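(* Let $\mathcal{H}_A,\mathcal{H}_B,\mathcal{H}_C$ be finite-dimensional Hilbert spaces, let $\rho_{ABC}$ be a pure state on $\mathcal{H}_A\otimes\mathcal{H}_B\otimes\mathcal{H}_C$, and let $Z=\{Z_j\}_{j=1}^N$ be a type of information about $A$. Let $\tilde\rho_{M_ZAB}=V_Z\rho_{AB}V_Z^\dagger$. Then, with entanglement measured across the bipartition $M_Z|AB$ of $\tilde\rho_{M_ZAB}$, (i) $E_D^{M_Z|AB}=E_R^{M_Z|AB}=H(Z|C)$; (ii) $E_G^{M_Z|AB}=1-p_{\mathrm{guess}}(Z|C)$.
   Context: A type of information $Z=\{Z_j\}_{j=1}^N$ about $A$ is a set of mutually orthogonal projectors on $\mathcal{H}_A$ with $\sum_j Z_j=I_A$. Let $M_Z$ be a register with orthonormal basis $\{|j\rangle\}_{j=1}^N$ and $V_Z=\sum_j |j\rangle_{M_Z}\otimes Z_j$ (identity on the other systems); $\rho_{AB}=\mathrm{Tr}_C\rho_{ABC}$. Let $\tilde\rho_{M_ZC}$ be the $M_ZC$ marginal of $V_Z\rho_{ABC}V_Z^\dagger$, which has the form $\sum_j p_j|j\rangle\langle j|\otimes\rho_{C,j}$ with $p_j=\mathrm{Tr}(Z_j\rho_A)$ and $p_j\rho_{C,j}=\mathrm{Tr}_A[(Z_j\otimes I_C)\rho_{AC}]$. Definitions: $H(\rho)=-\mathrm{Tr}(\rho\log_2\rho)$; $H(Z|C)=H(\tilde\rho_{M_ZC})-H(\rho_C)$; $p_{\mathrm{guess}}(Z|C)=\max_Q\sum_j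 p_j\mathrm{Tr}(Q_j\rho_{C,j})$ over POVMs $\{Q_j\}$ on $\mathcal{H}_C$. For a bipartite state $\rho_{XY}$: $E_D^{X|Y}$ is the distillable entanglement (optimal asymptotic rate of EPR pairs obtainable by LOCC); $E_R^{X|Y}(\rho_{XY})=\min_{\sigma\ \text{separable}}D(\rho_{XY}\|\sigma)$ with $D(\rho\|\sigma)=-H(\rho)-\mathrm{Tr}(\rho\log_2\sigma)$; $E_G^{X|Y}(\rho_{XY})=\min_{\sigma\ \text{separable}}[1-F(\rho_{XY},\sigma)]$ with $F(\rho,\sigma)=[\mathrm{Tr}(\sqrt{\rho}\sigma\sqrt{\rho})^{1/2}]^2$; separable means of the form $\sum_k q_k\sigma_{X,k}\otimes\sigma_{Y,k}$. *)

(* Defs.v *)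
From HB Require Import structures.
From mathcomp Require Import all_boot all_order all_algebra.
From mathcomp Require Import boolp classical_sets functions reals ereal exp topology normedtype sequences.
From mathcomp Require Import complex.
From mathcomp Require mxtens.

Set Implicit Arguments.
Unset Strict Implicit.
Unset Printing Implicit Defensive.

Import Order.TTheory GRing.Theory Num.Theory.
Import numFieldNormedType.Exports.
Local Open Scope ring_scope.
Local Open Scope classical_set_scope.

Section QInfo.
Variable R : realType.
Local Notation C := (R[i]).

Definition adj {m n} (A : 'M[C]_(m, n)) : 'M[C]_(n, m) := (map_mx Num.conj A)^T.

(* Kronecker product, index (i,j) of 'I_(m*n) is i*n+j *)
Definition kron {m n p q} (A : 'M[C]_(m, n)) (B : 'M[C]_(p, q)) :
  'M[C]_(m * p, n * q) := mxtens.tensmx A B.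

Definition ix {m n} (i : 'I_m) (j : 'I_n) : 'I_(m * n) :=
  mxtens.mxtens_index (i, j).

Definition ptr1 {m n} (M : 'M[C]_(m * n)) : 'M[C]_n :=
  \matrix_(j, l) \sum_(i < m) M (ix i j) (ix i l).
Definition ptr2 {m n} (M : 'M[C]_(m * n)) : 'M[C]_m :=
  \matrix_(i, k) \sum_(j < n) M (ix i j) (ix k j).
Definition ptr_mid {a b c} (M : 'M[C]_(a * b * c)) : 'M[C]_(a * c) :=
  \matrix_(k, l)
    \sum_(j < b) M (ix (ix (mxtens.mxtens_unindex k).1 j) (mxtens.mxtens_unindex k).2)
                   (ix (ix (mxtens.mxtens_unindex l).1 j) (mxtens.mxtens_unindex l).2).

Definition psd {n} (A : 'M[C]_n) : Prop :=
  adj A = A /\ forall v : 'rV[C]_n, 0 <= (v *m A *m adj v) 0 0.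
Definition density {n} (A : 'M[C]_n) : Prop := psd A /\ \tr A = 1.
Definition pure_state {n} (rho : 'M[C]_n) : Prop :=
  exists psi : 'cV[C]_n, adj psi *m psi = 1 /\ rho = psi *m adj psi.

(* functional calculus of a normal matrix through the spectral theorem
   A = P^-1 diag(sp) P  (mathcomp's spectralmx / spectral_diag);
   a real function f is applied to the (real parts of the) eigenvalues *)
Definition mxfun (f : R -> R) {n} (A : 'M[C]_n) : 'M[C]_n :=
  invmx (spectralmx A)
  *m diag_mx (map_mx (fun z : C => ((f (complex.Re z))%:C)%C) (spectral_diag A))
  *m spectralmx A.

Definition log2 (x : R) : R := ln x / ln 2.
(* eta(x) = - x log2 x, with 0 log 0 = 0 *)
Definition eta_fun (x : R) : R := if 0 < x then - (x * log2 x) else 0.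
(* logarithm on the support (value on the kernel irrelevant, see D) *)
Definition log2_supp (x : R) : R := if 0 < x then log2 x else 0.

Definition vN_entropy {n} (rho : 'M[C]_n) : R := complex.Re (\tr (mxfun eta_fun rho)).

(* relative entropy D(rho||sigma) = -H(rho) - Tr(rho log2 sigma), which is
   +oo when supp rho is not contained in supp sigma *)
Definition rel_entropy {n} (rho sigma : 'M[C]_n) : \bar R :=
  if (rho <= sigma)%MS
  then (- vN_entropy rho - complex.Re (\tr (rho *m mxfun log2_supp sigma)))%:E
  else +oo%E.

Definition sqrtm {n} (A : 'M[C]_n) : 'M[C]_n := mxfun Num.sqrt A.
Definition fidelity {n} (rho sigma : 'M[C]_n) : R :=
  (complex.Re (\tr (sqrtm (sqrtm rho *m sigma *m sqrtm rho)))) ^+ 2.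

Definition trace_norm {n} (M : 'M[C]_n) : R := complex.Re (\tr (sqrtm (adj M *m M))).

Definition separable {a b} (sigma : 'M[C]_(a * b)) : Prop :=
  exists (K : nat) (q : 'I_K -> R) (sx : 'I_K -> 'M[C]_a) (sy : 'I_K -> 'M[C]_b),
    (forall k, 0 <= q k) /\ \sum_k q k = 1 /\
    (forall k, density (sx k)) /\ (forall k, density (sy k)) /\
    sigma = \sum_k ((q k)%:C)%C *: kron (sx k) (sy k).

(* relative entropy of entanglement (infimum = minimum over separable states) *)
Definition E_R {a b} (rho : 'M[C]_(a * b)) : \bar R :=
  ereal_inf ((fun sigma => rel_entropy rho sigma) @` (@separable a b)).

Definition E_G {a b} (rho : 'M[C]_(a * b)) : R :=
  inf ((fun sigma => 1 - fidelity rho sigma) @` (@separable a b)).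

(* ----- LOCC protocols (finite number of rounds) -----
   locc a b a' b' : protocols taking X (dim a) | Y (dim b) to X' (dim a') |
   Y' (dim b').  At each node one party applies a quantum instrument
   (one Kraus operator per outcome, possibly changing its local dimension,
   sum K_i^dag K_i = 1) and broadcasts the outcome; the rest of the protocol
   may depend on all previous outcomes. *)
Inductive locc : nat -> nat -> nat -> nat -> Type :=
| locc_done a b : locc a b a b
| locc_alice a b a' b' (n : nat) (a1 : 'I_n -> nat)
    (K : forall i : 'I_n, 'M[C]_(a1 i, a))
    (HK : \sum_(i < n) adj (K i) *m K i = 1%:M)
    (next : forall i : 'I_n, locc (a1 i) b a' b') : locc a b a' b'
| locc_bob a b a' b' (n : nat) (b1 : 'I_n -> nat)
    (K : forall i : 'I_n, 'M[C]_(b1 i, b))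
    (HK : \sum_(i < n) adj (K i) *m K i = 1%:M)
    (next : forall i : 'I_n, locc a (b1 i) a' b') : locc a b a' b'.

Fixpoint locc_apply {a b a' b'} (P : locc a b a' b') :
    'M[C]_(a * b) -> 'M[C]_(a' * b') :=
  match P in locc a b a' b' return 'M[C]_(a * b) -> 'M[C]_(a' * b') with
  | locc_done _ _ => fun rho => rho
  | locc_alice a b _ _ n a1 K _ next => fun rho =>
      \sum_(i < n) locc_apply (next i)
         (kron (K i) (1%:M : 'M[C]_b) *m rho *m adj (kron (K i) (1%:M : 'M[C]_b)))
  | locc_bob a b _ _ n b1 K _ next => fun rho =>
      \sum_(i < n) locc_apply (next i)
         (kron (1%:M : 'M[C]_a) (K i) *m rho *m adj (kron (1%:M : 'M[C]_a) (K i)))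
  end.

(* bipartite tensor product: (X1|Y1) (x) (X2|Y2) as (X1 X2)|(Y1 Y2) *)
Definition btens {a b c d} (rho : 'M[C]_(a * b)) (sigma : 'M[C]_(c * d)) :
    'M[C]_((a * c) * (b * d)) :=
  \matrix_(k, l)
    (let x := mxtens.mxtens_unindex (mxtens.mxtens_unindex k).1 in
     let y := mxtens.mxtens_unindex (mxtens.mxtens_unindex k).2 in
     let x' := mxtens.mxtens_unindex (mxtens.mxtens_unindex l).1 in
     let y' := mxtens.mxtens_unindex (mxtens.mxtens_unindex l).2 in
     rho (ix x.1 y.1) (ix x'.1 y'.1) * sigma (ix x.2 y.2) (ix x'.2 y'.2)).

Fixpoint bpow {a b} (rho : 'M[C]_(a * b)) (n : nat) : 'M[C]_(a ^ n * b ^ n) :=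
  match n return 'M[C]_(a ^ n * b ^ n) with
  | 0 => 1%:M
  | n'.+1 =>
      let e := esym (congr2 muln (expnS a n') (expnS b n')) in
      castmx (e, e) (btens rho (bpow rho n'))
  end.

(* maximally entangled state of Schmidt rank d (for d = 2^m it is m EPR pairs) *)
Definition max_ent (d : nat) : 'M[C]_(d * d) :=
  \matrix_(k, l)
    (if (nat_of_ord (mxtens.mxtens_unindex k).1 == (mxtens.mxtens_unindex k).2)
        && (nat_of_ord (mxtens.mxtens_unindex l).1 == (mxtens.mxtens_unindex l).2)
     then (d%:R)^-1 else 0).

Definition achievable_rate {a b} (rho : 'M[C]_(a * b)) (r : R) : Prop :=
  exists P : forall n : nat,
      locc (a ^ n) (b ^ n) (2 ^ Num.truncn (r * n%:R)) (2 ^ Num.truncn (r * n%:R)),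
    (fun n => trace_norm (locc_apply (P n) (bpow rho n)
                          - max_ent (2 ^ Num.truncn (r * n%:R)))) @ \oo --> (0 : R).

Definition E_D {a b} (rho : 'M[C]_(a * b)) : \bar R :=
  ereal_sup ((fun r : R => r%:E) @` [set r : R | 0 <= r /\ achievable_rate rho r]).

Definition type_of_info {dA N} (Z : 'I_N -> 'M[C]_dA) : Prop :=
  (forall j, adj (Z j) = Z j) /\
  (forall j k, Z j *m Z k = if j == k then Z j else 0) /\
  \sum_j Z j = 1%:M.

Definition VZ {dA dB N} (Z : 'I_N -> 'M[C]_dA) : 'M[C]_(N * (dA * dB), dA * dB) :=
  castmx (erefl, mul1n (dA * dB))
    (\sum_j kron (delta_mx j 0 : 'M[C]_(N, 1)) (kron (Z j) (1%:M : 'M[C]_dB))).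

(* p_j rho_{C,j} = Tr_A[(Z_j (x) I_C) rho_AC] *)
Definition cond_state {dA dB dC N} (Z : 'I_N -> 'M[C]_dA)
    (rho : 'M[C]_(dA * dB * dC)) (j : 'I_N) : 'M[C]_dC :=
  ptr1 (kron (Z j) (1%:M : 'M[C]_dC) *m ptr_mid rho).

Definition rho_MC {dA dB dC N} (Z : 'I_N -> 'M[C]_dA)
    (rho : 'M[C]_(dA * dB * dC)) : 'M[C]_(N * dC) :=
  \sum_j kron (delta_mx j j : 'M[C]_N) (cond_state Z rho j).

Definition cond_entropy {dA dB dC N} (Z : 'I_N -> 'M[C]_dA)
    (rho : 'M[C]_(dA * dB * dC)) : R :=
  vN_entropy (rho_MC Z rho) - vN_entropy (ptr1 rho).

Definition POVM {d N} (Q : 'I_N -> 'M[C]_d) : Prop :=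
  (forall j, psd (Q j)) /\ \sum_j Q j = 1%:M.

Definition p_guess {dA dB dC N} (Z : 'I_N -> 'M[C]_dA)
    (rho : 'M[C]_(dA * dB * dC)) : R :=
  sup ((fun Q : 'I_N -> 'M[C]_dC =>
          \sum_j complex.Re (\tr (Q j *m cond_state Z rho j))) @` (@POVM dC N)).

Definition rho_tilde {dA dB dC N} (Z : 'I_N -> 'M[C]_dA)
    (rho : 'M[C]_(dA * dB * dC)) : 'M[C]_(N * (dA * dB)) :=
  VZ Z *m ptr2 rho *m adj (VZ Z).

End QInfo.

(* Main.v *)
(** Reshape the purification as an operator [X] from [C] to [A (x) B], so that
    [rho_AB = X X^+] and [rho_C = X^+ X], up to transposition.  With the
    orthogonal projections [P_j = Z_j (x) 1], the measured state is
    [Psi Psi^+], where [Psi] is the column of blocks [P_j X], and the states of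
    [C] conditioned on [j] are the [S_j = X^+ P_j X].

    (i) The separable state [sum_j |j><j| (x) P_j X X^+ P_j] has relative entropy
    [H(Z|C)] to the measured state, because [Y Y^+] and [Y^+ Y] have the same
    nonzero spectrum; this bounds [E_R].  [E_D <= E_R]: the projection on the
    maximally entangled state of rank [K], pulled back through the protocol, is
    a test of weight at most [1/K] on separable states, while hypothesis testing
    between the n-th powers of [rho] and [sigma] reduces, by Nussbaum and Szkola,
    to Chebyshev's inequality for a classical log-likelihood ratio.  For
    [H(Z|C) <= E_D], Alice measures a hash of [j], with signs protecting the
    coherence within each hash class.  If the hash is chosen such that every
    class has conditional state close to [rho_C / K], in Hilbert-Schmidt norm
    after cutting off atypical eigenvalues, then by a Powers-Stoermer
    inequality Bob decodes the class coherently, which leaves a state close to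
    the maximally entangled one of rank [K].

    (ii) If [sigma = W W^+], the fidelity of [Psi Psi^+] and [sigma] is the squared
    trace norm of [W^+ Psi].  For [sigma] separable, the columns of [W] may be
    taken to be product vectors [a_i (x) b_i]; if the contraction [V] attains the
    trace norm, Cauchy-Schwarz bounds it by the guessing probability of the POVM
    mixing the [v_i v_i^+], [v_i] being the columns of [V], with weights
    proportional to [|a_i(j)| * |P_j b_i|].  Conversely, the columns
    [P_j X sqrt(Q_j)] of a POVM [Q] form, after normalization, a separable state
    of fidelity at least its guessing probability. *)

From HB Require Import structures.
From mathcomp Require Import all_boot all_order all_algebra.
From mathcomp Require Import boolp classical_sets functions reals ereal exp topology normedtype sequences.
From mathcomp Require Import complex ring lra.
From mathcomp Require mxtens.
Require Import Defs.
Set Implicit Arguments.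
Unset Strict Implicit.
Unset Printing Implicit Defensive.
Import Order.TTheory GRing.Theory Num.Theory.
Import numFieldNormedType.Exports.
Local Open Scope ring_scope.

(** * Real parts and squared moduli of complex numbers *)

Section LinAlg.
Variable R : realType.
Local Notation C := (R[i]).
Local Notation "x %:C" := (real_complex R x) (format "x %:C").

Lemma ReD (x y : C) : complex.Re (x + y) = complex.Re x + complex.Re y.
Proof. by case: x; case: y. Qed.

Lemma ReN (x : C) : complex.Re (- x) = - complex.Re x.
Proof. by case: x. Qed.

Lemma Re_sum (I : Type) (r : seq I) (P : pred I) (F : I -> C) :
  complex.Re (\sum_(i <- r | P i) F i) = \sum_(i <- r | P i) complex.Re (F i).
Proof. exact: (big_morph _ ReD (erefl _)). Qed.

Lemma ReZl (a : R) (z : C) : complex.Re (a%:C * z) = a * complex.Re z.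
Proof. by case: z => x y /=; rewrite mul0r subr0. Qed.

Lemma Re_conj (z : C) : complex.Re (z^*) = complex.Re z.
Proof. by case: z. Qed.

Definition nsq (z : C) : R := complex.Re z ^+ 2 + complex.Im z ^+ 2.

Lemma nsq_ge0 z : 0 <= nsq z.
Proof. by rewrite addr_ge0 ?sqr_ge0. Qed.

Lemma nsqE z : z^* * z = (nsq z)%:C.
Proof.
rewrite /nsq; case: z => a b; apply/eqP; rewrite eq_complex /=; apply/andP; split; apply/eqP; ring.
Qed.

Lemma nsq_eq0 z : nsq z = 0 -> z = 0.
Proof.
move=> h; apply/eqP; rewrite -normr_eq0 -sqrf_eq0 -add_Re2_Im2.
by rewrite -/(nsq z) h.
Qed.

Lemma nsqM x y : nsq (x * y) = nsq x * nsq y.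
Proof. rewrite /nsq; case: x => a b; case: y => c d /=; ring. Qed.

Lemma nsqC x : nsq (x^*) = nsq x.
Proof. rewrite /nsq; case: x => a b /=; ring. Qed.

Lemma nsq_real (a : R) : nsq a%:C = a ^+ 2.
Proof. by rewrite /nsq /= expr0n addr0. Qed.

Lemma conj_real (a : R) : (a%:C : C)^* = a%:C.
Proof. by apply/eqP; rewrite eq_complex /= oppr0 !eqxx. Qed.

(** * Adjoints and the real trace form *)

Lemma adjE m n (A : 'M[C]_(m, n)) i j : adj A i j = (A j i)^*.
Proof. by rewrite !mxE. Qed.

Lemma adjK m n (A : 'M[C]_(m, n)) : adj (adj A) = A.
Proof. by apply/matrixP=> i j; rewrite !adjE conjCK. Qed.

Lemma adjM m n p (A : 'M[C]_(m, n)) (B : 'M[C]_(n, p)) :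
  adj (A *m B) = adj B *m adj A.
Proof. by rewrite /adj map_mxM trmx_mul. Qed.

Lemma adjD m n (A B : 'M[C]_(m, n)) : adj (A + B) = adj A + adj B.
Proof. by apply/matrixP=> i j; rewrite !mxE rmorphD. Qed.

Lemma adjN m n (A : 'M[C]_(m, n)) : adj (- A) = - adj A.
Proof. by apply/matrixP=> i j; rewrite !mxE rmorphN. Qed.

Lemma adjB m n (A B : 'M[C]_(m, n)) : adj (A - B) = adj A - adj B.
Proof. by rewrite adjD adjN. Qed.

Lemma adj0 m n : adj (0 : 'M[C]_(m, n)) = 0.
Proof. by apply/matrixP=> i j; rewrite !mxE rmorph0. Qed.

Lemma adj_1 n : adj (1%:M : 'M[C]_n) = 1%:M.
Proof. by apply/matrixP=> i j; rewrite !mxE rmorph_nat eq_sym. Qed.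

Lemma adj_sum m n (I : Type) (r : seq I) (P : pred I) (F : I -> 'M[C]_(m, n)) :
  adj (\sum_(i <- r | P i) F i) = \sum_(i <- r | P i) adj (F i).
Proof. exact: (big_morph _ (@adjD m n) (adj0 m n)). Qed.

Lemma adjZ m n (a : C) (A : 'M[C]_(m, n)) : adj (a *: A) = a^* *: adj A.
Proof. by apply/matrixP=> i j; rewrite !mxE rmorphM. Qed.

Lemma adjZr m n (a : R) (A : 'M[C]_(m, n)) : adj (a%:C *: A) = a%:C *: adj A.
Proof. by rewrite adjZ conj_real. Qed.

Lemma adj_kron m n p q (A : 'M[C]_(m, n)) (B : 'M[C]_(p, q)) :
  adj (kron A B) = kron (adj A) (adj B).
Proof. by apply/matrixP=> i j; rewrite !mxE rmorphM. Qed.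

Lemma kronM m n p q r s (A : 'M[C]_(m, n)) (B : 'M[C]_(p, q))
  (A' : 'M[C]_(n, r)) (B' : 'M[C]_(q, s)) :
  kron A B *m kron A' B' = kron (A *m A') (B *m B').
Proof. exact: mxtens.tensmx_mul. Qed.

Opaque adj.

Definition rtr n (A : 'M[C]_n) : R := complex.Re (\tr A).

Lemma rtrD n (A B : 'M[C]_n) : rtr (A + B) = rtr A + rtr B.
Proof. by rewrite /rtr mxtraceD ReD. Qed.

Lemma rtrN n (A : 'M[C]_n) : rtr (- A) = - rtr A.
Proof. by rewrite /rtr raddfN ReN. Qed.

Lemma rtrB n (A B : 'M[C]_n) : rtr (A - B) = rtr A - rtr B.
Proof. by rewrite rtrD rtrN. Qed.

Lemma rtr0 n : rtr (0 : 'M[C]_n) = 0.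
Proof. by rewrite /rtr mxtrace0. Qed.

Lemma rtr_sum n (I : Type) (r : seq I) (P : pred I) (F : I -> 'M[C]_n) :
  rtr (\sum_(i <- r | P i) F i) = \sum_(i <- r | P i) rtr (F i).
Proof. exact: (big_morph _ (@rtrD n) (rtr0 n)). Qed.

Lemma rtrZ n (a : R) (A : 'M[C]_n) : rtr (a%:C *: A) = a * rtr A.
Proof. by rewrite /rtr mxtraceZ ReZl. Qed.

Lemma rtrC m n (A : 'M[C]_(m, n)) (B : 'M[C]_(n, m)) :
  rtr (A *m B) = rtr (B *m A).
Proof. by rewrite /rtr mxtrace_mulC. Qed.

Lemma rtr_adj n (A : 'M[C]_n) : rtr (adj A) = rtr A.
Proof.
by rewrite /rtr /mxtrace !Re_sum; apply: eq_bigr => i _; rewrite adjE Re_conj.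
Qed.

Lemma rtr_trmx n (A : 'M[C]_n) : rtr (A^T) = rtr A.
Proof. by rewrite /rtr mxtrace_tr. Qed.

Definition ip m n (A B : 'M[C]_(m, n)) : R := rtr (adj A *m B).
Definition hs m n (A : 'M[C]_(m, n)) : R := ip A A.

Lemma ipC m n (A B : 'M[C]_(m, n)) : ip A B = ip B A.
Proof. by rewrite /ip -rtr_adj adjM adjK. Qed.

Lemma ipDr m n (A B B' : 'M[C]_(m, n)) : ip A (B + B') = ip A B + ip A B'.
Proof. by rewrite /ip mulmxDr rtrD. Qed.

Lemma ipDl m n (A A' B : 'M[C]_(m, n)) : ip (A + A') B = ip A B + ip A' B.
Proof. by rewrite ipC ipDr !(ipC B). Qed.

Lemma ipNr m n (A B : 'M[C]_(m, n)) : ip A (- B) = - ip A B.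
Proof. by rewrite /ip mulmxN rtrN. Qed.

Lemma ipBr m n (A B B' : 'M[C]_(m, n)) : ip A (B - B') = ip A B - ip A B'.
Proof. by rewrite ipDr ipNr. Qed.

Lemma ipBl m n (A A' B : 'M[C]_(m, n)) : ip (A - A') B = ip A B - ip A' B.
Proof. by rewrite ipC ipBr !(ipC B). Qed.

Lemma ipZr m n (a : R) (A B : 'M[C]_(m, n)) : ip A (a%:C *: B) = a * ip A B.
Proof. by rewrite /ip -scalemxAr rtrZ. Qed.

Lemma ipZl m n (a : R) (A B : 'M[C]_(m, n)) : ip (a%:C *: A) B = a * ip A B.
Proof. by rewrite ipC ipZr ipC. Qed.

Lemma ip_sumr m n (I : Type) (r : seq I) (P : pred I) A (F : I -> 'M[C]_(m, n)) :
  ip A (\sum_(i <- r | P i) F i) = \sum_(i <- r | P i) ip A (F i).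
Proof. by rewrite /ip mulmx_sumr rtr_sum. Qed.

Lemma ip_suml m n (I : Type) (r : seq I) (P : pred I) A (F : I -> 'M[C]_(m, n)) :
  ip (\sum_(i <- r | P i) F i) A = \sum_(i <- r | P i) ip (F i) A.
Proof. by rewrite ipC ip_sumr; apply: eq_bigr => i _; rewrite ipC. Qed.

Lemma hsE m n (A : 'M[C]_(m, n)) : hs A = \sum_j \sum_i nsq (A i j).
Proof.
rewrite /hs /ip /rtr /mxtrace Re_sum; apply: eq_bigr => i _.
by rewrite mxE Re_sum; apply: eq_bigr => j _; rewrite adjE nsqE.
Qed.

Lemma hs_ge0 m n (A : 'M[C]_(m, n)) : 0 <= hs A.
Proof. by rewrite hsE; do 2![apply: sumr_ge0 => ? _]; apply: nsq_ge0. Qed.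

Lemma hs_eq0 m n (A : 'M[C]_(m, n)) : hs A = 0 -> A = 0.
Proof.
rewrite hsE => /eqP; rewrite psumr_eq0; last first.
  by move=> j _; apply: sumr_ge0 => ? _; apply: nsq_ge0.
move=> /allP h; apply/matrixP=> i j; rewrite mxE; apply: nsq_eq0.
have /= := h j (mem_index_enum _); rewrite psumr_eq0 => [/allP/(_ i (mem_index_enum _))/eqP //|? _].
exact: nsq_ge0.
Qed.

Lemma hs_adj m n (A : 'M[C]_(m, n)) : hs (adj A) = hs A.
Proof. by rewrite /hs /ip adjK rtrC. Qed.

Lemma hsD m n (A B : 'M[C]_(m, n)) : hs (A + B) = hs A + 2 * ip A B + hs B.
Proof. rewrite /hs !(ipDl, ipDr) (ipC B A); ring. Qed.

Lemma hsB m n (A B : 'M[C]_(m, n)) : hs (A - B) = hs A - 2 * ip A B + hs B.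
Proof. rewrite /hs !(ipBl, ipBr) (ipC B A); ring. Qed.

Lemma hsZ m n (a : R) (A : 'M[C]_(m, n)) : hs (a%:C *: A) = a ^+ 2 * hs A.
Proof. rewrite /hs ipZl ipZr; ring. Qed.

(** The squared norm of [(hs B) A - (ip A B) B] equals [hs B] times the wanted difference; the case
    [hs B = 0] is separate. *)
Lemma ip_cauchy m n (A B : 'M[C]_(m, n)) : ip A B ^+ 2 <= hs A * hs B.
Proof.
have := hs_ge0 ((hs B)%:C *: A - (ip A B)%:C *: B).
rewrite hsB !hsZ ipZl ipZr => h.
have [B0|B0] := eqVneq (hs B) 0.
  by rewrite (hs_eq0 B0) /ip mulmx0 rtr0 expr0n mulr_ge0 ?hs_ge0.
have Bp : 0 < hs B by rewrite lt_def B0 hs_ge0.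
rewrite -subr_ge0 -(pmulr_rge0 _ Bp).
move: h; set a := hs A; set b := hs B; set c := ip A B => h.
have -> : b * (a * b - c ^+ 2) = b ^+ 2 * a - 2 * (b * (c * c)) + c ^+ 2 * b by ring.
by [].
Qed.

Lemma ip_le_sqrt m n (A B : 'M[C]_(m, n)) :
  `|ip A B| <= Num.sqrt (hs A) * Num.sqrt (hs B).
Proof.
rewrite -sqrtrM ?hs_ge0 // -sqrtr_sqr ler_sqrt ?ip_cauchy //.
by rewrite mulr_ge0 ?hs_ge0.
Qed.

(** * Positive semidefinite matrices and functional calculus *)

Definition dg n (d : 'I_n -> R) : 'M[C]_n := diag_mx (\row_i (d i)%:C).

Lemma dgE n (d : 'I_n -> R) i j : dg d i j = (d i)%:C *+ (i == j).
Proof. by rewrite !mxE. Qed.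

Lemma adj_dg n (d : 'I_n -> R) : adj (dg d) = dg d.
Proof.
apply/matrixP=> i j; rewrite adjE !dgE eq_sym.
by case: eqP => [->|_]; rewrite ?mulr1n ?conj_real ?mulr0n ?rmorph0.
Qed.

Lemma dgM n (d e : 'I_n -> R) : dg d *m dg e = dg (fun i => d i * e i).
Proof.
rewrite /dg mulmx_diag; congr diag_mx; apply/rowP=> i.
by rewrite !mxE rmorphM.
Qed.

Lemma dg1 n : dg (fun _ : 'I_n => 1) = 1%:M.
Proof. by apply/matrixP=> i j; rewrite dgE !mxE. Qed.

Lemma dgB n (d e : 'I_n -> R) : dg d - dg e = dg (fun i => d i - e i).
Proof. by apply/matrixP=> i j; rewrite !mxE rmorphB mulrnBl. Qed.

Lemma eq_dg n (d e : 'I_n -> R) : d =1 e -> dg d = dg e.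
Proof. by move=> h; congr diag_mx; apply/rowP=> i; rewrite !mxE h. Qed.

Lemma mul_dg_l n m (d : 'I_n -> R) (A : 'M[C]_(n, m)) i j :
  (dg d *m A) i j = (d i)%:C * A i j.
Proof. by rewrite /dg mul_diag_mx !mxE. Qed.

Lemma mul_dg_r n m (d : 'I_n -> R) (A : 'M[C]_(m, n)) i j :
  (A *m dg d) i j = A i j * (d j)%:C.
Proof. by rewrite /dg mul_mx_diag !mxE. Qed.

Lemma rtr_dg n (d : 'I_n -> R) : rtr (dg d) = \sum_i d i.
Proof.
by rewrite /rtr mxtrace_diag Re_sum; apply: eq_bigr => i _; rewrite mxE.
Qed.

Definition unitary n (U : 'M[C]_n) := U *m adj U = 1%:M.

Lemma unitaryV n (U : 'M[C]_n) : unitary U -> adj U *m U = 1%:M.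
Proof. exact: mulmx1C. Qed.

Lemma unitary_adj n (U : 'M[C]_n) : unitary U -> unitary (adj U).
Proof. by rewrite /unitary adjK; exact: unitaryV. Qed.

Lemma adj_spec n (A : 'M[C]_n) : adj A = map_mx Num.conj (A^T).
Proof. by apply/matrixP=> i j; rewrite adjE !mxE. Qed.

Lemma hermitian_spectral n (A : 'M[C]_n) : adj A = A ->
  exists U (d : 'I_n -> R), unitary U /\ A = adj U *m dg d *m U.
Proof.
move=> hA.
have herm : A \is hermsymmx.
  by apply/is_hermitianmxP; rewrite expr0 scale1r -adj_spec hA.
have sU := spectral_unitarymx A.
exists (spectralmx A), (fun i => complex.Re (spectral_diag A 0 i)); split.
  by move/unitarymxP: sU; rewrite /unitary adj_spec.
have e := orthomx_spectralP (hermitian_normalmx herm).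
rewrite [LHS]e (invmx_unitary sU) adj_spec.
congr (_ *m _ *m _); congr diag_mx; apply/rowP=> i; rewrite mxE.
by rewrite RRe_real //; have /mxOverP := hermitian_spectral_diag_real herm; apply.
Qed.

(** Wherever [W i j] is nonzero, the intertwining forces [s i = d j], hence [t i = e j]. *)
Lemma diag_intertwine m n (s t : 'rV[C]_m) (d e : 'rV[C]_n) (W : 'M[C]_(m, n)) :
  diag_mx s *m W = W *m diag_mx d ->
  (forall i j, s 0 i = d 0 j -> t 0 i = e 0 j) ->
  diag_mx t *m W = W *m diag_mx e.
Proof.
move=> /matrixP h te; apply/matrixP=> i j; have := h i j.
rewrite !mul_diag_mx !mul_mx_diag !mxE.
have [->|w0] := eqVneq (W i j) 0; first by rewrite !mul0r !mulr0.
by rewrite mulrC => /(mulfI w0) /te ->; rewrite mulrC.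
Qed.

(* Both diagonalizations are intertwined by [W = P *m adj U], whose nonzero
   entries connect only equal eigenvalues. *)
Lemma mxfun_diag (f : R -> R) n (U : 'M[C]_n) (d : 'I_n -> R) :
  unitary U -> mxfun f (adj U *m dg d *m U) = adj U *m dg (fun i => f (d i)) *m U.
Proof.
move=> hU; set A := adj U *m dg d *m U.
have hA : adj A = A by rewrite /A !adjM adjK adj_dg mulmxA.
have herm : A \is hermsymmx.
  by apply/is_hermitianmxP; rewrite expr0 scale1r -adj_spec hA.
have sP := spectral_unitarymx A.
have eA := orthomx_spectralP (hermitian_normalmx herm).
rewrite /mxfun; move: sP eA; set P := spectralmx A; set s := spectral_diag A.
move=> sP; rewrite (invmx_unitary sP) -adj_spec => eA.
have hP : unitary P by move/unitarymxP: sP; rewrite -adj_spec.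
pose W := P *m adj U.
have eW : diag_mx s *m W = W *m dg d.
  transitivity (P *m (adj P *m diag_mx s *m P) *m adj U).
    by rewrite /W !mulmxA hP mul1mx.
  by rewrite -[X in P *m X]eA /W /A -!mulmxA hU mulmx1.
set fs := map_mx _ s.
have eW' : diag_mx fs *m W = W *m dg (fun i => f (d i)).
  by apply: (diag_intertwine eW) => i j; rewrite !mxE => ->.
transitivity (adj P *m (diag_mx fs *m W) *m U).
  by rewrite /W -!mulmxA (unitaryV hU) mulmx1.
by rewrite eW' /W !mulmxA (unitaryV hP) mul1mx.
Qed.

End LinAlg.

Section Psd.
Variable R : realType.
Local Notation C := (R[i]).
Local Notation "x %:C" := (real_complex R x) (format "x %:C").
Opaque adj.

Lemma hs_row m n (A : 'M[C]_(m, n)) i :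
  hs (row i A) = complex.Re ((A *m adj A) i i).
Proof.
rewrite hsE mxE Re_sum; apply: eq_bigr => j _.
by rewrite big_ord1 mxE adjE mulrC nsqE.
Qed.

Lemma ip_rows m n (A B : 'M[C]_(m, n)) :
  ip A B = \sum_i ip (row i A) (row i B).
Proof.
rewrite /ip rtrC /rtr /mxtrace Re_sum; apply: eq_bigr => i _.
rewrite -[RHS]/(rtr _) rtrC /rtr /mxtrace big_ord1 !mxE.
by congr complex.Re; apply: eq_bigr => j _; rewrite !adjE !mxE.
Qed.

Lemma psd_adj n (A : 'M[C]_n) : psd A -> adj A = A.
Proof. by case. Qed.

Lemma psd_gram m n (B : 'M[C]_(m, n)) : psd (adj B *m B).
Proof.
split; first by rewrite adjM adjK.
move=> v; have -> : v *m (adj B *m B) *m adj v = (v *m adj B) *m adj (v *m adj B).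
  by rewrite adjM adjK !mulmxA.
rewrite mxE sumr_ge0 // => j _.
by rewrite adjE mulrC nsqE ler0c nsq_ge0.
Qed.

Lemma psd_gram' m n (B : 'M[C]_(m, n)) : psd (B *m adj B).
Proof. by rewrite -{1}[B]adjK; apply: psd_gram. Qed.

Lemma conj_diag_entry n m (U : 'M[C]_(m, n)) (A : 'M[C]_n) i :
  (row i U *m A *m adj (row i U)) 0 0 = (U *m A *m adj U) i i.
Proof.
rewrite -row_mul !mxE; apply: eq_bigr => j _; rewrite !adjE.
by congr (_ * _^*); rewrite !mxE.
Qed.

Lemma psd_diag_ge0 n m (U : 'M[C]_(m, n)) (A : 'M[C]_n) i :
  psd A -> 0 <= complex.Re ((U *m A *m adj U) i i).
Proof.
case=> _ /(_ (row i U)); rewrite conj_diag_entry lecE => /andP[_].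
by [].
Qed.

Lemma psd_spectral n (A : 'M[C]_n) : psd A ->
  exists U (d : 'I_n -> R),
    [/\ unitary U, forall i, 0 <= d i & A = adj U *m dg d *m U].
Proof.
move=> pA; have [U [d [hU eA]]] := hermitian_spectral (psd_adj pA).
exists U, d; split=> // i.
have := psd_diag_ge0 U i pA.
have -> : U *m A *m adj U = dg d.
  by rewrite eA !mulmxA hU mul1mx -mulmxA hU mulmx1.
by rewrite dgE eqxx mulr1n.
Qed.

Lemma psd_conj m n (K : 'M[C]_(m, n)) (A : 'M[C]_n) :
  psd A -> psd (K *m A *m adj K).
Proof.
case=> hA pA; split; first by rewrite !adjM adjK hA mulmxA.
by move=> v; have := pA (v *m K); rewrite adjM !mulmxA.
Qed.

Lemma psd_conj' m n (K : 'M[C]_(n, m)) (A : 'M[C]_n) :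
  psd A -> psd (adj K *m A *m K).
Proof. by move=> pA; rewrite -{2}[K]adjK; apply: psd_conj. Qed.

Lemma psd_dg n (d : 'I_n -> R) : (forall i, 0 <= d i) -> psd (dg d).
Proof.
move=> d0; have -> : dg d = adj (dg (fun i => Num.sqrt (d i))) *m dg (fun i => Num.sqrt (d i)).
  by rewrite adj_dg dgM; apply: eq_dg => i; rewrite -expr2 sqr_sqrtr.
exact: psd_gram.
Qed.

Lemma psd_sqrt n (A : 'M[C]_n) : psd A -> exists B : 'M[C]_n, A = adj B *m B.
Proof.
case/psd_spectral=> U [d [hU d0 ->]].
exists (dg (fun i => Num.sqrt (d i)) *m U).
rewrite adjM adj_dg !mulmxA; congr (_ *m _).
rewrite -mulmxA dgM; congr (_ *m _).
by apply: eq_dg => i; rewrite -expr2 sqr_sqrtr.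
Qed.

Lemma psd0 n : psd (0 : 'M[C]_n).
Proof. by rewrite -(mulmx0 _ (adj (0 : 'M[C]_n))); apply: psd_gram. Qed.

Lemma psd1 n : psd (1%:M : 'M[C]_n).
Proof. by have := psd_gram (1%:M : 'M[C]_n); rewrite adj_1 mulmx1. Qed.

Lemma psdD n (A B : 'M[C]_n) : psd A -> psd B -> psd (A + B).
Proof.
move=> [hA pA] [hB pB]; split; first by rewrite adjD hA hB.
by move=> v; rewrite mulmxDr mulmxDl mxE addr_ge0.
Qed.

Lemma psd_sum n (I : Type) (r : seq I) (P : pred I) (F : I -> 'M[C]_n) :
  (forall i, P i -> psd (F i)) -> psd (\sum_(i <- r | P i) F i).
Proof. by apply: big_ind; [apply: psd0 | move=> ? ?; apply: psdD]. Qed.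

Lemma psdZ n (a : R) (A : 'M[C]_n) : 0 <= a -> psd A -> psd (a%:C *: A).
Proof.
move=> a0 [hA pA]; split; first by rewrite adjZr hA.
by move=> v; rewrite -scalemxAr -scalemxAl mxE mulr_ge0 // ler0c.
Qed.

Lemma psd_kron m n (A : 'M[C]_m) (B : 'M[C]_n) : psd A -> psd B -> psd (kron A B).
Proof.
move=> /psd_sqrt[a ->] /psd_sqrt[b ->].
by rewrite -kronM -adj_kron; apply: psd_gram.
Qed.

Lemma adj_trmx m n (A : 'M[C]_(m, n)) : adj (A^T) = (adj A)^T.
Proof. by apply/matrixP=> i j; rewrite adjE [RHS]mxE adjE mxE. Qed.

Lemma psd_trmx n (A : 'M[C]_n) : psd A -> psd (A^T).
Proof.
move=> /psd_sqrt[a ->]; rewrite trmx_mul -adj_trmx -{1}[a^T]adjK.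
exact: psd_gram.
Qed.

Lemma psd_rtrM n (A B : 'M[C]_n) : psd A -> psd B -> 0 <= rtr (A *m B).
Proof.
move=> /psd_sqrt[a ->] /psd_sqrt[b ->].
have -> : rtr (adj a *m a *m (adj b *m b)) = hs (a *m adj b).
  by rewrite /hs /ip adjM adjK [RHS]rtrC -!mulmxA rtrC !mulmxA.
exact: hs_ge0.
Qed.

Lemma psd_rtr n (A : 'M[C]_n) : psd A -> 0 <= rtr A.
Proof. by move=> pA; rewrite -[A]mulmx1; apply: psd_rtrM => //; apply: psd1. Qed.

(** [T - T^2] is [T (1 - T) T + (1 - T) T (1 - T)], a sum of two positive conjugates. *)
Lemma psd_subsqr n (T : 'M[C]_n) : psd T -> psd (1%:M - T) -> psd (T - T *m T).
Proof.
move=> pT pT'.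
have -> : T - T *m T = adj T *m (1%:M - T) *m T
                     + adj (1%:M - T) *m T *m (1%:M - T).
  rewrite (psd_adj pT) (psd_adj pT') !(mulmxBl, mulmxBr, mul1mx, mulmx1).
  by rewrite [RHS]addrC subrK.
by apply: psdD; apply: psd_conj'.
Qed.

(** With [W = 1 - V V^+], one has [W = W^+ W + V (1 - V^+ V) V^+]. *)
Lemma contraction_adj m n (V : 'M[C]_(m, n)) :
  psd (1%:M - adj V *m V) -> psd (1%:M - V *m adj V).
Proof.
move=> h; set W := 1%:M - V *m adj V.
have hW : adj W = W by rewrite /W adjB adj_1 adjM adjK.
have -> : W = adj W *m W + V *m (1%:M - adj V *m V) *m adj V.
  rewrite hW /W !(mulmxBl, mulmxBr, mul1mx, mulmx1) !mulmxA.
  by rewrite subrK.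
by apply: psdD; [apply: psd_gram | apply: psd_conj].
Qed.

Lemma mxfun_psd (f : R -> R) n (A : 'M[C]_n) :
  adj A = A -> (forall x, 0 <= f x) -> psd (mxfun f A).
Proof.
move=> /hermitian_spectral[U [d [hU ->]]] f0; rewrite (mxfun_diag _ _ hU).
by apply: psd_conj'; apply: psd_dg => i.
Qed.

Lemma sqrtm_psd n (A : 'M[C]_n) : psd A -> psd (sqrtm A).
Proof. by move=> pA; apply: mxfun_psd => [|x]; rewrite ?sqrtr_ge0 //; apply: psd_adj. Qed.

Lemma conj_dgM n (U : 'M[C]_n) (d e : 'I_n -> R) : unitary U ->
  (adj U *m dg d *m U) *m (adj U *m dg e *m U)
  = adj U *m dg (fun i => d i * e i) *m U.
Proof.
move=> hU; rewrite -dgM -!mulmxA (mulmxA U (adj U)) hU mul1mx.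
by rewrite !mulmxA.
Qed.

Lemma adj_conj_dg n (U : 'M[C]_n) (d : 'I_n -> R) :
  adj (adj U *m dg d *m U) = adj U *m dg d *m U.
Proof. by rewrite !adjM adjK adj_dg mulmxA. Qed.

Lemma rtr_conj_dg n (U : 'M[C]_n) (d : 'I_n -> R) : unitary U ->
  rtr (adj U *m dg d *m U) = \sum_i d i.
Proof. by move=> hU; rewrite rtrC mulmxA hU mul1mx rtr_dg. Qed.

Lemma conj_dg_eq n (U : 'M[C]_n) (d e : 'I_n -> R) : d =1 e ->
  adj U *m dg d *m U = adj U *m dg e *m U.
Proof. by move=> /eq_dg ->. Qed.

Lemma conj_dg1 n (U : 'M[C]_n) : unitary U -> adj U *m dg (fun=> 1) *m U = 1%:M.
Proof. by move=> hU; rewrite dg1 mulmx1 unitaryV. Qed.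

Lemma conj_dgB n (U : 'M[C]_n) (d e : 'I_n -> R) :
  adj U *m dg d *m U - adj U *m dg e *m U = adj U *m dg (fun i => d i - e i) *m U.
Proof. by rewrite -dgB mulmxBr mulmxBl. Qed.

Lemma sqrtm_sqr n (A : 'M[C]_n) : psd A -> sqrtm A *m sqrtm A = A.
Proof.
case/psd_spectral=> U [d [hU d0 ->]]; rewrite /sqrtm (mxfun_diag _ _ hU) (conj_dgM _ _ hU).
by apply: conj_dg_eq => i; rewrite -expr2 sqr_sqrtr.
Qed.

(* [W] intertwines the two spectral decompositions and [W W^+], [W^+ W] are the
   eigenvalues, so both traces equal the sum of [f d_i / d_i * |W i j|^2]. *)
Lemma rtr_mxfun_gram (f : R -> R) m n (X : 'M[C]_(m, n)) : f 0 = 0 ->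
  rtr (mxfun f (X *m adj X)) = rtr (mxfun f (adj X *m X)).
Proof.
move=> f0.
have [U [d [hU _ eA]]] := psd_spectral (psd_gram' X).
have [V [e [hV _ eB]]] := psd_spectral (psd_gram X).
rewrite eA eB (mxfun_diag _ _ hU) (mxfun_diag _ _ hV) (rtr_conj_dg _ hU) (rtr_conj_dg _ hV).
pose W := U *m X *m adj V.
have eW : dg d *m W = W *m dg e.
  have -> : dg d = U *m (X *m adj X) *m adj U.
    by rewrite eA !mulmxA hU mul1mx -mulmxA hU mulmx1.
  have -> : dg e = V *m (adj X *m X) *m adj V.
    by rewrite eB !mulmxA hV mul1mx -mulmxA hV mulmx1.
  rewrite /W -!mulmxA; congr (_ *m _).
  rewrite (mulmxA (adj U)) unitaryV // mul1mx.
  by rewrite (mulmxA (adj V)) unitaryV // mul1mx !mulmxA.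
have WW i : d i = \sum_j nsq (W i j).
  have : W *m adj W = dg d.
    rewrite /W !adjM adjK -!mulmxA (mulmxA (adj V)) unitaryV // mul1mx.
    have -> : X *m (adj X *m adj U) = adj U *m dg d *m U *m adj U by rewrite -eA !mulmxA.
    by rewrite -!mulmxA hU mulmx1 mulmxA hU mul1mx.
  move/matrixP/(_ i i)/(congr1 (@complex.Re _)); rewrite -hs_row hsE dgE eqxx mulr1n /= => <-.
  by apply: eq_bigr => j _; rewrite big_ord1 mxE.
have WW' j : e j = \sum_i nsq (W i j).
  have : adj W *m W = dg e.
    rewrite /W !adjM adjK -!mulmxA (mulmxA (adj U)) unitaryV // mul1mx.
    have -> : adj X *m (X *m adj V) = adj V *m dg e *m V *m adj V by rewrite -eB !mulmxA.
    by rewrite -!mulmxA hV mulmx1 mulmxA hV mul1mx.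
  rewrite -{2}[W]adjK.
  move/matrixP/(_ j j)/(congr1 (@complex.Re _)); rewrite -hs_row hsE dgE eqxx mulr1n /= => <-.
  by apply: eq_bigr => i _; rewrite big_ord1 mxE adjE nsqC.
pose g x := f x / x.
have fg x : f x = g x * x.
  by rewrite /g; have [->|x0] := eqVneq x 0; [rewrite f0 !mul0r | rewrite divfK].
transitivity (\sum_i \sum_j g (d i) * nsq (W i j)).
  by apply: eq_bigr => i _; rewrite fg {2}WW mulr_sumr.
rewrite exchange_big; apply: eq_bigr => j _; rewrite fg {2}WW' mulr_sumr.
apply: eq_bigr => i _; move/matrixP/(_ i j): eW; rewrite mul_dg_l mul_dg_r.
have [->|W0] := eqVneq (W i j) 0; first by rewrite /nsq /= !expr0n /= addr0 !mulr0.
by rewrite mulrC => /(mulfI W0) [] ->.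
Qed.

(** * Trace norm *)

(** The trace norm for rectangular matrices, since overlaps [G^+ F] of Gram factors need not be
    square. *)
Definition tnorm m n (B : 'M[C]_(m, n)) : R := rtr (sqrtm (B *m adj B)).

Lemma tnorm_ge0 m n (B : 'M[C]_(m, n)) : 0 <= tnorm B.
Proof. by apply: psd_rtr; apply: sqrtm_psd; apply: psd_gram'. Qed.

Lemma tnorm_adj m n (B : 'M[C]_(m, n)) : tnorm (adj B) = tnorm B.
Proof. by rewrite /tnorm adjK; apply/esym/rtr_mxfun_gram/sqrtr0. Qed.

(** Cauchy-Schwarz row by row in the eigenbasis of [B B^+]: the rows of [U B] have squared norms
    [d i], those of [U V^+] at most 1. *)
Lemma tnorm_ge m n (B : 'M[C]_(m, n)) (V : 'M[C]_(n, m)) :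
  psd (1%:M - adj V *m V) -> rtr (V *m B) <= tnorm B.
Proof.
move=> hV; have [U [d [hU d0 eA]]] := psd_spectral (psd_gram' B).
rewrite /tnorm /sqrtm eA (mxfun_diag _ _ hU) (rtr_conj_dg _ hU).
have -> : rtr (V *m B) = ip (U *m adj V) (U *m B).
  by rewrite /ip adjM adjK mulmxA -(mulmxA V) unitaryV // mulmx1.
rewrite ip_rows; apply: ler_sum => i _.
apply: le_trans (ler_norm _) _; apply: le_trans (ip_le_sqrt _ _) _.
have -> : hs (row i (U *m B)) = d i.
  rewrite hs_row adjM !mulmxA -(mulmxA U) eA !mulmxA hU mul1mx -mulmxA hU mulmx1.
  by rewrite dgE eqxx.
rewrite -[leRHS]mul1r ler_wpM2r ?sqrtr_ge0 // -sqrtr1 ler_wsqrtr //.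
rewrite hs_row adjM adjK.
have := psd_diag_ge0 U i hV.
have -> : U *m (1%:M - adj V *m V) *m adj U = 1%:M - U *m adj V *m (V *m adj U).
  by rewrite mulmxBr mulmxBl mulmx1 hU !mulmxA.
move: (U *m adj V *m (V *m adj U)) => M.
by rewrite !mxE eqxx ReD ReN subr_ge0.
Qed.

(** The maximizer is the adjoint of the polar part of [B], namely [B^+] times the inverse square
    root of [B B^+]; as [0^-1 = 0], the inverse is taken on the support. *)
Lemma tnorm_attained m n (B : 'M[C]_(m, n)) :
  exists V : 'M[C]_(n, m), psd (1%:M - adj V *m V) /\ rtr (V *m B) = tnorm B.
Proof.
have [U [d [hU d0 eA]]] := psd_spectral (psd_gram' B).
pose s i := (Num.sqrt (d i))^-1.
exists (adj B *m (adj U *m dg s *m U)); split.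
  rewrite adjM adjK adj_conj_dg mulmxA -(mulmxA _ B) eA !(conj_dgM _ _ hU).
  rewrite -(conj_dg1 hU) conj_dgB; apply: psd_conj'; apply: psd_dg => i /=.
  rewrite subr_ge0 /s.
  have [->|d1] := eqVneq (d i) 0; first by rewrite mulr0 mul0r ler01.
  have : Num.sqrt (d i) != 0 by rewrite sqrtr_eq0 -ltNge lt_def d1 d0.
  move=> h; rewrite -{2}(sqr_sqrtr (d0 i)) expr2 mulrA mulVf // mul1r divff //.
rewrite -mulmxA rtrC -mulmxA eA (conj_dgM _ _ hU) /tnorm /sqrtm eA (mxfun_diag _ _ hU).
rewrite !(rtr_conj_dg _ hU); apply: eq_bigr => i _; rewrite /s.
have [->|d1] := eqVneq (d i) 0; first by rewrite mulr0 sqrtr0.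
have : Num.sqrt (d i) != 0 by rewrite sqrtr_eq0 -ltNge lt_def d1 d0.
by move=> h; rewrite -{2}(sqr_sqrtr (d0 i)) expr2 mulrA mulVf // mul1r.
Qed.

Lemma trace_norm_dg n (U : 'M[C]_n) (d : 'I_n -> R) : unitary U ->
  trace_norm (adj U *m dg d *m U) = \sum_i `|d i|.
Proof.
move=> hU; rewrite /trace_norm -/(rtr _) adj_conj_dg (conj_dgM _ _ hU) /sqrtm.
rewrite (mxfun_diag _ _ hU) (rtr_conj_dg _ hU); apply: eq_bigr => i _.
by rewrite -expr2 sqrtr_sqr.
Qed.

(* A Powers-Stoermer type inequality. *)
Lemma hs_sub_sqr n (A B P : 'M[C]_n) :
  psd A -> psd B -> adj P = P -> P *m P = P -> P *m A = A -> P *m B = B ->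
  hs (A - B) <= Num.sqrt (rtr P) * Num.sqrt (hs (A *m A - B *m B)).
Proof.
move=> pA pB hP PP PA PB; set M := A *m A - B *m B.
have hD : adj (A - B) = A - B by rewrite adjB !psd_adj.
have [U [d [hU eD]]] := hermitian_spectral hD.
(* [sg] is the sign of [A - B]; it commutes with [A - B], and the product is the absolute value
   [ab]. *)
pose sg := adj U *m dg (fun i => Num.sg (d i)) *m U.
pose ab := adj U *m dg (fun i => `|d i|) *m U.
have sgD : sg *m (A - B) = ab.
  by rewrite eD (conj_dgM _ _ hU); apply: conj_dg_eq => i; rewrite -normrEsg.
have Dsg : (A - B) *m sg = ab.
  by rewrite eD (conj_dgM _ _ hU); apply: conj_dg_eq => i; rewrite mulrC -normrEsg.
(* [2 M] is the symmetrized product of [A - B] and [A + B], and cyclicity brings [sg] next to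
   [A - B] in both orders. *)
have e1 : rtr (sg *m M) = rtr (ab *m (A + B)).
  have e2 : 2 * rtr (sg *m M) = rtr (sg *m (A - B) *m (A + B)) + rtr (sg *m (A + B) *m (A - B)).
    have eM : (A - B) *m (A + B) + (A + B) *m (A - B) = M + M.
      rewrite /M !(mulmxDl, mulmxDr, mulmxN, mulNmx).
      move: (A *m A) (A *m B) (B *m A) (B *m B) => a b c e.
      by apply/matrixP=> i j; rewrite !mxE; ring.
    by rewrite -rtrD -!(mulmxA sg) -mulmxDr eM mulmxDr rtrD; ring.
  have e3 : rtr (sg *m (A + B) *m (A - B)) = rtr (ab *m (A + B)).
    by rewrite rtrC mulmxA Dsg.
  apply: (mulfI (_ : 2 != 0 :> R)); first by rewrite pnatr_eq0.
  by rewrite e2 e3 sgD mulr_natl mulr2n.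
(* In the eigenbasis of [A - B], the diagonal entries [a], [b] of [A], [B] are nonnegative with
   [a - b = d i], so [|d i| <= a + b]. *)
have e4 : hs (A - B) <= rtr (sg *m M).
  have -> : hs (A - B) = \sum_i `|d i| * `|d i|.
    rewrite /hs /ip hD eD (conj_dgM _ _ hU) (rtr_conj_dg _ hU).
    by apply: eq_bigr => i _; rewrite -normrM ger0_norm // -expr2 sqr_ge0.
  rewrite e1 /ab -!mulmxA rtrC /rtr /mxtrace Re_sum.
  apply: ler_sum => i _; rewrite -mulmxA mul_dg_l ReZl.
  apply: ler_wpM2l; rewrite ?normr_ge0 //.
  have ed : complex.Re ((U *m (A - B) *m adj U) i i) = d i.
    by rewrite eD !mulmxA hU mul1mx -mulmxA hU mulmx1 dgE eqxx.
  have := psd_diag_ge0 U i pA; have := psd_diag_ge0 U i pB; move: ed.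
  rewrite mulmxBr mulmxBl mulmxDr mulmxDl.
  move: (U *m A *m adj U) (U *m B *m adj U) => a b.
  rewrite !mxE !ReD ReN => <- b0 a0.
  by rewrite ler_norml; apply/andP; split; lra.
apply: le_trans e4 _.
(* With [P] inserted, Cauchy-Schwarz costs the rank of [P] rather than the full dimension. *)
have PM : M = P *m M by rewrite /M mulmxBr !mulmxA PA PB.
have hsg : adj sg = sg by rewrite adj_conj_dg.
have -> : rtr (sg *m M) = ip (P *m sg) M.
  by rewrite /ip adjM hP hsg -mulmxA -PM.
apply: le_trans (ler_norm _) _; apply: le_trans (ip_le_sqrt _ _) _.
apply: ler_wpM2r; rewrite ?sqrtr_ge0 // ler_wsqrtr //.
rewrite -subr_ge0.
have -> : rtr P - hs (P *m sg) = rtr (P *m (1%:M - sg *m sg)).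
  rewrite /hs /ip adjM hP hsg -mulmxA (mulmxA P) PP rtrC -mulmxA.
  by rewrite mulmxBr mulmx1 rtrB.
apply: psd_rtrM; first by rewrite -PP -{1}hP; apply: psd_gram.
rewrite (conj_dgM _ _ hU) -(conj_dg1 hU) conj_dgB.
apply: psd_conj'; apply: psd_dg => i.
by rewrite subr_ge0 -expr2 sqr_sg lern1 leq_b1.
Qed.

End Psd.

(** * LOCC protocols *)

Section Locc.
Variable R : realType.
Local Notation C := (R[i]).
Local Notation "x %:C" := (real_complex R x) (format "x %:C").
Opaque adj.

Lemma sum_ix (V : nmodType) m n (F : 'I_(m * n) -> V) :
  \sum_k F k = \sum_i \sum_j F (ix i j).
Proof.
rewrite pair_big (reindex (@mxtens.mxtens_index m n)) //=.
  by apply: eq_bigr => -[i j].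
by exists (@mxtens.mxtens_unindex m n) => k _; rewrite (mxtens.mxtens_indexK, mxtens.mxtens_unindexK).
Qed.

Lemma ixK m n (i : 'I_m) (j : 'I_n) : mxtens.mxtens_unindex (ix i j) = (i, j).
Proof. exact: mxtens.mxtens_indexK. Qed.

Lemma ix_eq m n (i k : 'I_m) (j l : 'I_n) : (ix i j == ix k l) = (i == k) && (j == l).
Proof. by rewrite (can_eq (@mxtens.mxtens_indexK m n)). Qed.

Lemma kronE m n p q (A : 'M[C]_(m, n)) (B : 'M[C]_(p, q)) i j k l :
  kron A B (ix i j) (ix k l) = A i k * B j l.
Proof. exact: mxtens.tensmxE. Qed.

Lemma matrix_ixP m n p q (A B : 'M[C]_(m * n, p * q)) :
  (forall i j k l, A (ix i j) (ix k l) = B (ix i j) (ix k l)) -> A = B.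
Proof.
move=> h; apply/matrixP=> i k.
by case: (mxtens.mxtens_indexP i) => i0 i1; case: (mxtens.mxtens_indexP k) => k0 k1; apply: h.
Qed.

Lemma kron11 m n : kron (1%:M : 'M[C]_m) (1%:M : 'M[C]_n) = 1%:M.
Proof.
apply: matrix_ixP => i j k l; rewrite kronE !mxE ix_eq.
by case: eqP; case: eqP; rewrite ?(mulr1, mulr0).
Qed.

Lemma kronDl m n p q (A A' : 'M[C]_(m, n)) (B : 'M[C]_(p, q)) :
  kron (A + A') B = kron A B + kron A' B.
Proof. by apply/matrixP=> i j; rewrite !mxE mulrDl. Qed.

Lemma kronDr m n p q (A : 'M[C]_(m, n)) (B B' : 'M[C]_(p, q)) :
  kron A (B + B') = kron A B + kron A B'.
Proof. by apply/matrixP=> i j; rewrite !mxE mulrDr. Qed.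

Lemma kron0l m n p q (B : 'M[C]_(p, q)) : kron (0 : 'M[C]_(m, n)) B = 0.
Proof. exact: mxtens.tens0mx. Qed.

Lemma kron0r m n p q (B : 'M[C]_(p, q)) : kron B (0 : 'M[C]_(m, n)) = 0.
Proof. exact: mxtens.tensmx0. Qed.

Lemma kron_suml m n p q (I : Type) (r : seq I) (P : pred I)
  (F : I -> 'M[C]_(m, n)) (B : 'M[C]_(p, q)) :
  kron (\sum_(i <- r | P i) F i) B = \sum_(i <- r | P i) kron (F i) B.
Proof.
by apply: (big_morph (fun A => kron A B)) => [A A'|]; rewrite (kronDl, kron0l).
Qed.

Lemma kron_sumr m n p q (I : Type) (r : seq I) (P : pred I)
  (B : 'M[C]_(m, n)) (F : I -> 'M[C]_(p, q)) :
  kron B (\sum_(i <- r | P i) F i) = \sum_(i <- r | P i) kron B (F i).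
Proof.
by apply: (big_morph (fun A => kron B A)) => [A A'|]; rewrite (kronDr, kron0r).
Qed.

(** The trace of a positive matrix is real, so the real part of the product of traces splits. *)
Lemma rtr_kron m n (A : 'M[C]_m) (B : 'M[C]_n) : psd A -> psd B ->
  rtr (kron A B) = rtr A * rtr B.
Proof.
move=> pA pB.
have -> : rtr (kron A B) = complex.Re (\tr A * \tr B).
  congr complex.Re; rewrite /mxtrace sum_ix mulr_suml; apply: eq_bigr => i _.
  by rewrite mulr_sumr; apply: eq_bigr => j _; rewrite kronE.
have [U [d [hU _ ->]]] := psd_spectral pA.
by rewrite /rtr mxtrace_mulC mulmxA hU mul1mx mxtrace_diag;
  rewrite (eq_bigr (fun i => (d i)%:C)) => [|i _]; rewrite ?mxE // -rmorph_sum ReZl.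
Qed.

Lemma kraus_alice a b n (a1 : 'I_n -> nat) (K : forall i, 'M[C]_(a1 i, a)) :
  \sum_i adj (K i) *m K i = 1%:M ->
  \sum_i adj (kron (K i) (1%:M : 'M[C]_b)) *m kron (K i) 1%:M = 1%:M.
Proof.
move=> h; rewrite -kron11 -h kron_suml; apply: eq_bigr => i _.
by rewrite adj_kron kronM adj_1 mulmx1.
Qed.

Lemma kraus_bob a b n (b1 : 'I_n -> nat) (K : forall i, 'M[C]_(b1 i, b)) :
  \sum_i adj (K i) *m K i = 1%:M ->
  \sum_i adj (kron (1%:M : 'M[C]_a) (K i)) *m kron 1%:M (K i) = 1%:M.
Proof.
move=> h; rewrite -kron11 -h kron_sumr; apply: eq_bigr => i _.
by rewrite adj_kron kronM adj_1 mulmx1.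
Qed.

Lemma rtr_kraus n k (m : 'I_k -> nat) (K : forall i, 'M[C]_(m i, n)) (rho : 'M[C]_n) :
  \sum_i adj (K i) *m K i = 1%:M ->
  \sum_i rtr (K i *m rho *m adj (K i)) = rtr rho.
Proof.
move=> h; rewrite -[in RHS](mul1mx rho) -h mulmx_suml rtr_sum.
by apply: eq_bigr => i _; rewrite rtrC mulmxA.
Qed.

Lemma locc_psd_rtr a b a' b' (P : locc R a b a' b') (rho : 'M[C]_(a * b)) :
  psd rho -> psd (locc_apply P rho) /\ rtr (locc_apply P rho) = rtr rho.
Proof.
elim: P rho => [//|{}a {}b {}a' {}b' n a1 K HK next IH|{}a {}b {}a' {}b' n b1 K HK next IH] rho prho /=.
- split; first by apply: psd_sum => i _; apply: (IH i _ _).1; apply: psd_conj.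
  rewrite -(rtr_kraus rho (kraus_alice b HK)) rtr_sum.
  by apply: eq_bigr => i _; apply: (IH i _ _).2; apply: psd_conj.
- split; first by apply: psd_sum => i _; apply: (IH i _ _).1; apply: psd_conj.
  rewrite -(rtr_kraus rho (kraus_bob a HK)) rtr_sum.
  by apply: eq_bigr => i _; apply: (IH i _ _).2; apply: psd_conj.
Qed.

Definition effect n (T : 'M[C]_n) := psd T /\ psd (1%:M - T).

Lemma effect_kraus n k (m : 'I_k -> nat) (K : forall i, 'M[C]_(m i, n))
  (T : forall i, 'M[C]_(m i)) :
  \sum_i adj (K i) *m K i = 1%:M -> (forall i, effect (T i)) ->
  effect (\sum_i adj (K i) *m T i *m K i).
Proof.
move=> hK hT; split; first by apply: psd_sum => i _; apply: psd_conj'; case: (hT i).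
have -> : 1%:M - \sum_i adj (K i) *m T i *m K i = \sum_i adj (K i) *m (1%:M - T i) *m K i.
  rewrite -{1}hK -sumrB; apply: eq_bigr => i _.
  by rewrite mulmxBr mulmxBl mulmx1.
by apply: psd_sum => i _; apply: psd_conj'; case: (hT i).
Qed.

Lemma rtr_effect_kraus n k (m : 'I_k -> nat) (K : forall i, 'M[C]_(m i, n))
  (T : forall i, 'M[C]_(m i)) rho :
  \sum_i rtr (T i *m (K i *m rho *m adj (K i))) =
  rtr ((\sum_i adj (K i) *m T i *m K i) *m rho).
Proof.
rewrite mulmx_suml rtr_sum; apply: eq_bigr => i _.
by rewrite -!mulmxA [in RHS]rtrC !mulmxA.
Qed.

(** The dual of the protocol, built round by round: the adjoint Kraus maps are unital and positive,
    so they send tests to tests. *)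
Lemma locc_heisenberg a b a' b' (P : locc R a b a' b') (E : 'M[C]_(a' * b')) :
  effect E -> exists T : 'M[C]_(a * b),
    effect T /\ forall rho, rtr (E *m locc_apply P rho) = rtr (T *m rho).
Proof.
elim: P E => [{}a {}b|{}a {}b {}a' {}b' n a1 K HK next IH|{}a {}b {}a' {}b' n b1 K HK next IH] E hE /=.
- by exists E.
- have [T hT] := fin_all_exists (fun i => IH i E hE).
  exists (\sum_i adj (kron (K i) 1%:M) *m T i *m kron (K i) 1%:M); split.
    by apply: effect_kraus => [|i]; [apply: kraus_alice | case: (hT i)].
  move=> rho; rewrite -rtr_effect_kraus mulmx_sumr rtr_sum.
  by apply: eq_bigr => i _; case: (hT i) => _ ->.
- have [T hT] := fin_all_exists (fun i => IH i E hE).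
  exists (\sum_i adj (kron 1%:M (K i)) *m T i *m kron 1%:M (K i)); split.
    by apply: effect_kraus => [|i]; [apply: kraus_bob | case: (hT i)].
  move=> rho; rewrite -rtr_effect_kraus mulmx_sumr rtr_sum.
  by apply: eq_bigr => i _; case: (hT i) => _ ->.
Qed.

(** [B] is dominated by its trace times the identity. *)
Lemma psd_rtrM_le n (A B : 'M[C]_n) : psd A -> psd B ->
  rtr (A *m B) <= rtr A * rtr B.
Proof.
move=> pA pB; have : psd ((rtr B)%:C *: 1%:M - B).
  have [U [d [hU d0 ->]]] := psd_spectral pB.
  rewrite (rtr_conj_dg _ hU) -(conj_dg1 hU).
  have -> : (\sum_i d i)%:C *: (adj U *m dg (fun=> 1) *m U)
     = adj U *m dg (fun=> \sum_i d i) *m U.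
    rewrite scalemxAl scalemxAr; congr (_ *m _ *m _).
    by apply/matrixP=> i j; rewrite mxE !dgE mulrnAr mulr1.
  rewrite conj_dgB; apply: psd_conj'; apply: psd_dg => i.
  by rewrite (bigD1 i) //= addrAC subrr add0r sumr_ge0.
move=> /(psd_rtrM pA); rewrite mulmxBr rtrB -scalemxAr mulmx1 rtrZ subr_ge0.
by rewrite mulrC.
Qed.

(** * Maximally entangled states *)

Definition max_vec (K : nat) : 'cV[C]_(K * K) :=
  \col_k (if (nat_of_ord (mxtens.mxtens_unindex k).1 == (mxtens.mxtens_unindex k).2)
          then ((Num.sqrt K%:R)^-1)%:C else 0).

Lemma max_entE K : max_ent R K = max_vec K *m adj (max_vec K).
Proof.
apply/matrixP=> k l; rewrite !mxE big_ord1 adjE !mxE.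
have e : ((K%:R)^-1 : C) = ((Num.sqrt K%:R)^-1)%:C * ((Num.sqrt K%:R)^-1)%:C.
  by rewrite -rmorphM -invfM -expr2 sqr_sqrtr ?ler0n // fmorphV rmorph_nat.
case: ifP => [/andP[-> ->]|]; first by rewrite conj_real.
by case: eqP => //= _; [move=> ->; rewrite rmorph0 mulr0 | rewrite mul0r].
Qed.

Lemma max_vec_norm K : (0 < K)%N -> adj (max_vec K) *m max_vec K = 1%:M.
Proof.
move=> K0; rewrite [LHS]mx11_scalar mxE sum_ix; congr (_%:M).
rewrite (eq_bigr (fun=> ((K%:R)^-1 : C))) => [|i _].
  rewrite sumr_const card_ord -[LHS]mulr_natl.
  by apply: (mulfV (_ : (K%:R : C) != 0)); rewrite pnatr_eq0 -lt0n.
rewrite (bigD1 i) //= big1 => [|j ji]; last first.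
  by rewrite adjE !mxE ixK /= ifN ?mulr0 //; apply: contra ji => /eqP e; apply/eqP/val_inj.
rewrite adjE !mxE ixK /= eqxx conj_real addr0.
by rewrite -rmorphM -invfM -expr2 sqr_sqrtr ?ler0n // fmorphV rmorph_nat.
Qed.

Lemma effect_vec n (v : 'cV[C]_n) : adj v *m v = 1%:M -> effect (v *m adj v).
Proof.
move=> h; split; first exact: psd_gram'.
by apply: contraction_adj; rewrite h subrr; apply: psd0.
Qed.

Lemma max_ent_effect K : (0 < K)%N -> effect (max_ent R K).
Proof. by move=> /max_vec_norm h; rewrite max_entE; apply: effect_vec. Qed.

Lemma rtr_max_ent_kron K (x y : 'M[C]_K) :
  rtr (max_ent R K *m kron x y) = (K%:R)^-1 * rtr (x *m y^T).
Proof.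
rewrite -ReZl /rtr; congr complex.Re.
rewrite fmorphV rmorph_nat /mxtrace sum_ix mulr_sumr.
transitivity (\sum_(i < K) \sum_(j < K) (K%:R)^-1 * (x j i * y j i)).
  apply: eq_bigr => i _; rewrite (bigD1 i) //= [X in _ + X]big1 ?addr0.
    rewrite mxE sum_ix; apply: eq_bigr => j _.
    rewrite (bigD1 j) //= [X in _ + X]big1 ?addr0 => [|l lj].
      by rewrite kronE mxE !ixK /= !eqxx.
    rewrite mxE !ixK /= eqxx /= ifN ?mul0r //.
    by apply: contra lj => /eqP e; apply/eqP/val_inj.
  move=> j ji; rewrite mxE big1 // => l _.
  rewrite mxE !ixK /= ifN ?mul0r // negb_and; apply/orP; left.
  by apply: contra ji => /eqP e; apply/eqP/val_inj.
rewrite exchange_big; apply: eq_bigr => i _; rewrite mxE mulr_sumr.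
by apply: eq_bigr => j _; rewrite mxE.
Qed.

(** Every branch of the protocol keeps a product a product, and at the leaves the overlap is
    [tr (x y^T) / K]. The two output dimensions are separate variables linked by [e], as the
    induction on [P] requires independent indices. *)
Lemma locc_product_bound a b K K' (P : locc R a b K K') (e : K = K')
  (x : 'M[C]_a) (y : 'M[C]_b) : psd x -> psd y ->
  rtr (castmx (congr1 (muln K) e, congr1 (muln K) e) (max_ent R K) *m locc_apply P (kron x y))
    <= (K%:R)^-1 * (rtr x * rtr y).
Proof.
elim: P e x y => [{}a {}b|{}a {}b {}a' {}b' n a1 L HL next IH|{}a {}b {}a' {}b' n b1 L HL next IH] e x y px py /=.
- case: _ / e y py => y py; rewrite castmx_id rtr_max_ent_kron.
  rewrite ler_wpM2l ?invr_ge0 ?ler0n // -(rtr_trmx y).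
  exact: psd_rtrM_le px (psd_trmx py).
- rewrite mulmx_sumr rtr_sum -(rtr_kraus x HL) mulr_suml mulr_sumr.
  apply: ler_sum => i _; rewrite adj_kron !kronM adj_1 mul1mx mulmx1.
  by apply: IH => //; apply: psd_conj.
- rewrite mulmx_sumr rtr_sum -(rtr_kraus y HL) mulr_sumr mulr_sumr.
  apply: ler_sum => i _; rewrite adj_kron !kronM adj_1 mul1mx mulmx1.
  by apply: IH => //; apply: psd_conj.
Qed.

Lemma sum_enum_val (V : nmodType) (I : finType) (F : I -> V) :
  \sum_i F i = \sum_(k < #|I|) F (enum_val k).
Proof.
transitivity (\sum_(i in I) F i); last exact: big_enum_val.
by apply: eq_bigl.
Qed.

(** Alice broadcasts one outcome and Bob answers with an instrument depending on it. Outcomes range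
    over any finite types, such as sign patterns, and are enumerated to fit [locc]. *)
Lemma locc_one_way a b k (I : finType) (J : finType)
  (K : I -> 'M[C]_(k, a)) (L : I -> J -> 'M[C]_(k, b)) :
  \sum_i adj (K i) *m K i = 1%:M ->
  (forall i, \sum_j adj (L i j) *m L i j = 1%:M) ->
  exists P : locc R a b k k, forall rho, locc_apply P rho =
    \sum_i \sum_j kron (K i) (L i j) *m rho *m adj (kron (K i) (L i j)).
Proof.
move=> hK hL.
have hK' : \sum_(i < #|I|) adj (K (enum_val i)) *m K (enum_val i) = 1%:M.
  by rewrite -(sum_enum_val (fun i => adj (K i) *m K i)).
have hL' (i : 'I_#|I|) : \sum_(j < #|J|) adj (L (enum_val i) (enum_val j)) *m L (enum_val i) (enum_val j) = 1%:M.
  by rewrite -(sum_enum_val (fun j => adj (L (enum_val i) j) *m L (enum_val i) j)).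
pose bob (i : 'I_#|I|) : locc R k b k k := locc_bob (hL' i) (fun j => locc_done R k k).
exists (locc_alice hK' bob) => rho /=.
rewrite [RHS]sum_enum_val; apply: eq_bigr => i _.
rewrite [RHS]sum_enum_val; apply: eq_bigr => j _.
have -> : kron (K (enum_val i)) (L (enum_val i) (enum_val j)) =
   kron 1%:M (L (enum_val i) (enum_val j)) *m kron (K (enum_val i)) 1%:M.
  by rewrite kronM mul1mx mulmx1.
by rewrite adjM !mulmxA.
Qed.

(** * Trace distance and fidelity to a pure state *)

(** In the eigenbasis of [M], the diagonal entries of a test lie between 0 and 1. *)
Lemma rtr_effect_trace_norm n (T M : 'M[C]_n) : effect T -> adj M = M ->
  `|rtr (T *m M)| <= trace_norm M.
Proof.
move=> [pT pT'] /hermitian_spectral[U [d [hU ->]]].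
rewrite (trace_norm_dg _ hU) mulmxA rtrC !mulmxA.
rewrite /rtr /mxtrace Re_sum; apply: le_trans (ler_norm_sum _ _ _) _.
apply: ler_sum => i _; rewrite mul_dg_r mulrC ReZl normrM -[leRHS]mulr1.
apply: ler_wpM2l; rewrite ?normr_ge0 //.
rewrite ger0_norm; last exact: psd_diag_ge0.
have := psd_diag_ge0 U i pT'; rewrite mulmxBr mulmxBl mulmx1 hU.
move: (U *m T *m adj U) => A.
by rewrite !mxE eqxx ReD ReN subr_ge0.
Qed.

Lemma rtr_sign_le n (S A : 'M[C]_n) : psd A -> psd (1%:M - S) -> psd (1%:M + S) ->
  `|rtr (S *m A)| <= rtr A.
Proof.
move=> pA p1 p2; have := psd_rtrM p1 pA; have := psd_rtrM p2 pA.
rewrite mulmxBl mulmxDl mul1mx rtrB rtrD => h1 h2.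
by rewrite ler_norml; apply/andP; split; lra.
Qed.

(** Splits [w] into blocks along [P + Q = 1]. The block at [P], minus [P], and the block at [Q]
    contribute at most [1 - F] each; the two off-diagonal blocks contribute [sqrt (1 - F)] each by
    Cauchy-Schwarz. *)
Lemma pinched_sign_bound n (S P Q w : 'M[C]_n) (F : R) :
  adj S = S -> psd (1%:M - S) -> psd (1%:M + S) -> psd (1%:M - S *m S) ->
  psd P -> psd Q -> psd w -> P + Q = 1%:M -> P *m P = P -> Q *m Q = Q ->
  rtr w = 1 -> rtr (w *m P) = F -> rtr P = 1 -> P *m w *m P = F%:C *: P ->
  rtr (S *m (w - P)) <= 2 * (1 - F) + 2 * Num.sqrt (1 - F).
Proof.
move=> hS pS1 pS2 pSS pP pQ pw PQ PP QQ w1 eF rP ePwP.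
have hP := psd_adj pP; have hQ := psd_adj pQ.
have F0 : 0 <= F by rewrite -eF; exact: psd_rtrM pw pP.
have F1 : rtr (w *m Q) = 1 - F.
  have : rtr w = rtr (w *m P) + rtr (w *m Q) by rewrite -rtrD -mulmxDr PQ mulmx1.
  by rewrite w1 eF => ->; rewrite addrAC subrr add0r.
have F1' : 0 <= 1 - F by rewrite -F1; exact: psd_rtrM pw pQ.
have ew : w - P = (F - 1)%:C *: P + (P *m w *m Q + Q *m w *m P) + Q *m w *m Q.
  have -> : (F - 1)%:C *: P = P *m w *m P - P by rewrite rmorphB rmorph1 scalerBl scale1r ePwP.
  have e0 : w = P *m w *m P + (P *m w *m Q + Q *m w *m P) + Q *m w *m Q.
    have {1}-> : w = (P + Q) *m w *m (P + Q) by rewrite PQ mul1mx mulmx1.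
    rewrite mulmxDr !mulmxDl !addrA; congr (_ + _); exact: addrAC.
  rewrite {1}e0 addrAC; congr (_ + _); exact: addrAC.
have eX : rtr (S *m (Q *m w *m P)) = rtr (S *m (P *m w *m Q)).
  by rewrite -rtr_adj !adjM hS hP hQ (psd_adj pw) rtrC !mulmxA.
have e1 : rtr (S *m (w - P)) = (F - 1) * rtr (S *m P) + 2 * rtr (S *m (P *m w *m Q))
            + rtr (S *m (Q *m w *m Q)).
  by rewrite ew 3!mulmxDr 3!rtrD eX -scalemxAr rtrZ mulr_natl mulr2n.
have b1 : (F - 1) * rtr (S *m P) <= 1 - F.
  have := rtr_sign_le pP pS1 pS2; rewrite rP ler_norml => /andP[h _].
  rewrite -subr_ge0; have -> : 1 - F - (F - 1) * rtr (S *m P) = (1 - F) * (rtr (S *m P) + 1) by ring.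
  by apply: mulr_ge0 => //; rewrite -lerBlDr sub0r.
have eQ : rtr (Q *m w *m Q) = 1 - F by rewrite rtrC mulmxA QQ rtrC F1.
have b3 : rtr (S *m (Q *m w *m Q)) <= 1 - F.
  apply: le_trans (ler_norm _) _; rewrite -eQ.
  by apply: (rtr_sign_le _ pS1 pS2); rewrite -{2}hQ; apply: psd_conj.
have b2 : rtr (S *m (P *m w *m Q)) <= Num.sqrt (1 - F).
  have [B eB] := psd_sqrt pw.
  have -> : rtr (S *m (P *m w *m Q)) = ip (B *m P *m S) (B *m Q).
    by rewrite /ip !adjM hS hP eB !mulmxA.
  apply: le_trans (ler_norm _) _; apply: le_trans (ip_le_sqrt _ _) _.
  have -> : hs (B *m Q) = 1 - F by rewrite /hs /ip adjM hQ -eQ eB !mulmxA.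
  rewrite -[leRHS]mul1r ler_wpM2r ?sqrtr_ge0 // -sqrtr1 ler_wsqrtr //.
  have -> : hs (B *m P *m S) = rtr (P *m w *m P *m (S *m S)).
    by rewrite /hs /ip !adjM hS hP eB -!mulmxA rtrC !mulmxA.
  have h : 0 <= rtr (P *m w *m P *m (1%:M - S *m S)).
    by apply: psd_rtrM pSS; rewrite -{2}hP; apply: psd_conj.
  rewrite mulmxBr mulmx1 rtrB subr_ge0 in h; apply: le_trans h _.
  by rewrite ePwP rtrZ rP mulr1 -subr_ge0.
rewrite e1; move: (rtr (S *m P)) (rtr (S *m (P *m w *m Q))) (rtr (S *m (Q *m w *m Q))) (Num.sqrt (1 - F)) b1 b2 b3.
by clear => x y z s; lra.
Qed.

(** A Fuchs-van de Graaf type bound with weaker constants: the sign of [w - v v^+] attains the trace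
    norm, and compressing [w] by the rank-one projection [v v^+] gives [F] times that projection. *)
Lemma trace_norm_pure n (w : 'M[C]_n) (v : 'cV[C]_n) (F := rtr (v *m adj v *m w)) :
  psd w -> rtr w = 1 -> adj v *m v = 1%:M ->
  trace_norm (w - v *m adj v) <= 2 * (1 - F) + 2 * Num.sqrt (1 - F).
Proof.
move=> pw w1 hv; set P := v *m adj v.
have hP : adj P = P by rewrite /P adjM adjK.
have PP : P *m P = P by rewrite /P mulmxA -(mulmxA v) hv mulmx1.
have hM : adj (w - P) = w - P by rewrite adjB hP (psd_adj pw).
have [U [d [hU eM]]] := hermitian_spectral hM.
have [S [hS pS1 pS2 pSS eS]] : exists S : 'M[C]_n, [/\ adj S = S, psd (1%:M - S), psd (1%:M + S),
   psd (1%:M - S *m S) & trace_norm (w - P) = rtr (S *m (w - P))].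
  exists (adj U *m dg (fun i => Num.sg (d i)) *m U).
  have sg1 i : -1 <= Num.sg (d i) <= 1 by case: sgrP => _; lra.
  split; first exact: adj_conj_dg.
  - rewrite -(conj_dg1 hU) conj_dgB; apply: psd_conj'; apply: psd_dg => i.
    by have /andP[] := sg1 i; rewrite subr_ge0.
  - have -> : 1%:M + adj U *m dg (fun i => Num.sg (d i)) *m U =
       1%:M - adj U *m dg (fun i => - Num.sg (d i)) *m U.
      rewrite -[in RHS](conj_dg1 hU) conj_dgB -[X in X + _](conj_dg1 hU) -mulmxDl -mulmxDr.
      by congr (_ *m _ *m _); apply/matrixP=> i j; rewrite !mxE opprK rmorphD mulrnDl.
    rewrite -(conj_dg1 hU) conj_dgB; apply: psd_conj'; apply: psd_dg => i.
    by have /andP[h _] := sg1 i; rewrite opprK addrC -lerBlDr sub0r.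
  - rewrite (conj_dgM _ _ hU) -(conj_dg1 hU) conj_dgB; apply: psd_conj'; apply: psd_dg => i.
    by rewrite subr_ge0 -expr2 sqr_sg lern1 leq_b1.
  rewrite {1}eM (trace_norm_dg _ hU) eM (conj_dgM _ _ hU) (rtr_conj_dg _ hU).
  by apply: eq_bigr => i _; rewrite -normrEsg.
rewrite eS; have [pP pQ] : effect P by apply: effect_vec.
apply: (pinched_sign_bound (Q := 1%:M - P)) => //; last 2 first.
- by rewrite /P rtrC hv /rtr mxtrace1.
- rewrite /P !mulmxA -(mulmxA v) -(mulmxA v).
  have -> : adj v *m w *m v = (F%:C)%:M.
    rewrite [LHS]mx11_scalar; congr (_%:M).
    have -> : F = complex.Re ((adj v *m w *m v) 0 0).
      by rewrite /F -mulmxA rtrC /rtr /mxtrace big_ord1.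
    by rewrite RRe_real // ger0_real // -[X in _ *m X]adjK; case: pw.
  by rewrite mul_mx_scalar -scalemxAl.
- by rewrite addrC subrK.
- by rewrite mulmxBl mul1mx mulmxBr mulmx1 PP subrr subr0.
- by rewrite rtrC.
Qed.

End Locc.

(** * Chebyshev's inequality for tensor powers *)

Section Moments.
Variable R : realType.

(** [m] and [v] are the mean and variance per copy, so that adding an independent copy changes only
    [n]. *)
Definition moments (I : finType) (w g : I -> R) (m v : R) (n : nat) :=
  [/\ forall i, 0 <= w i, \sum_i w i = 1,
      \sum_i w i * (g i - n%:R * m) = 0
    & \sum_i w i * (g i - n%:R * m) ^+ 2 = n%:R * v].

Lemma moments1 (I : finType) (w g : I -> R) : (forall i, 0 <= w i) ->
  \sum_i w i = 1 -> exists v, moments w g (\sum_i w i * g i) v 1.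
Proof.
move=> w0 w1; set m := \sum_i _.
exists (\sum_i w i * (g i - 1%:R * m) ^+ 2); split; rewrite ?mul1r //.
under eq_bigr => i _ do rewrite mulrBr.
by rewrite sumrB -mulr_suml w1 mul1r subrr.
Qed.

Lemma moments0 (I : finType) (w g : I -> R) m v : (forall i, 0 <= w i) ->
  \sum_i w i = 1 -> (forall i, w i != 0 -> g i = 0) -> moments w g m v 0.
Proof.
move=> w0 w1 g0.
have e i : w i * (g i - 0%:R * m) = 0.
  have [->|/g0 ->] := eqVneq (w i) 0; first by rewrite mul0r.
  by rewrite mulr0n mul0r subr0 mulr0.
split=> //; first exact: big1.
rewrite mulr0n [RHS]mul0r; apply: big1 => i _.
by rewrite expr2 mulrA e mul0r.
Qed.

Lemma sum_dec (V : nmodType) (K I J : finType) (dec : K -> I * J) (F : I -> J -> V) :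
  bijective dec -> \sum_k F (dec k).1 (dec k).2 = \sum_i \sum_j F i j.
Proof.
move=> [enc dK eK]; rewrite pair_big (reindex dec) //=.
by exists enc => x _.
Qed.

Lemma dec2_bij (K I J K' I' J' : finType) (dec : K -> I * J) (dec' : K' -> I' * J') :
  bijective dec -> bijective dec' ->
  bijective (fun p : K * K' =>
    (((dec p.1).1, (dec' p.2).1), ((dec p.1).2, (dec' p.2).2))).
Proof.
move=> [enc eK dK] [enc' eK' dK'].
exists (fun q => (enc (q.1.1, q.2.1), enc' (q.1.2, q.2.2))) => [[k l]|[[i i'] [j j']]] /=.
  by have := eK k; have := eK' l; case: (dec k); case: (dec' l) => ? ? ? ? /= -> ->.
by rewrite dK dK'.
Qed.

(** Means and variances of independent variables add, the cross term vanishing. Additivity of [g] is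
    asked only where the weight is nonzero, because [ln (x y) = ln x + ln y] may fail at zero
    eigenvalues. *)
Lemma moments_prod (K I J : finType) (dec : K -> I * J) (w g : K -> R)
  (wI gI : I -> R) (wJ gJ : J -> R) m v n : bijective dec ->
  moments wI gI m v 1 -> moments wJ gJ m v n ->
  (forall k, w k = wI (dec k).1 * wJ (dec k).2) ->
  (forall k, w k != 0 -> g k = gI (dec k).1 + gJ (dec k).2) ->
  moments w g m v n.+1.
Proof.
move=> bd [I0 I1 I2 I3] [J0 J1 J2 J3] ew eg.
have wF (F : R -> R) : \sum_k w k * F (g k) =
    \sum_i \sum_j wI i * wJ j * F (gI i + gJ j).
  rewrite -(sum_dec (fun i j => wI i * wJ j * F (gI i + gJ j)) bd).
  apply: eq_bigr => k _; rewrite -ew.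
  by have [->|/eg ->] := eqVneq (w k) 0; rewrite ?mul0r.
pose x i := gI i - 1%:R * m; pose y j := gJ j - n%:R * m.
have exy i j : gI i + gJ j - n.+1%:R * m = x i + y j.
  by rewrite /x /y -natr1; ring.
have s1 : \sum_i wI i * x i = 0 by exact: I2.
have s2 : \sum_j wJ j * y j = 0 by exact: J2.
split.
- by move=> k; rewrite ew mulr_ge0.
- have := wF (fun=> 1); under eq_bigr => k _ do rewrite mulr1.
  move=> ->; transitivity (\sum_i wI i * \sum_j wJ j).
    by apply: eq_bigr => i _; rewrite mulr_sumr; apply: eq_bigr => j _; rewrite mulr1.
  by rewrite J1; under eq_bigr => i _ do rewrite mulr1.
- rewrite (wF (fun t => t - n.+1%:R * m)).
  transitivity (\sum_i (wI i * x i * (\sum_j wJ j) + wI i * (\sum_j wJ j * y j))).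
    apply: eq_bigr => i _; rewrite !mulr_sumr -big_split; apply: eq_bigr => j _ /=.
    by rewrite exy; ring.
  by rewrite J1 s2; under eq_bigr => i _ do rewrite mulr0 addr0 mulr1.
- rewrite (wF (fun t => (t - n.+1%:R * m) ^+ 2)).
  transitivity (\sum_i (wI i * x i ^+ 2 * (\sum_j wJ j)
    + (2 * (wI i * x i) * (\sum_j wJ j * y j) + wI i * (\sum_j wJ j * y j ^+ 2)))).
    apply: eq_bigr => i _; rewrite !mulr_sumr -!big_split; apply: eq_bigr => j _ /=.
    by rewrite exy; ring.
  rewrite J1 s2 J3.
  under eq_bigr => i _ do rewrite mulr0 add0r mulr1.
  rewrite big_split /= I3 -mulr_suml I1 -natr1; ring.
Qed.

Lemma moments_chebyshev (I : finType) (w g : I -> R) m v n (e : R) :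
  moments w g m v n -> (0 < n)%N -> 0 < e ->
  \sum_(i | n%:R * e < `|g i - n%:R * m|) w i <= v / (n%:R * e ^+ 2).
Proof.
move=> [w0 _ _ s2] n0 e0.
have n0' : 0 < n%:R :> R by rewrite ltr0n.
have t0 : 0 < n%:R * e by apply: mulr_gt0.
have h : (n%:R * e) ^+ 2 * \sum_(i | n%:R * e < `|g i - n%:R * m|) w i <= n%:R * v.
  rewrite -s2 mulr_sumr [leRHS](bigID (fun i => n%:R * e < `|g i - n%:R * m|)) /=.
  rewrite -[leLHS]addr0; apply: lerD; last by apply: sumr_ge0 => i _; rewrite mulr_ge0 ?sqr_ge0.
  apply: ler_sum => i hi; rewrite mulrC ler_wpM2l // -[leRHS]real_normK ?num_real //.
  by rewrite ler_sqr ?nnegrE ?normr_ge0 // ltW.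
rewrite ler_pdivlMr ?mulr_gt0 ?exprn_gt0 //.
rewrite -(ler_pM2l n0'); apply: le_trans h.
by rewrite exprMn expr2 -!mulrA le_eqVlt; apply/orP; left; apply/eqP; ring.
Qed.

Lemma moments_typical (I : finType) (w g : I -> R) m v n (e : R) :
  moments w g m v n -> (0 < n)%N -> 0 < e ->
  1 - v / (n%:R * e ^+ 2) <= \sum_(i | `|g i - n%:R * m| <= n%:R * e) w i.
Proof.
move=> mom n0 e0; have h := moments_chebyshev mom n0 e0; case: mom => [_ w1 _ _].
rewrite lerBlDr; apply: le_trans (lerD (lexx _) h).
rewrite -{1}w1 [leLHS](bigID (fun i => n%:R * e < `|g i - n%:R * m|)) /= [leLHS]addrC lerD2r.
by under eq_bigl => i do rewrite -leNgt.
Qed.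

End Moments.

(** * Tensor products along a decoding of indices into pairs *)

Section Tens.
Variable R : realType.
Local Notation C := (R[i]).
Local Notation "x %:C" := (real_complex R x) (format "x %:C").
Opaque adj.

(** [Pr] ranges over all dimensions, so the cast along [a ^ n.+1 = a * a ^ n] in [bpow] is
    eliminated here once for all later inductions. *)
Lemma bpow_ind (a b : nat) (rho sigma : 'M[C]_(a * b))
  (Pr : forall (n A B : nat), 'M[C]_(A * B) -> 'M[C]_(A * B) -> Prop) :
  Pr 0 1 1 1%:M 1%:M ->
  (forall n A B M M', Pr n A B M M' -> Pr n.+1 (a * A)%N (b * B)%N (btens rho M) (btens sigma M')) ->
  forall n, Pr n (a ^ n)%N (b ^ n)%N (bpow rho n) (bpow sigma n).
Proof.
move=> h0 hS; elim=> [//|n /hS] /=.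
move: (bpow rho n) (bpow sigma n) => M M'.
move: (esym _); move: (btens _ _) (btens _ _) => N N'.
rewrite !expnS => e; by rewrite (eq_irrelevance e erefl) castmx_id.
Qed.

Section Dec.
Variables (K m n : nat) (dec : 'I_K -> 'I_m * 'I_n).
Hypothesis decB : bijective dec.

(** [kron] on square matrices and [btens] are both of this form and differ only in [dec]. *)
Definition tens (A : 'M[C]_m) (B : 'M[C]_n) : 'M[C]_K :=
  \matrix_(k, l) (A (dec k).1 (dec l).1 * B (dec k).2 (dec l).2).

Lemma tensM A B A' B' : tens A B *m tens A' B' = tens (A *m A') (B *m B').
Proof.
apply/matrixP=> k l; rewrite !mxE mulr_suml.
transitivity (\sum_p A (dec k).1 (dec p).1 * A' (dec p).1 (dec l).1 *
   (B (dec k).2 (dec p).2 * B' (dec p).2 (dec l).2)).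
  by apply: eq_bigr => p _; rewrite !mxE mulrACA.
rewrite (sum_dec (fun i j => A (dec k).1 i * A' i (dec l).1 *
   (B (dec k).2 j * B' j (dec l).2)) decB).
by apply: eq_bigr => i _; rewrite mulr_sumr.
Qed.

Lemma adj_tens A B : adj (tens A B) = tens (adj A) (adj B).
Proof. by apply/matrixP=> k l; rewrite adjE [in LHS]mxE rmorphM [in RHS]mxE !adjE. Qed.

Lemma dg_tens (d : 'I_m -> R) (e : 'I_n -> R) :
  tens (dg d) (dg e) = dg (fun k => d (dec k).1 * e (dec k).2).
Proof.
apply/matrixP=> k l; rewrite mxE !dgE.
have -> : (k == l) = ((dec k).1 == (dec l).1) && ((dec k).2 == (dec l).2).
  by rewrite -(inj_eq (bij_inj decB)) -pair_eqE.
by do 2!case: eqP; rewrite ?mulr0n ?mulr0 ?mul0r // !mulr1n rmorphM.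
Qed.

Lemma unitary_tens U V : unitary U -> unitary V -> unitary (tens U V).
Proof.
move=> hU hV; rewrite /unitary adj_tens tensM hU hV -!dg1 dg_tens.
by apply: eq_dg => k; rewrite mulr1.
Qed.

Lemma tens_conj_dg U V (d : 'I_m -> R) (e : 'I_n -> R) :
  tens (adj U *m dg d *m U) (adj V *m dg e *m V) =
  adj (tens U V) *m dg (fun k => d (dec k).1 * e (dec k).2) *m tens U V.
Proof. by rewrite adj_tens -dg_tens !tensM. Qed.

End Dec.

Definition bdec a b c d (k : 'I_((a * c) * (b * d))) : 'I_(a * b) * 'I_(c * d) :=
  let x := mxtens.mxtens_unindex (mxtens.mxtens_unindex k).1 in
  let y := mxtens.mxtens_unindex (mxtens.mxtens_unindex k).2 in
  (ix x.1 y.1, ix x.2 y.2).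

Lemma bdecE a b c d (i : 'I_a) (j : 'I_c) (k : 'I_b) (l : 'I_d) :
  bdec (ix (ix i j) (ix k l)) = (ix i k, ix j l).
Proof. by rewrite /bdec; cbv zeta; rewrite !ixK. Qed.

Lemma bdec_bij a b c d : bijective (@bdec a b c d).
Proof.
pose enc (p : 'I_(a * b) * 'I_(c * d)) : 'I_((a * c) * (b * d)) :=
  ix (ix (mxtens.mxtens_unindex p.1).1 (mxtens.mxtens_unindex p.2).1)
     (ix (mxtens.mxtens_unindex p.1).2 (mxtens.mxtens_unindex p.2).2).
have encE i j k l : enc (ix i j, ix k l) = ix (ix i k) (ix j l).
  by rewrite /enc !ixK.
exists enc => [k|[p q]].
- case: (mxtens.mxtens_indexP k) => x y.
  case: (mxtens.mxtens_indexP x) => i j; case: (mxtens.mxtens_indexP y) => i' j'.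
  by rewrite bdecE encE.
- case: (mxtens.mxtens_indexP p) => i j; case: (mxtens.mxtens_indexP q) => k l.
  by rewrite encE bdecE.
Qed.

Lemma btensE a b c d (A : 'M[C]_(a * b)) (B : 'M[C]_(c * d)) :
  btens A B = tens (@bdec a b c d) A B.
Proof. by apply/matrixP=> k l; rewrite !mxE. Qed.

Lemma kdec_bij m n : bijective (@mxtens.mxtens_unindex m n).
Proof. by exists (@mxtens.mxtens_index m n); [exact: mxtens.mxtens_unindexK | exact: mxtens.mxtens_indexK]. Qed.

Lemma kron_tens m n (A : 'M[C]_m) (B : 'M[C]_n) :
  kron A B = tens (@mxtens.mxtens_unindex m n) A B.
Proof. by apply/matrixP=> k l; rewrite !mxE. Qed.

Lemma btens_kron a b c d (x : 'M[C]_a) (y : 'M[C]_b) (x' : 'M[C]_c) (y' : 'M[C]_d) :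
  btens (kron x y) (kron x' y') = kron (kron x x') (kron y y').
Proof.
rewrite btensE; apply: matrix_ixP => i j k l.
case: (mxtens.mxtens_indexP i) => i1 i2; case: (mxtens.mxtens_indexP j) => j1 j2.
case: (mxtens.mxtens_indexP k) => k1 k2; case: (mxtens.mxtens_indexP l) => l1 l2.
by rewrite mxE !bdecE !kronE mulrACA.
Qed.

Lemma btens_suml a b c d (I : Type) (r : seq I) (F : I -> 'M[C]_(a * b)) (B : 'M[C]_(c * d)) :
  btens (\sum_(i <- r) F i) B = \sum_(i <- r) btens (F i) B.
Proof.
apply: (big_morph (fun A => btens A B)) => [A A'|]; rewrite !btensE;
  by apply/matrixP=> k l; rewrite !mxE ?mulrDl ?mul0r.
Qed.

Lemma btens_sumr a b c d (I : Type) (r : seq I) (F : I -> 'M[C]_(c * d)) (A : 'M[C]_(a * b)) :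
  btens A (\sum_(i <- r) F i) = \sum_(i <- r) btens A (F i).
Proof.
apply: (big_morph (fun B => btens A B)) => [B B'|]; rewrite !btensE;
  by apply/matrixP=> k l; rewrite !mxE ?mulrDr ?mulr0.
Qed.

End Tens.

(** * Distillable entanglement is at most the relative entropy *)

Section Converse.
Variable R : realType.
Local Notation C := (R[i]).
Local Notation "x %:C" := (real_complex R x) (format "x %:C").
Opaque adj.

Lemma rtr_gram_dg m n (X : 'M[C]_(m, n)) (d : 'I_n -> R) :
  rtr (adj X *m X *m dg d) = \sum_i \sum_j d j * nsq (X i j).
Proof.
rewrite exchange_big /rtr /mxtrace Re_sum; apply: eq_bigr => j _.
rewrite mul_dg_r mulrC ReZl -mulr_sumr; congr (_ * _).
rewrite -{2}[X]adjK -hs_row hsE exchange_big big_ord1.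
by apply: eq_bigr => i _; rewrite mxE adjE nsqC.
Qed.

Lemma rtr_gram_dg' m n (X : 'M[C]_(m, n)) (d : 'I_m -> R) :
  rtr (X *m adj X *m dg d) = \sum_i \sum_j d i * nsq (X i j).
Proof.
rewrite -{1}[X]adjK rtr_gram_dg exchange_big; apply: eq_bigr => i _.
by apply: eq_bigr => j _; rewrite adjE nsqC.
Qed.

Lemma nsq_unitary_row n (O : 'M[C]_n) i : unitary O -> \sum_j nsq (O i j) = 1.
Proof.
move=> hO; have := hs_row O i; rewrite hO mxE eqxx /= => <-.
by rewrite hsE; apply: eq_bigr => j _; rewrite big_ord1 mxE.
Qed.

Lemma unitaryM n (U W : 'M[C]_n) : unitary U -> unitary W -> unitary (U *m W).
Proof. by move=> hU hW; rewrite /unitary adjM mulmxA -(mulmxA U) hW mulmx1. Qed.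

(* Nussbaum-Szkola: [M] and [M'] are replaced by the classical distributions
   [lam i * |<u_i|w_j>|^2] and [mu j * |<u_i|w_j>|^2]; the mean of their
   log-likelihood ratio is the relative entropy, in nats. *)
Definition ns_pair (d n : nat) (M M' : 'M[C]_d) (D V : R) :=
  exists (U W : 'M[C]_d) (lam mu : 'I_d -> R),
  [/\ unitary U /\ unitary W,
      M = adj U *m dg lam *m U /\ M' = adj W *m dg mu *m W,
      (forall i, 0 <= lam i) /\ (forall j, 0 <= mu j),
      forall p : 'I_d * 'I_d,
        lam p.1 * nsq ((U *m adj W) p.1 p.2) != 0 -> 0 < mu p.2
    & moments (fun p : 'I_d * 'I_d => lam p.1 * nsq ((U *m adj W) p.1 p.2))
              (fun p => ln (lam p.1) - ln (mu p.2)) D V n].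

Lemma ns_pair_btens a b A B n (rho sigma : 'M[C]_(a * b)) (M M' : 'M[C]_(A * B)) D V :
  ns_pair 1 rho sigma D V -> ns_pair n M M' D V ->
  ns_pair n.+1 (btens rho M) (btens sigma M') D V.
Proof.
move=> [U [W [lam [mu [[hU hW] [-> ->] [l0 m0] sup mom]]]]].
move=> [U' [W' [lam' [mu' [[hU' hW'] [-> ->] [l0' m0'] sup' mom']]]]].
have db := @bdec_bij a b A B.
pose dec := @bdec a b A B.
exists (tens dec U U'), (tens dec W W').
exists (fun k => lam (dec k).1 * lam' (dec k).2), (fun k => mu (dec k).1 * mu' (dec k).2).
have eO k l : nsq ((tens dec U U' *m adj (tens dec W W')) k l) =
  nsq ((U *m adj W) (dec k).1 (dec l).1) * nsq ((U' *m adj W') (dec k).2 (dec l).2).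
  by rewrite adj_tens (tensM db) -nsqM [in LHS]mxE.
have split0 (x y z t : R) : x * y * (z * t) != 0 -> x * z != 0 /\ y * t != 0.
  by rewrite mulrACA mulf_eq0 negb_or => /andP.
split.
- by split; apply: unitary_tens.
- by rewrite !btensE !(tens_conj_dg db).
- by split=> k; apply: mulr_ge0.
- by move=> p; rewrite eO => /split0[h h']; apply: mulr_gt0; [apply: (sup (_, _) h)|apply: (sup' (_, _) h')].
have d2 := dec2_bij db db.
apply: (moments_prod d2 mom mom') => p; rewrite eO /=; first exact: mulrACA.
move=> /split0[h h'].
have p1 : 0 < lam (dec p.1).1.
  by rewrite lt_def l0 andbT; apply: contraNneq h => ->; rewrite mul0r.
have p2 : 0 < lam' (dec p.1).2.
  by rewrite lt_def l0' andbT; apply: contraNneq h' => ->; rewrite mul0r.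
have q1 := sup (_, _) h; have q2 := sup' (_, _) h'.
rewrite !lnM ?posrE //; ring.
Qed.

Lemma ns_pair_bpow a b (rho sigma : 'M[C]_(a * b)) D V n :
  ns_pair 1 rho sigma D V -> ns_pair n (bpow rho n) (bpow sigma n) D V.
Proof.
move=> h1; pose Pr n A B (M M' : 'M[C]_(A * B)) := ns_pair n M M' D V.
apply: (@bpow_ind _ a b rho sigma Pr) => [|{}n A B M M' h]; last exact: ns_pair_btens.
have u1 : unitary (1%:M : 'M[C]_(1 * 1)) by rewrite /unitary adj_1 mulmx1.
have e1 : (1%:M : 'M[C]_(1 * 1)) = adj 1%:M *m dg (fun=> 1) *m 1%:M.
  by rewrite dg1 adj_1 !mulmx1.
exists 1%:M, 1%:M, (fun=> 1), (fun=> 1); split=> //.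
apply: moments0 => [p||p _]; rewrite ?subrr //=; first by rewrite mul1r nsq_ge0.
rewrite -(pair_big xpredT xpredT (fun i j => 1 * nsq ((1%:M *m adj 1%:M : 'M[C]_(1 * 1)) i j))) /=.
rewrite big_ord1; under eq_bigr => j _ do rewrite mul1r.
by rewrite nsq_unitary_row // u1.
Qed.

Lemma nsq_subr_le (x y : C) : nsq x <= 2 * nsq (x - y) + 2 * nsq y.
Proof.
rewrite /nsq; case: x => a b; case: y => c d /=.
rewrite -subr_ge0.
have -> : 2 * ((a - c) ^+ 2 + (b - d) ^+ 2) + 2 * (c ^+ 2 + d ^+ 2) - (a ^+ 2 + b ^+ 2)
   = (a - 2 * c) ^+ 2 + (b - 2 * d) ^+ 2 by ring.
by rewrite addr_ge0 ?sqr_ge0.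
Qed.

(** On a typical pair [lam i <= c * mu j], so the weight [lam i |O i j|^2] is at most twice [lam i
    |(O - X) i j|^2 + c * mu j |X i j|^2]. The two sums are bounded by the two error terms, and
    typical pairs carry the weight given by Chebyshev. *)
Lemma test_bound d n (M M' T : 'M[C]_d) (D V c e : R) :
  ns_pair n M M' D V -> effect T -> (0 < n)%N -> 0 < e ->
  c = expR (n%:R * (D + e)) ->
  (1 - V / (n%:R * e ^+ 2)) / 2 <= rtr ((1%:M - T) *m M) + c * rtr (T *m M').
Proof.
move=> [U [W [lam [mu [[hU hW] [eM eM'] [l0 m0] sup mom]]]]] hT n0 e0 ec.
have [pT pT'] := hT.
have c0 : 0 <= c by rewrite ec expR_ge0.
pose O := U *m adj W; pose X := U *m T *m adj W.
have pM : psd M by rewrite eM; apply: psd_conj'; apply: psd_dg.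
have pM' : psd M' by rewrite eM'; apply: psd_conj'; apply: psd_dg.
(* The sum is the trace of [(1 - T)^2 M], and [(1 - T)^2 <= 1 - T]. *)
have b1 : \sum_i \sum_j lam i * nsq ((O - X) i j) <= rtr ((1%:M - T) *m M).
  have pT'' : psd (1%:M - (1%:M - T)) by rewrite opprB addrC subrK.
  have := psd_rtrM (psd_subsqr pT' pT'') pM.
  rewrite mulmxBl rtrB subr_ge0; apply: le_trans.
  have -> : O - X = U *m (1%:M - T) *m adj W by rewrite mulmxBr mulmxBl mulmx1.
  rewrite -rtr_gram_dg' eM.
  rewrite !adjM adjK (psd_adj pT') !mulmxA -(mulmxA _ (adj W)) (unitaryV hW) mulmx1.
  by rewrite [X in _ <= X]rtrC !mulmxA.
have b2 : \sum_i \sum_j mu j * nsq (X i j) <= rtr (T *m M').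
  have := psd_rtrM (psd_subsqr pT pT') pM'.
  rewrite mulmxBl rtrB subr_ge0; apply: le_trans.
  rewrite -rtr_gram_dg eM'.
  rewrite !adjM adjK (psd_adj pT) !mulmxA -(mulmxA _ (adj U)) (unitaryV hU) mulmx1.
  by rewrite [X in _ <= X]rtrC !mulmxA.
have := moments_typical mom n0 e0.
rewrite ler_pdivrMr ?ltr0n // => /le_trans; apply.
apply: (@le_trans _ _ (2 * (\sum_i \sum_j lam i * nsq ((O - X) i j) + c * \sum_i \sum_j mu j * nsq (X i j)))); last first.
  by rewrite mulrC ler_pM2r ?ltr0n // lerD // ler_wpM2l.
rewrite !pair_bigA mulr_sumr -big_split /= mulr_sumr big_mkcond.
apply: ler_sum => -[i j] _ /=.
have [x0 y0] : 0 <= lam i * nsq ((O - X) i j) /\ 0 <= c * (mu j * nsq (X i j)).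
  by split; rewrite !mulr_ge0 ?nsq_ge0.
have oo : nsq (O i j) <= 2 * nsq ((O - X) i j) + 2 * nsq (X i j).
  rewrite [in leRHS]mxE [X in nsq (_ + X)]mxE; exact: nsq_subr_le.
case: ifP => [good|_]; last by rewrite mulr_ge0 ?ler0n ?addr_ge0.
have [->|wn] := eqVneq (lam i * nsq (O i j)) 0; first by rewrite mulr_ge0 ?ler0n ?addr_ge0.
have muj : 0 < mu j := sup (i, j) wn.
have lami : 0 < lam i.
  by rewrite lt_def l0 andbT; apply: contraNneq wn => ->; rewrite mul0r.
have le_c : lam i <= c * mu j.
  rewrite ec -[mu j]lnK ?posrE // -expRD -[lam i]lnK ?posrE // ler_expR.
  move: good; rewrite ler_norml => /andP[_]; rewrite mulrDr lerBlDl lerBlDr.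
  by rewrite addrC.
apply: le_trans (ler_wpM2l (l0 i) oo) _.
rewrite mulrDr [leRHS]mulrDr; apply: lerD; first by rewrite mulrCA.
by rewrite mulrCA ler_pM2l ?ltr0n // mulrA ler_wpM2r ?nsq_ge0.
Qed.

Lemma rtr_two_bases d (U W : 'M[C]_d) (x y : 'I_d -> R) :
  rtr (adj U *m dg x *m U *m (adj W *m dg y *m W)) =
  \sum_i \sum_j x i * nsq ((U *m adj W) i j) * y j.
Proof.
rewrite -!mulmxA rtrC !mulmxA -!mulmxA.
rewrite /rtr /mxtrace Re_sum; apply: eq_bigr => i _.
rewrite mul_dg_l ReZl.
have -> : U *m (adj W *m (dg y *m (W *m adj U))) = U *m adj W *m (dg y *m adj (U *m adj W)).
  by rewrite adjM adjK !mulmxA.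
rewrite mxE Re_sum mulr_sumr; apply: eq_bigr => j _.
by rewrite mul_dg_l adjE mulrCA [_ * _^*]mulrC nsqE -rmorphM /= -mulrA [y j * _]mulrC.
Qed.

Lemma ln2_gt0 : 0 < ln (2 : R).
Proof. by rewrite ln_gt0 // ltr1n. Qed.

(** The factor [ln 2] converts bits to nats. A finite relative entropy entails the inclusion of
    supports, which yields the positivity clause of [ns_pair]. *)
Lemma rel_entropy_ns_pair d (rho sigma : 'M[C]_d) D : density rho -> psd sigma ->
  rel_entropy rho sigma = D%:E -> exists V, ns_pair 1 rho sigma (D * ln 2) V.
Proof.
move=> [prho trho] psig; rewrite /rel_entropy; case: ifP => // /submxP[Y eY] [eD].
have [U [lam [hU l0 eM]]] := psd_spectral prho.
have [W [mu [hW m0 eM']]] := psd_spectral psig.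
pose w (p : 'I_d * 'I_d) := lam p.1 * nsq ((U *m adj W) p.1 p.2).
pose g (p : 'I_d * 'I_d) := ln (lam p.1) - ln (mu p.2).
have w0 p : 0 <= w p by rewrite mulr_ge0 ?nsq_ge0.
have row1 i : \sum_j lam i * nsq ((U *m adj W) i j) = lam i.
  by rewrite -mulr_sumr nsq_unitary_row ?mulr1 //; apply: unitaryM => //; apply: unitary_adj.
have suml : \sum_i lam i = 1.
  have := congr1 (@complex.Re _) trho; rewrite -[LHS]/(rtr rho) eM (rtr_conj_dg _ hU) => ->.
  by [].
have w1 : \sum_p w p = 1.
  rewrite -suml -(pair_bigA _ (fun i j => lam i * nsq ((U *m adj W) i j))) /=.
  by apply: eq_bigr => i _; apply: row1.
have sup p : w p != 0 -> 0 < mu p.2.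
  (* As [rho = Y sigma], the entry [lam i * O i j], with [O = U W^+], has [mu j] as a factor and
     vanishes with it. *)
  move=> wp; rewrite lt_def m0 andbT; apply: contraNneq wp => mu0.
  have : dg lam *m (U *m adj W) = U *m Y *m adj W *m dg mu.
    have := congr1 (fun X => U *m X *m adj W) eY.
    rewrite {1}eM {1}eM' !mulmxA hU mul1mx => ->.
    by rewrite -(mulmxA _ W) hW mulmx1.
  move/matrixP/(_ p.1 p.2); rewrite mul_dg_l mul_dg_r mu0 rmorph0 mulr0.
  move/eqP; rewrite mulf_eq0 /w => /orP[/eqP/complexI ->|/eqP ->]; first by rewrite mul0r.
  by rewrite /nsq /= expr0n addr0 mulr0.
have lamp p : w p != 0 -> 0 < lam p.1.
  by move=> wp; rewrite lt_def l0 andbT; apply: contraNneq wp; rewrite /w => ->; rewrite mul0r.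
have [V mom] := moments1 g w0 w1.
exists V, U, W, lam, mu; split=> //.
suff -> : D * ln 2 = \sum_p w p * g p by [].
have ln20 := lt0r_neq0 ln2_gt0.
rewrite -eD /vN_entropy -/(rtr _) -/(rtr _) eM eM' (mxfun_diag _ _ hU) (mxfun_diag _ _ hW).
rewrite (rtr_conj_dg _ hU) rtr_two_bases pair_bigA /=.
have -> : \sum_i eta_fun (lam i) = \sum_p w p * - (ln (lam p.1) / ln 2).
  rewrite -(pair_bigA _ (fun i j => lam i * nsq ((U *m adj W) i j) * - (ln (lam i) / ln 2))) /=.
  apply: eq_bigr => i _; rewrite -mulr_suml row1 /eta_fun /log2.
  by case: ltP => [_|li]; [rewrite mulrN | have -> : lam i = 0 by apply/eqP; rewrite eq_le li l0]; rewrite ?mul0r.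
rewrite -sumrN -sumrB mulr_suml; apply: eq_bigr => p _.
rewrite /w /g; have := sup p; rewrite /w.
move: (lam p.1 * nsq _) => wp' sup'; have [->|wp] := eqVneq wp' 0; first by rewrite !mul0r oppr0 addr0 mul0r.
rewrite /log2_supp /log2 (sup' wp); move: wp' (ln (lam p.1)) (ln (mu p.2)) {wp sup'} => x y z.
by field.
Qed.

(** The convex weights are absorbed into the first factors, which stay positive without being
    normalized; [locc_product_bound] uses only the total weight. *)
Lemma separable_bpow a b (sigma : 'M[C]_(a * b)) n : separable sigma ->
  exists (I : finType) (x : I -> 'M[C]_(a ^ n)) (y : I -> 'M[C]_(b ^ n)),
  [/\ forall k, psd (x k), forall k, psd (y k),
      bpow sigma n = \sum_k kron (x k) (y k)
    & \sum_k rtr (x k) * rtr (y k) = 1].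
Proof.
move=> [K [q [sx [sy [q0 [q1 [hx [hy es]]]]]]]].
pose Pr (n A B : nat) (M M' : 'M[C]_(A * B)) :=
  exists (I : finType) (x : I -> 'M[C]_A) (y : I -> 'M[C]_B),
  [/\ forall k, psd (x k), forall k, psd (y k),
      M = \sum_k kron (x k) (y k)
    & \sum_k rtr (x k) * rtr (y k) = 1].
apply: (@bpow_ind _ a b sigma sigma Pr) => [|{}n A B M M' [I [x [y [px py -> s1]]]]].
  exists unit, (fun=> 1%:M), (fun=> 1%:M); split.
  - by move=> _; apply: psd1.
  - by move=> _; apply: psd1.
  - by rewrite big_const card_unit /= addr0 kron11.
  - by rewrite big_const card_unit /= addr0 /rtr mxtrace1 mulr1.
have t1 d (s : 'M[C]_d) : density s -> rtr s = 1 by rewrite /rtr => -[_ ->].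
exists ('I_K * I)%type, (fun p => kron ((q p.1)%:C *: sx p.1) (x p.2)),
  (fun p => kron (sy p.1) (y p.2)); split.
- by move=> p; apply: psd_kron => //; apply: psdZ => //; case: (hx p.1).
- by move=> p; apply: psd_kron => //; case: (hy p.1).
- rewrite es btens_suml.
  rewrite -(pair_bigA _ (fun i k => kron (kron ((q i)%:C *: sx i) (x k)) (kron (sy i) (y k)))) /=.
  apply: eq_bigr => i _; rewrite btens_sumr; apply: eq_bigr => k _.
  have -> : (q i)%:C *: kron (sx i) (sy i) = kron ((q i)%:C *: sx i) (sy i).
    by apply/matrixP=> ? ?; rewrite !mxE mulrA.
  by rewrite btens_kron.
- rewrite -(pair_bigA _ (fun i k => rtr (kron ((q i)%:C *: sx i) (x k)) * rtr (kron (sy i) (y k)))) /=.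
  rewrite -q1; apply: eq_bigr => i _.
  rewrite -[RHS]mulr1 -s1 mulr_sumr; apply: eq_bigr => k _.
  have pq : psd ((q i)%:C *: sx i) by apply: psdZ => //; case: (hx i).
  have py' : psd (sy i) by case: (hy i).
  rewrite (rtr_kron pq (px k)) (rtr_kron py' (py k)) rtrZ (t1 _ _ (hx i)) (t1 _ _ (hy i)).
  ring.
Qed.

Lemma ns_pair_density d n (M M' : 'M[C]_d) D V : ns_pair n M M' D V ->
  psd M /\ rtr M = 1.
Proof.
move=> [U [W [lam [mu [[hU hW] [-> _] [l0 _] _ [_ w1 _ _]]]]]]; split.
  by apply: psd_conj'; apply: psd_dg.
rewrite (rtr_conj_dg _ hU) -w1 -(pair_bigA _ (fun i j => lam i * nsq ((U *m adj W) i j))) /=.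
apply: eq_bigr => i _; rewrite -mulr_sumr nsq_unitary_row ?mulr1 //.
by apply: unitaryM => //; apply: unitary_adj.
Qed.

(** Truncation lowers the exponent by less than one, whence the factor 2. *)
Lemma pow2_truncn_ge (x : R) : ((2 ^ Num.truncn x)%N%:R)^-1 <= 2 * expR (- (x * ln 2)).
Proof.
have h := truncnS_gt x; have l2 := ln2_gt0.
have -> : ((2 ^ Num.truncn x)%N%:R)^-1 = expR (- ((Num.truncn x)%:R * ln 2)) :> R.
  by rewrite expRN expRM_natl lnK ?posrE ?ltr0n // natrX.
have -> : 2 * expR (- (x * ln 2)) = expR (ln 2 - x * ln 2).
  by rewrite expRD lnK ?posrE ?ltr0n.
rewrite ler_expR.
rewrite -natr1 in h; move: (ln 2) (Num.truncn x)%:R h l2 => l t h l2.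
have : x * l <= (t + 1) * l by rewrite ler_pM2r // ltW.
by rewrite mulrDl mul1r; lra.
Qed.

(** A single large [n] gives the contradiction: the pulled-back test accepts [rho^n] with high
    probability, while its weight on [sigma^n] is at most [1/K], too small for a rate above [D]. *)
Theorem distillable_le_rel_entropy a b (rho sigma : 'M[C]_(a * b)) (D r : R) :
  density rho -> separable sigma -> rel_entropy rho sigma = D%:E ->
  achievable_rate rho r -> r <= D.
Proof.
move=> drho ssig eD [P cvP]; rewrite leNgt; apply/negP => Dr.
have psig : psd sigma.
  have [K [q [sx [sy [q0 [_ [hx [hy ->]]]]]]]] := ssig.
  apply: psd_sum => k _; apply: psdZ => //.
  by apply: psd_kron; [case: (hx k) | case: (hy k)].
have [V ns1] := rel_entropy_ns_pair drho psig eD.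
have l2 := ln2_gt0.
(* Half the gap in nats: then [n (D ln 2 + e)] stays below [n r ln 2] by [n e]. *)
have [e e0 ee] : exists2 e, 0 < e & e = (r - D) * ln 2 / 2.
  by exists ((r - D) * ln 2 / 2); rewrite // !mulr_gt0 ?invr_gt0 ?ltr0n // subr_gt0.
have : 0 < (16 : R)^-1 by rewrite invr_gt0 ltr0n.
move/cvgrPdist_lt: cvP => /[apply] -[N _ hN].
(* The first term of [x] makes [V / (n e^2)] at most 1/4; the second makes [n e >= 32], so that
   [2 exp (- n e) <= 1/16]. *)
pose x := 4 * `|V| / e ^+ 2 + 32 / e.
pose n := maxn N (Num.truncn x).+1.
have xn : x < n%:R.
  by apply: lt_le_trans (truncnS_gt x) _; rewrite ler_nat leq_maxr.
have n0 : (0 < n)%N by rewrite /n leq_max orbT.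
have nr0 : 0 < n%:R :> R by rewrite ltr0n.
have := hN n (leq_maxl _ _); rewrite /= sub0r normrN.
set K := (2 ^ _)%N => ht.
have K0 : (0 < K)%N by rewrite expn_gt0.
have ns := ns_pair_bpow n ns1; have [pn tn] := ns_pair_density ns.
have [pw tw] := locc_psd_rtr (P n) pn.
have eK := max_ent_effect R K0.
have [T [hT eT]] := locc_heisenberg (P n) eK.
have b1 : rtr ((1%:M - T) *m bpow rho n) < 16^-1.
  rewrite mulmxBl mul1mx rtrB tn -eT.
  have hM : adj (locc_apply (P n) (bpow rho n) - max_ent R K) = locc_apply (P n) (bpow rho n) - max_ent R K.
    by rewrite adjB (psd_adj pw) (psd_adj eK.1).
  apply: le_lt_trans ht.
  apply: le_trans (ler_norm (trace_norm (locc_apply (P n) (bpow rho n) - max_ent R K))).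
  apply: le_trans (rtr_effect_trace_norm eK hM).
  rewrite mulmxBr rtrB; have -> : rtr (max_ent R K *m max_ent R K) = 1.
    have hv := max_vec_norm R K0.
    by rewrite max_entE mulmxA -(mulmxA (max_vec R K)) hv mulmx1 rtrC hv /rtr mxtrace1.
  by rewrite -normrN opprB ler_norm.
have b2 : rtr (T *m bpow sigma n) <= K%:R^-1.
  have [I [xs [ys [px py -> s1]]]] := separable_bpow n ssig.
  rewrite mulmx_sumr rtr_sum -[leRHS]mulr1 -[X in _ <= _ * X]s1 mulr_sumr; apply: ler_sum => k _.
  have := locc_product_bound (P n) (erefl K) (px k) (py k).
  by rewrite castmx_id -/K eT => h; exact: h.
pose c := expR (n%:R * (D * ln 2 + e)).
have b3 := test_bound ns hT n0 e0 (erefl c).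
have b4 : c * rtr (T *m bpow sigma n) <= 16^-1.
  apply: (@le_trans _ _ (c * (2 * expR (- (r * n%:R * ln 2))))).
    by rewrite ler_wpM2l ?expR_ge0 // (le_trans b2) // pow2_truncn_ge.
  rewrite mulrCA /c -expRD.
  have -> : n%:R * (D * ln 2 + e) + - (r * n%:R * ln 2) = - (n%:R * e).
    by rewrite ee; field.
  rewrite expRN ler_pdivrMr ?expR_gt0 //.
  have h : 32 <= n%:R * e.
    rewrite -ler_pdivrMr //; apply: ltW; apply: le_lt_trans xn.
    by rewrite /x lerDr !mulr_ge0 ?normr_ge0 ?invr_ge0 ?exprn_ge0 ?ltW.
  have := expR_ge1Dx (n%:R * e).
  by move: (expR _) h => z; lra.
have b5 : V / (n%:R * e ^+ 2) <= 4^-1.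
  rewrite ler_pdivrMr ?mulr_gt0 ?exprn_gt0 //.
  apply: le_trans (ler_norm V) _; rewrite -ler_pdivrMl ?invr_gt0 ?ltr0n // invrK.
  rewrite -ler_pdivrMr ?exprn_gt0 //; apply: ltW; apply: le_lt_trans xn.
  by rewrite /x lerDl !mulr_ge0 ?invr_ge0 ?ler0n ?ltW.
(* The contradiction is [3/8 <= u + v < 1/8]. *)
move: b1 b3 b4 b5; clear.
move: (rtr _) (c * rtr _) (V / _) => u v w; lra.
Qed.

End Converse.

(** * One-shot distillation *)

Section OneShot.
Variable R : realType.
Local Notation C := (R[i]).
Local Notation "x %:C" := (real_complex R x) (format "x %:C").
Opaque adj.

Lemma sum_cauchy (I : finType) (x y : I -> R) :
  (\sum_i x i * y i) ^+ 2 <= (\sum_i x i ^+ 2) * (\sum_i y i ^+ 2).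
Proof.
set a := \sum_i x i ^+ 2; set b := \sum_i y i ^+ 2; set c := \sum_i x i * y i.
have b0 : 0 <= b by apply: sumr_ge0 => i _; apply: sqr_ge0.
have h : b * (a * b - c ^+ 2) = \sum_i (b * x i - c * y i) ^+ 2.
  transitivity (\sum_i (b ^+ 2 * x i ^+ 2 + (- (2 * b * c) * (x i * y i) + c ^+ 2 * y i ^+ 2))).
    rewrite !big_split /= -!mulr_sumr -/a -/b -/c; ring.
  by apply: eq_bigr => i _; ring.
have [b1|b1] := eqVneq b 0.
  have y0 i : y i = 0.
    have /eqP := b1; rewrite psumr_eq0 => [/allP/(_ i (mem_index_enum _))/=|j _]; last exact: sqr_ge0.
    by rewrite sqrf_eq0 => /eqP.
  rewrite /c big1 => [|i _]; last by rewrite y0 mulr0.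
  by rewrite expr0n /= b1 mulr0.
have b2 : 0 < b by rewrite lt_def b1.
rewrite -subr_ge0 -(pmulr_rge0 _ b2) h.
by apply: sumr_ge0 => i _; apply: sqr_ge0.
Qed.

Lemma exists_le_mean (K : nat) (f : 'I_K -> R) : (0 < K)%N ->
  exists k, f k <= (\sum_k f k) / K%:R.
Proof.
move=> K0; apply/not_existsP => h.
have : \sum_(k < K) (\sum_k f k) / K%:R < \sum_k f k.
  have k0 : 'I_K := Ordinal K0.
  apply: ltr_sum => [|k _]; first by apply/hasP; exists k0; rewrite ?mem_index_enum.
  by have := h k => /negP; rewrite -ltNge.
rewrite sumr_const card_ord -[_ *+ K]mulr_natr divfK ?ltxx //.
by rewrite pnatr_eq0 -lt0n.
Qed.

(* Derandomization: assigning the indices one at a time, each to a class of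
   least overlap, does at least as well as a uniformly random assignment. *)
Lemma greedy_hash (A K c : nat) (M : 'I_A -> 'M[C]_c) : (0 < K)%N ->
  exists h : 'I_A -> 'I_K,
    \sum_k hs (\sum_(j | h j == k) M j) <= hs (\sum_j M j) / K%:R + \sum_j hs (M j).
Proof.
move=> K0; have k0 : 'I_K := Ordinal K0.
suff H (s : seq 'I_A) : uniq s -> exists h : 'I_A -> 'I_K,
    \sum_k hs (\sum_(j <- s | h j == k) M j) <=
    hs (\sum_(j <- s) M j) / K%:R + \sum_(j <- s) hs (M j).
  exact: H (index_enum_uniq _).
elim: s => [_|j s IH /= /andP[js us]].
  exists (fun=> k0); rewrite !big_nil addr0 /hs /ip mulmx0 rtr0 mul0r.
  by rewrite big1 // => k _; rewrite big_nil mulmx0 rtr0.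
have [h hh] := IH us.
pose T k := \sum_(i <- s | h i == k) M i.
(* The overlaps of [M j] with the classes sum to its overlap with the whole sum, so a class with at
   most the average pays exactly the cross term on the right. *)
have [k1 hk1] := exists_le_mean (fun k => ip (T k) (M j)) K0.
exists (fun x => if x == j then k1 else h x).
have eT k : \sum_(i <- j :: s | (if i == j then k1 else h i) == k) M i =
   T k + (if k1 == k then M j else 0).
  rewrite big_cons eqxx.
  have -> : \sum_(i <- s | (if i == j then k1 else h i) == k) M i = T k.
    rewrite big_seq_cond [RHS]big_seq_cond; apply: eq_bigl => i.
    by have [->|//] := eqVneq i j; rewrite (negbTE js).
  by case: ifP => _; rewrite ?addr0 // addrC.
under eq_bigr => k _ do rewrite eT hsD.
have eS : \sum_k T k = \sum_(i <- s) M i.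
  rewrite /T (exchange_big_dep predT) //=; apply: eq_bigr => i _.
  by rewrite (big_pred1 (h i)) // => k; rewrite eq_sym.
have -> : \sum_k (hs (T k) + 2 * ip (T k) (if k1 == k then M j else 0) +
    hs (if k1 == k then M j else 0)) = \sum_k hs (T k) + (2 * ip (T k1) (M j) + hs (M j)).
  transitivity (\sum_k (hs (T k) + (if k == k1 then 2 * ip (T k) (M j) + hs (M j) else 0))).
    apply: eq_bigr => k _; rewrite eq_sym; case: ifP => _; first by rewrite addrA.
    by rewrite /hs /ip !mulmx0 rtr0 mulr0 !addr0.
  by rewrite big_split /= -big_mkcond big_pred1_eq.
rewrite !big_cons hsD.
move: hk1; rewrite -ip_suml eS => hk1; move: hh; rewrite -/(T _).
have K1 : 0 < K%:R^-1 :> R by rewrite invr_gt0 ltr0n.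
have := mulr_ge0 (hs_ge0 (M j)) (ltW K1); rewrite (ipC (M j)).
move: hk1 (\sum_k hs _) (\sum_(i <- s) hs (M i)).
move: (ip _ _) (ip _ _) (hs (M j)) (hs _) (K%:R^-1) => u v w x y hk1 p q; lra.
Qed.

(** For distinct indices, flipping the sign at [j] is an involution that negates the sum. *)
Lemma sum_signs (A : nat) (j j' : 'I_A) :
  \sum_(s : {ffun 'I_A -> bool}) (-1) ^+ (s j) * (-1) ^+ (s j') =
  (if j == j' then 2 ^+ A else 0) :> R.
Proof.
case: eqP => [->|/eqP jj].
  under eq_bigr => s _ do rewrite -expr2 sqrr_sign.
  by rewrite sumr_const card_ffun card_bool card_ord -natrX.
pose flip (s : {ffun 'I_A -> bool}) := [ffun x => if x == j then ~~ s x else s x].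
have flipK : involutive flip.
  by move=> s; apply/ffunP => x; rewrite !ffunE; case: eqP => // _; rewrite negbK.
set S := \sum_s _; suff : S = - S by move=> h; move: h; lra.
rewrite {1}/S (reindex_inj (inv_inj flipK)) -sumrN; apply: eq_bigr => s _.
rewrite !ffunE eqxx eq_sym (negbTE jj) signrN mulNr //.
Qed.

Definition stack (A B c : nat) (P : 'I_A -> 'M[C]_B) (X : 'M[C]_(B, c)) : 'M[C]_(A * B, c) :=
  \matrix_(k, m) (P (mxtens.mxtens_unindex k).1 *m X) (mxtens.mxtens_unindex k).2 m.

Definition cq (A B c : nat) (P : 'I_A -> 'M[C]_B) (X : 'M[C]_(B, c)) : 'M[C]_(A * B) :=
  stack P X *m adj (stack P X).

Lemma stackE A B c (P : 'I_A -> 'M[C]_B) (X : 'M[C]_(B, c)) j y m :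
  stack P X (ix j y) m = (P j *m X) y m.
Proof. by rewrite [LHS]mxE ixK. Qed.

Lemma max_vec_kron_stack A B c K (P : 'I_A -> 'M[C]_B) (X : 'M[C]_(B, c))
    (Q : 'M[C]_(K, A)) (L : 'M[C]_(K, B)) m :
  (adj (max_vec R K) *m (kron Q L *m stack P X)) 0 m =
  ((Num.sqrt K%:R)^-1)%:C * \sum_k \sum_j Q k j * (L *m P j *m X) k m.
Proof.
rewrite mxE sum_ix mulr_sumr; apply: eq_bigr => k _.
rewrite (bigD1 k) //= [X in _ + X]big1 ?addr0 => [|l lk]; last first.
  rewrite adjE mxE ixK /= ifN ?rmorph0 ?mul0r //.
  by apply: contra lk => /eqP e; apply/eqP/val_inj.
rewrite adjE mxE ixK /= eqxx conj_real; congr (_ * _).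
rewrite mxE sum_ix; apply: eq_bigr => j _.
rewrite -mulmxA [in RHS]mxE mulr_sumr; apply: eq_bigr => y _.
by rewrite kronE stackE mulrA.
Qed.

(* Alice measures the hash value of her register coherently within each class
   (signs [s] randomize the relative phases), Bob undoes the signs and
   decodes with the [D k]. *)
Lemma hash_protocol A B c K (P : 'I_A -> 'M[C]_B) (X : 'M[C]_(B, c))
    (h : 'I_A -> 'I_K) (D : 'I_K -> 'M[C]_(c, B)) :
  type_of_info P -> (0 < K)%N -> psd (1%:M - \sum_k adj (D k) *m D k) ->
  exists Pr : locc R A B K K,
    hs (\sum_k D k *m (\sum_(j | h j == k) P j *m X)) / K%:R
      <= rtr (max_ent R K *m locc_apply Pr (cq P X)).
Proof.
move=> [Ph [Po P1]] K0 /psd_sqrt[G eG]; have k0 : 'I_K := Ordinal K0.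
(* Normalizes the uniform mixture of the [2^A] sign patterns. *)
pose a : R := (Num.sqrt (2 ^+ A))^-1.
have a2 : a ^+ 2 * 2 ^+ A = 1.
  by rewrite /a exprVn sqr_sqrtr ?exprn_ge0 // mulVf // expf_neq0.
pose sg (b : bool) : C := (-1) ^+ b.
have sgr b : sg b = ((-1) ^+ b : R)%:C by rewrite /sg rmorphXn rmorphN rmorph1.
have sgC b : (sg b)^* = sg b by rewrite sgr conj_real.
have sg2 b : sg b * sg b = 1 by rewrite /sg -expr2 sqrr_sign.
pose Q (s : {ffun 'I_A -> bool}) : 'M[C]_(K, A) :=
  \matrix_(k, j) (a%:C * sg (s j) * (h j == k)%:R).
pose Th (s : {ffun 'I_A -> bool}) : 'M[C]_B := \sum_j sg (s j) *: P j.
have ThP s j : Th s *m P j = sg (s j) *: P j.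
  rewrite /Th mulmx_suml (bigD1 j) //= -scalemxAl Po eqxx big1 ?addr0 // => i ij.
  by rewrite -scalemxAl Po (negbTE ij) scaler0.
have ThTh s : adj (Th s) *m Th s = 1%:M.
  have -> : adj (Th s) = Th s.
    by rewrite /Th adj_sum; apply: eq_bigr => j _; rewrite adjZ sgC Ph.
  rewrite {2}/Th mulmx_sumr -P1; apply: eq_bigr => j _.
  by rewrite -scalemxAr ThP scalerA sg2 scale1r.
(* The [D k] form one map that writes [k] in Bob's output and [D k] in an auxiliary register of
   dimension [c]. Outcome [inl m] reads [m] in that register; the outcomes [inr y] signal failure
   and complete the instrument. *)
pose L0 (x : 'I_c + 'I_B) : 'M[C]_(K, B) :=
  match x with
  | inl m => \matrix_(k, y) D k m y
  | inr y => delta_mx k0 y *m G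
  end.
pose L s x := L0 x *m Th s.
have hL0 : \sum_x adj (L0 x) *m L0 x = 1%:M.
  rewrite big_sumType /=.
  have -> : \sum_(m < c) adj (\matrix_(k, y) D k m y : 'M[C]_(K, B)) *m (\matrix_(k, y) D k m y) =
            \sum_k adj (D k) *m D k.
    apply/matrixP=> y y'; rewrite !summxE.
    transitivity (\sum_(m < c) \sum_k (D k m y)^* * D k m y').
      by apply: eq_bigr => m _; rewrite mxE; apply: eq_bigr => k _; rewrite adjE !mxE.
    rewrite exchange_big; apply: eq_bigr => k _; rewrite mxE.
    by apply: eq_bigr => m _; rewrite adjE.
  have -> : \sum_(y < B) adj (delta_mx k0 y *m G) *m (delta_mx k0 y *m G) = adj G *m G.
    transitivity (adj G *m (\sum_(y < B) delta_mx y y) *m G).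
      rewrite mulmx_sumr mulmx_suml; apply: eq_bigr => y _.
      rewrite adjM -mulmxA (mulmxA (adj (delta_mx k0 y))).
      have -> : adj (delta_mx k0 y : 'M[C]_(K, B)) = delta_mx y k0.
        by apply/matrixP=> i j; rewrite adjE !mxE rmorph_nat andbC.
      by rewrite mul_delta_mx mulmxA.
    have -> : \sum_(y < B) delta_mx y y = 1%:M :> 'M[C]_B.
      by rewrite [RHS](matrix_sum_delta) ; apply: eq_bigr => y _; rewrite (bigD1 y) //= big1 => [|z zy];
        rewrite mxE ?eqxx ?scale1r ?addr0 // eq_sym (negbTE zy) scale0r.
    by rewrite mulmx1.
  by rewrite -eG addrC subrK.
have hL s : \sum_x adj (L s x) *m L s x = 1%:M.
  transitivity (adj (Th s) *m (\sum_x adj (L0 x) *m L0 x) *m Th s); last by rewrite hL0 mulmx1 ThTh.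
  rewrite mulmx_sumr mulmx_suml; apply: eq_bigr => x _.
  by rewrite adjM !mulmxA.
(* Averaging over signs removes the cross terms between distinct indices of one class. *)
have hQ : \sum_s adj (Q s) *m Q s = 1%:M.
  apply/matrixP=> j j'; rewrite summxE.
  transitivity ((a ^+ 2 * \sum_(s : {ffun 'I_A -> bool}) (-1) ^+ (s j) * (-1) ^+ (s j'))%:C * (h j == h j')%:R).
    rewrite rmorphM rmorph_sum /= mulr_sumr mulr_suml; apply: eq_bigr => s _.
    rewrite mxE (bigD1 (h j)) //= big1 => [|k kk]; last first.
      by rewrite adjE !mxE [h j == k]eq_sym (negbTE kk) mulr0 rmorph0 mul0r.
    have eQ k i : Q s k i = a%:C * sg (s i) * (h i == k)%:R by rewrite mxE.
    have eqc : adj (Q s) j (h j) = (a * (-1) ^+ s j)%:C.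
      by rewrite adjE eQ eqxx mulr1 sgr -rmorphM conj_real.
    rewrite eqc eQ sgr addr0 [h j' == _]eq_sym mulrA -!rmorphM.
    congr (real_complex R _ * _); rewrite expr2; ring.
  rewrite sum_signs mxE; case: eqP => [->|_]; last by rewrite mulr0 rmorph0 mul0r.
  by rewrite a2 eqxx mulr1.
have [Pr hPr] := locc_one_way hQ hL.
exists Pr; rewrite hPr.
pose Z := \sum_k D k *m (\sum_(j | h j == k) P j *m X).
(* The signs in [Q s] and [Th s] cancel, so every sign pattern contributes the same amount. *)
have term s m : hs (adj (max_vec R K) *m (kron (Q s) (L s (inl m)) *m stack P X)) =
    K%:R^-1 * a ^+ 2 * \sum_(y < c) nsq (Z m y).
  rewrite hsE mulr_sumr; apply: eq_bigr => y _; rewrite big_ord1 max_vec_kron_stack.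
  have -> : \sum_k \sum_j Q s k j * (L s (inl m) *m P j *m X) k y = a%:C * Z m y.
    rewrite /Z summxE mulr_sumr; apply: eq_bigr => k _.
    rewrite mulmx_sumr summxE mulr_sumr [RHS]big_mkcond; apply: eq_bigr => j _.
    have -> : L s (inl m) *m P j *m X = sg (s j) *: (L0 (inl m) *m (P j *m X)).
      by rewrite /L -!mulmxA (mulmxA (Th s)) ThP -scalemxAl -scalemxAr.
    have -> : (sg (s j) *: (L0 (inl m) *m (P j *m X))) k y = sg (s j) * (D k *m (P j *m X)) m y.
      rewrite mxE; congr (_ * _); rewrite [LHS]mxE [RHS]mxE.
      by apply: eq_bigr => z _; congr (_ * _); rewrite mxE.
    have -> : Q s k j = a%:C * sg (s j) * (h j == k)%:R by rewrite mxE.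
    case: eqP => _; last by rewrite mulr0 mul0r.
    by rewrite mulr1 mulrA -(mulrA a%:C) sg2 mulr1.
  rewrite !nsqM !nsq_real exprVn sqr_sqrtr ?ler0n //; ring.
have pull M : rtr (max_ent R K *m (M *m cq P X *m adj M)) =
    hs (adj (max_vec R K) *m (M *m stack P X)).
  rewrite /hs /ip max_entE /cq !adjM adjK.
  by rewrite [RHS]rtrC -(mulmxA (max_vec R K)) [LHS]rtrC !mulmxA.
rewrite mulmx_sumr rtr_sum.
apply: (@le_trans _ _ (\sum_(s : {ffun 'I_A -> bool}) K%:R^-1 * a ^+ 2 * hs Z)).
  rewrite sumr_const card_ffun card_bool card_ord -[leRHS]mulr_natr natrX.
  by rewrite mulrAC -(mulrA _ (a ^+ 2)) a2 mulr1 mulrC.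
apply: ler_sum => s _; rewrite mulmx_sumr rtr_sum big_sumType /=.
(* Bob's failure outcomes only add nonnegative terms and are dropped. *)
rewrite -[leLHS]addr0; apply: lerD.
  rewrite hsE exchange_big mulr_sumr; apply: ler_sum => m _.
  by rewrite pull term.
by apply: sumr_ge0 => y _; rewrite pull hs_ge0.
Qed.

(** [S] is the inverse square root on the support of [T] and 0 on its kernel, by [0^-1 = 0]. *)
Lemma pinv_sqrt n (T : 'M[C]_n) : psd T -> exists S : 'M[C]_n,
  [/\ adj S = S, S *m T = sqrtm T & S *m T *m S *m S = S].
Proof.
move=> /psd_spectral[U [d [hU d0 ->]]].
exists (adj U *m dg (fun i => (Num.sqrt (d i))^-1) *m U).
have e i : (Num.sqrt (d i))^-1 * d i = Num.sqrt (d i).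
  have [->|di] := eqVneq (d i) 0; first by rewrite mulr0 sqrtr0.
  rewrite -{2}(sqr_sqrtr (d0 i)) expr2 mulrA mulVf ?mul1r //.
  by rewrite sqrtr_eq0 -ltNge lt_def di d0.
split; first exact: adj_conj_dg.
  by rewrite (conj_dgM _ _ hU) /sqrtm (mxfun_diag _ _ hU); apply: conj_dg_eq.
rewrite !(conj_dgM _ _ hU); apply: conj_dg_eq => i; rewrite e.
have [->|di] := eqVneq (Num.sqrt (d i)) 0; first by rewrite invr0 mulr0.
by rewrite mulfV ?mul1r.
Qed.

(** [D k] is the inverse square root of [T k] times the adjoint of [W k]. The ranges of the [W k]
    are mutually orthogonal, so the sum [E] of the [D_k^+ D_k] is a projection. *)
Lemma gram_decoders B c K (W : 'I_K -> 'M[C]_(B, c)) (T : 'I_K -> 'M[C]_c) :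
  (forall k l, adj (W k) *m W l = if k == l then T k else 0) ->
  exists D : 'I_K -> 'M[C]_(c, B), psd (1%:M - \sum_k adj (D k) *m D k) /\
    forall k (Y : 'M[C]_(B, c)), adj (W k) *m Y = T k -> D k *m Y = sqrtm (T k).
Proof.
move=> hW.
have pT k : psd (T k) by have := psd_gram (W k); rewrite hW eqxx.
have [S hS] := fin_all_exists (fun k => pinv_sqrt (pT k)).
exists (fun k => S k *m adj (W k)); split; last first.
  by move=> k Y eY; rewrite -mulmxA eY; case: (hS k).
have eF k : adj (S k *m adj (W k)) *m (S k *m adj (W k)) = W k *m (S k *m S k) *m adj (W k).
  by rewrite adjM adjK; have [-> _ _] := hS k; rewrite !mulmxA.
rewrite (eq_bigr _ (fun k _ => eF k)); set E := \sum_k _.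
have hE : adj E = E.
  rewrite /E adj_sum; apply: eq_bigr => k _.
  by rewrite !adjM adjK; have [-> _ _] := hS k; rewrite !mulmxA.
have EE : E *m E = E.
  rewrite {2}/E mulmx_sumr; apply: eq_bigr => k _.
  rewrite /E mulmx_suml (bigD1 k) //= big1 ?addr0 => [|l lk].
    rewrite !mulmxA -(mulmxA _ (adj (W k))) hW eqxx -!(mulmxA (W k)).
    have [_ _ e] := hS k; congr (_ *m (_ *m _)).
    transitivity (S k *m (S k *m T k *m S k *m S k)); first by rewrite !mulmxA.
    by rewrite e.
  by rewrite !mulmxA -(mulmxA _ (adj (W l))) hW (negbTE lk) !(mul0mx, mulmx0).
have -> : 1%:M - E = adj (1%:M - E) *m (1%:M - E).
  by rewrite adjB adj_1 hE mulmxBl mul1mx mulmxBr mulmx1 EE subrr subr0.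
exact: psd_gram.
Qed.

Lemma hs_conj_proj_le n (P M : 'M[C]_n) : adj P = P -> psd (1%:M - P *m P) ->
  hs (M *m P) <= hs M.
Proof.
move=> hP pP; rewrite -subr_ge0.
have -> : hs M - hs (M *m P) = rtr (adj M *m M *m (1%:M - P *m P)).
  rewrite /hs /ip adjM hP mulmxBr mulmx1 rtrB; congr (_ - _).
  by rewrite [LHS]rtrC -[in RHS]mulmxA [RHS]rtrC !mulmxA.
exact: psd_rtrM (psd_gram M) pP.
Qed.

(** The squared norm of [(P - 1) sqrt S] is the trace of [(P - 1) S (P - 1)^+], which is 0. *)
Lemma sqrtm_range n (P S : 'M[C]_n) : psd S -> P *m S = S -> P *m sqrtm S = sqrtm S.
Proof.
move=> pS PS; apply/eqP; rewrite -subr_eq0 -{2}[sqrtm S]mul1mx -mulmxBl; apply/eqP.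
apply: hs_eq0; rewrite -hs_adj /hs /ip adjK adjM (psd_adj (sqrtm_psd pS)).
rewrite mulmxA -(mulmxA _ (sqrtm S) (sqrtm S)) (sqrtm_sqr pS) mulmxBl PS mul1mx subrr mul0mx.
exact: rtr0.
Qed.

(** Bob's decoders turn each class, cut by [Pm], into [sqrt (T k)]. Were all [T k] equal to their
    mean [G], these roots would add up coherently; Powers-Stoermer measures the deviation, whose
    total is controlled by [greedy_hash]. *)
Lemma hash_fidelity A B c K (P : 'I_A -> 'M[C]_B) (X : 'M[C]_(B, c))
    (Pm : 'M[C]_c) (Pj Nj : 'I_A -> 'M[C]_c) (tau : R) :
  type_of_info P -> (0 < K)%N -> adj Pm = Pm -> Pm *m Pm = Pm ->
  (forall j, adj (Pj j) = Pj j) ->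
  (forall j, Pj j *m (adj X *m P j *m X) = Nj j) ->
  (forall j, Pj j *m (adj X *m P j *m X) *m Pj j = Nj j) ->
  (forall j, psd (Nj j)) ->
  rtr (\sum_j Pm *m Nj j *m Pm) <= 1 ->
  \sum_j hs (Pm *m Nj j *m Pm) <= tau ->
  exists Pr : locc R A B K K,
    1 - 2 * (1 - rtr (\sum_j Pm *m Nj j *m Pm) + Num.sqrt (rtr Pm * K%:R * tau) / 2)
      <= rtr (max_ent R K *m locc_apply Pr (cq P X)).
Proof.
move=> hP K0 hPm PmPm hPj PjS PjSPj psdN t1 hs1.
have [Ph [Po P1]] := hP.
pose Mj j := Pm *m Nj j *m Pm.
have psdM j : psd (Mj j) by have := psd_conj Pm (psdN j); rewrite hPm.
have PmMj j : Pm *m Mj j = Mj j by rewrite /Mj !mulmxA PmPm.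
move: t1 hs1; rewrite -/(Mj _) => t1 hs1.
have [h hh] := greedy_hash Mj K0.
pose T k := \sum_(j | h j == k) Mj j.
(* The cut-offs [Pj] depend on [j] and so enter only the decoders; by [hWT], the class block cut by
   [Pm] alone still overlaps [W k] in exactly [T k]. *)
pose W k := \sum_(j | h j == k) P j *m X *m Pj j *m Pm.
have PP j j' : adj (P j *m X *m Pj j *m Pm) *m (P j' *m X) =
   if j == j' then Pm *m Nj j else 0.
  rewrite 3!adjM hPm hPj Ph -!mulmxA (mulmxA (P j)) Po; case: eqP => [->|_].
    by rewrite -PjS !mulmxA.
  by rewrite !(mul0mx, mulmx0).
have PP' j j' : adj (P j *m X *m Pj j *m Pm) *m (P j' *m X *m Pj j' *m Pm) =
   if j == j' then Mj j else 0.
  rewrite -(mulmxA _ (Pj j')) mulmxA PP; case: eqP => [->|_]; last by rewrite mul0mx.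
  have NPj : Nj j' *m Pj j' = Nj j' by rewrite -{1}PjS PjSPj.
  by rewrite mulmxA -(mulmxA Pm) NPj.
have sum_if (F : 'I_A -> 'M[C]_c) j k : \sum_(j' | h j' == k) (if j == j' then F j else 0) =
    if h j == k then F j else 0.
  rewrite -big_mkcondr; case: ifP => hj.
    by rewrite (big_pred1 j) // => i; rewrite [j == i]eq_sym /=; have [->|_] := eqVneq i j; rewrite ?hj ?andbF.
  by apply: big1 => i /andP[hi /eqP e]; move: hj; rewrite e hi.
have hW k l : adj (W k) *m W l = if k == l then T k else 0.
  rewrite /W adj_sum mulmx_suml.
  transitivity (\sum_(j | h j == k) if h j == l then Mj j else 0).
    apply: eq_bigr => j hj; rewrite mulmx_sumr -sum_if.
    by apply: eq_bigr => j' _; rewrite PP'.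
  case: eqP => [->|kl]; first by apply: eq_bigr => j ->.
  by apply: big1 => j /eqP ->; rewrite ifN //; apply/eqP.
have hWT k : adj (W k) *m ((\sum_(j | h j == k) P j *m X) *m Pm) = T k.
  rewrite /W adj_sum [LHS]mulmx_suml; apply: eq_bigr => j hj.
  rewrite mulmx_suml mulmx_sumr.
  transitivity (\sum_(j' | h j' == k) (if j == j' then Mj j else 0)); last by rewrite sum_if hj.
  apply: eq_bigr => j' _; rewrite mulmxA PP.
  by case: eqP => _ //; rewrite mul0mx.
have [D [pD hD]] := gram_decoders hW.
have [Pr hPr] := hash_protocol X h hP K0 pD.
exists Pr; apply: le_trans hPr.
pose rT k := sqrtm (T k).
have pT k : psd (T k) by apply: psd_sum => j _; exact: psdM.
pose Z := \sum_k D k *m (\sum_(j | h j == k) P j *m X); rewrite -/Z.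
have eZ : Z *m Pm = \sum_k rT k.
  rewrite /Z mulmx_suml; apply: eq_bigr => k _.
  by rewrite -mulmxA; apply: hD; apply: hWT.
have psd1Pm : psd (1%:M - Pm *m Pm).
  have -> : 1%:M - Pm *m Pm = adj (1%:M - Pm) *m (1%:M - Pm).
    by rewrite adjB adj_1 hPm mulmxBl mul1mx mulmxBr mulmx1 !PmPm subrr subr0.
  exact: psd_gram.
have le_hsZ : hs (\sum_k rT k) <= hs Z by rewrite -eZ; exact: hs_conj_proj_le hPm psd1Pm.
have Kp : 0 < K%:R :> R by rewrite ltr0n.
have Ki : 0 < K%:R^-1 :> R by rewrite invr_gt0.
pose t := rtr (\sum_j Mj j); rewrite -/(Mj _) -/t in t1 *.
pose G := (K%:R^-1)%:C *: \sum_j Mj j.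
have pG : psd G by apply: (psdZ (ltW Ki)); apply: psd_sum => j _; exact: psdM.
pose rG := sqrtm G.
have prG : psd rG := sqrtm_psd pG.
have prT k : psd (rT k) := sqrtm_psd (pT k).
have hsrG : hs rG = t / K%:R.
  by rewrite /hs /ip (psd_adj prG) (sqrtm_sqr pG) rtrZ mulrC.
have hsrT k : hs (rT k) = rtr (T k).
  by rewrite /hs /ip (psd_adj (prT k)) (sqrtm_sqr (pT k)).
have sumT : \sum_k T k = \sum_j Mj j.
  rewrite /T (exchange_big_dep predT) //=; apply: eq_bigr => j _.
  by rewrite (big_pred1 (h j)) // => k; rewrite eq_sym.
have PT k : Pm *m T k = T k.
  by rewrite /T mulmx_sumr; apply: eq_bigr => j _; apply: PmMj.
have PG : Pm *m G = G.
  by rewrite /G -scalemxAr mulmx_sumr; congr (_ *: _); apply: eq_bigr => j _; apply: PmMj.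
pose x k := hs (T k - G).
have xk k : hs (rT k - rG) <= Num.sqrt (rtr Pm) * Num.sqrt (x k).
  have := hs_sub_sqr (prT k) prG hPm PmPm (sqrtm_range (pT k) (PT k)) (sqrtm_range pG PG).
  by rewrite /rT /rG (sqrtm_sqr (pT k)) (sqrtm_sqr pG).
(* As [G] is the mean of the [T k], the sum of squared deviations is the excess bounded by
   [greedy_hash]. *)
have sumx : \sum_k x k <= tau.
  apply: le_trans hs1; rewrite -(lerD2l (hs (\sum_j Mj j) / K%:R)); apply: le_trans hh.
  have -> : \sum_k x k = \sum_k hs (T k) - hs (\sum_j Mj j) / K%:R.
    transitivity (\sum_k (hs (T k) - 2 * ip (T k) G + hs G)).
      by apply: eq_bigr => k _; rewrite /x hsB.
    rewrite big_split sumrB -mulr_sumr -ip_suml sumT /= sumr_const card_ord.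
    rewrite /G ipZr hsZ -[_ *+ K]mulr_natr -/(hs _).
    by field; rewrite lt0r_neq0.
  by rewrite addrC subrK.
have x0 k : 0 <= x k by apply: hs_ge0.
have sqx : \sum_k Num.sqrt (x k) <= Num.sqrt (K%:R * tau).
  have := sum_cauchy (fun=> 1) (fun k : 'I_K => Num.sqrt (x k)).
  under eq_bigr => k _ do rewrite mul1r.
  under [X in _ <= X * _]eq_bigr => k _ do rewrite expr1n.
  under [X in _ <= _ * X]eq_bigr => k _ do rewrite sqr_sqrtr //.
  rewrite sumr_const card_ord => hc.
  rewrite -[leLHS]ger0_norm ?sumr_ge0 // -sqrtr_sqr ler_wsqrtr //.
  by apply: le_trans hc _; rewrite ler_pM2l.
(* Polarization: twice the overlap of two roots is the sum of their squared norms minus their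
   squared distance. *)
have ipE : ip rG (\sum_k rT k) = t - (\sum_k hs (rT k - rG)) / 2.
  rewrite ip_sumr.
  transitivity (\sum_k ((rtr (T k) + t / K%:R) / 2 - hs (rT k - rG) / 2)).
    apply: eq_bigr => k _; rewrite hsB hsrG hsrT (ipC rG).
    by move: (ip _ _) (rtr _) (t / _) => u v w; field.
  rewrite sumrB -!mulr_suml; congr (_ - _).
  rewrite big_split /= -rtr_sum sumT -/t sumr_const card_ord -[_ *+ K]mulr_natr divfK ?lt0r_neq0 //.
  by field.
have ip_ge : 1 - (1 - t + Num.sqrt (rtr Pm * K%:R * tau) / 2) <= ip rG (\sum_k rT k).
  rewrite ipE opprD addrA subKr lerD2l lerN2 ler_pM2r ?invr_gt0 ?ltr0n //.
  rewrite -mulrA sqrtrM; last by have := psd_rtr (psd_gram Pm); rewrite hPm PmPm.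
  apply: (@le_trans _ _ (\sum_k Num.sqrt (rtr Pm) * Num.sqrt (x k))); first exact: ler_sum.
  by rewrite -mulr_sumr ler_wpM2l ?sqrtr_ge0.
have cs := ip_cauchy rG (\sum_k rT k).
apply: (@le_trans _ _ (ip rG (\sum_k rT k) ^+ 2)); last first.
  apply: le_trans cs _; rewrite hsrG mulrAC [leRHS]mulrC [leLHS]mulrC ler_pM2l //.
  apply: le_trans le_hsZ; rewrite -[leRHS]mul1r; apply: ler_wpM2r => //; exact: hs_ge0.
(* Uses [v^2 >= 2 v - 1]. *)
move: ip_ge; move: (1 - t + _) (ip _ _); clear => u v uv.
have := sqr_ge0 (v - 1); have -> : (v - 1) ^+ 2 = v ^+ 2 - 2 * v + 1 by ring.
by move: (v ^+ 2) => w; lra.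
Qed.

(** * One-shot distillation from spectral cut-offs *)

Section OneShotTheorem.
Variables (A B c K : nat) (P : 'I_A -> 'M[C]_B) (X : 'M[C]_(B, c)).
Variables (U : 'M[C]_c) (mu : 'I_c -> R) (V : 'I_A -> 'M[C]_c) (lam : 'I_A -> 'I_c -> R).
Variables (G : pred 'I_c) (L : 'I_A -> pred 'I_c) (tau e1 e2 : R).
Hypothesis hP : type_of_info P.
Hypothesis K0 : (0 < K)%N.
Hypothesis hU : unitary U.
Hypothesis hV : forall j, unitary (V j).
Hypothesis eS : adj X *m X = adj U *m dg mu *m U.
Hypothesis eSj : forall j, adj X *m P j *m X = adj (V j) *m dg (lam j) *m V j.
Hypothesis lam0 : forall j e, 0 <= lam j e.
Hypothesis mu1 : \sum_i mu i = 1.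
Hypothesis hL : forall j e, L j e -> lam j e <= tau.
Hypothesis tau0 : 0 <= tau.
Hypothesis he1 : 1 - e1 <= \sum_j \sum_(e | L j e) lam j e.
Hypothesis he2 : \sum_(i | ~~ G i) mu i <= e2.

Let ind (Q : pred 'I_c) (i : 'I_c) : R := (Q i)%:R.
Let Pm := adj U *m dg (ind G) *m U.
Let Pj j := adj (V j) *m dg (ind (L j)) *m V j.
Let Nj j := adj (V j) *m dg (fun e => lam j e * ind (L j) e) *m V j.
Let Mj j := Pm *m Nj j *m Pm.

Let indM Q i : ind Q i * ind Q i = ind Q i.
Proof. by rewrite /ind; case: (Q i); rewrite ?mulr1 ?mulr0. Qed.

Let hPm : adj Pm = Pm. Proof. exact: adj_conj_dg. Qed.
Let PmPm : Pm *m Pm = Pm.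
Proof. by rewrite /Pm (conj_dgM _ _ hU); apply: conj_dg_eq => i; apply: indM. Qed.

Let psd1Pm : psd (1%:M - Pm).
Proof.
rewrite -(conj_dg1 hU) conj_dgB; apply: psd_conj'; apply: psd_dg => i.
by rewrite subr_ge0 /ind; case: (G i).
Qed.

Let hPj j : adj (Pj j) = Pj j. Proof. exact: adj_conj_dg. Qed.

Let psdNj j : psd (Nj j).
Proof. by apply: psd_conj'; apply: psd_dg => e; rewrite mulr_ge0. Qed.

Let PjS j : Pj j *m (adj X *m P j *m X) = Nj j.
Proof.
by rewrite eSj (conj_dgM _ _ (hV j)); apply: conj_dg_eq => e; rewrite mulrC.
Qed.

Let PjSPj j : Pj j *m (adj X *m P j *m X) *m Pj j = Nj j.
Proof.
rewrite PjS (conj_dgM _ _ (hV j)); apply: conj_dg_eq => e.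
by rewrite -mulrA indM.
Qed.

Let sum_lam : \sum_j \sum_e lam j e = 1.
Proof.
rewrite -mu1 -(rtr_conj_dg mu hU) -eS.
have [_ [_ P1]] := hP.
have -> : adj X *m X = \sum_j adj X *m P j *m X.
  by rewrite -mulmx_suml -mulmx_sumr P1 mulmx1.
by rewrite rtr_sum; apply: eq_bigr => j _; rewrite eSj rtr_conj_dg.
Qed.

Let rtrMj j : rtr (Mj j) = rtr (Nj j *m Pm).
Proof. by rewrite /Mj rtrC mulmxA PmPm rtrC. Qed.

(** The eigenvalues kept by [L j] are at most [tau], so squared norms are at most [tau] times
    traces; compression by [Pm] only lowers them. *)
Let sum_hs : \sum_j hs (Mj j) <= tau.
Proof.
apply: (@le_trans _ _ (\sum_j \sum_e tau * lam j e)); last first.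
  by under eq_bigr => j _ do rewrite -mulr_sumr; rewrite -mulr_sumr sum_lam mulr1.
apply: ler_sum => j _.
have p1 : psd (1%:M - Pm *m Pm) by rewrite PmPm.
apply: le_trans (hs_conj_proj_le _ hPm p1) _.
rewrite -hs_adj adjM hPm; apply: le_trans (hs_conj_proj_le _ hPm p1) _.
rewrite /hs /ip adjK (psd_adj (psdNj j)) (conj_dgM _ _ (hV j)) (rtr_conj_dg _ (hV j)).
apply: ler_sum => e _.
have -> : lam j e * ind (L j) e * (lam j e * ind (L j) e) = lam j e * (ind (L j) e * ind (L j) e) * lam j e.
  ring.
rewrite indM; apply: ler_wpM2r => //; rewrite /ind.
by case: (boolP (L j e)) => [/hL|_]; rewrite ?mulr1 ?mulr0.
Qed.

Let t := rtr (\sum_j Mj j).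

Let t_le1 : t <= 1.
Proof.
rewrite /t rtr_sum -sum_lam; apply: ler_sum => j _; rewrite rtrMj.
apply: (@le_trans _ _ (rtr (Nj j))).
  by rewrite -subr_ge0 -rtrB -{1}[Nj j]mulmx1 -mulmxBr; exact: psd_rtrM (psdNj j) psd1Pm.
rewrite (rtr_conj_dg _ (hV j)); apply: ler_sum => e _.
by rewrite /ind; case: (L j e); rewrite ?mulr1 ?mulr0.
Qed.

(** The weight that [Pm] removes from [Nj j] is at most what it removes from the full conditional
    state; over all [j] the latter is the weight of [mu] outside [G]. *)
Let t_ge : 1 - (e1 + e2) <= t.
Proof.
rewrite /t rtr_sum opprD addrA lerBlDr.
apply: le_trans he1 _; apply: le_trans (lerD (lexx _) he2).
have -> : \sum_(i | ~~ G i) mu i = \sum_j rtr ((adj X *m P j *m X) *m (1%:M - Pm)).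
  rewrite -rtr_sum -mulmx_suml -mulmx_suml -mulmx_sumr.
  have [_ [_ ->]] := hP; rewrite mulmx1 eS -(conj_dg1 hU) conj_dgB (conj_dgM _ _ hU) (rtr_conj_dg _ hU).
  rewrite big_mkcond; apply: eq_bigr => i _; rewrite /ind.
  by case: (G i); rewrite /= ?subrr ?subr0 ?mulr0 ?mulr1.
rewrite -big_split; apply: ler_sum => j _ /=.
have -> : \sum_(e | L j e) lam j e = rtr (Nj j).
  rewrite (rtr_conj_dg _ (hV j)) big_mkcond; apply: eq_bigr => e _; rewrite /ind.
  by case: (L j e); rewrite ?mulr1 ?mulr0.
rewrite rtrMj -subr_ge0.
have -> : rtr (Nj j *m Pm) + rtr (adj X *m P j *m X *m (1%:M - Pm)) - rtr (Nj j) =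
   rtr ((adj X *m P j *m X - Nj j) *m (1%:M - Pm)).
  by rewrite [in RHS]mulmxBl [in RHS]rtrB [in X in _ = _ - rtr X]mulmxBr mulmx1 rtrB opprB [in RHS]addrCA addrA.
refine (psd_rtrM _ psd1Pm); rewrite eSj conj_dgB; apply: psd_conj'; apply: psd_dg => e.
by rewrite subr_ge0 /ind; case: (L j e); rewrite ?mulr1 ?mulr0.
Qed.

Lemma one_shot_distillation : exists Pr : locc R A B K K,
  1 - 2 * (e1 + e2 + Num.sqrt (#|G|%:R * K%:R * tau) / 2)
    <= rtr (max_ent R K *m locc_apply Pr (cq P X)).
Proof.
have [Pr hPr] := hash_fidelity hP K0 hPm PmPm hPj PjS PjSPj psdNj t_le1 sum_hs.
exists Pr; apply: le_trans hPr.
have -> : rtr Pm = #|G|%:R.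
  rewrite (rtr_conj_dg _ hU) /ind -sum1_card natr_sum [RHS]big_mkcond.
  by apply: eq_bigr => i _; rewrite unfold_in; case: (G i).
move: t_ge; rewrite -/t; move: t (Num.sqrt _) => x y h; lra.
Qed.

End OneShotTheorem.

End OneShot.

(** * Achievability of the hashing rate *)

Section Asymptotic.
Variable R : realType.
Local Notation C := (R[i]).
Local Notation "x %:C" := (real_complex R x) (format "x %:C").
Opaque adj.

(** Everything typicality needs, in a form stable under tensor products: spectra of [X^+ X] and of
    the [X^+ P_j X], with the moments of minus the logarithm of the eigenvalues. [s] and [h] are
    entropies per copy in nats. *)
Definition cq_data (n A B : nat) (M : 'M[C]_(A * B)) (s vs h vh : R) :=
  exists (c : nat) (P : 'I_A -> 'M[C]_B) (X : 'M[C]_(B, c))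
    (U : 'M[C]_c) (mu : 'I_c -> R) (V : 'I_A -> 'M[C]_c) (lam : 'I_A -> 'I_c -> R),
  [/\ type_of_info P /\ M = cq P X,
      unitary U /\ (forall j, unitary (V j)),
      adj X *m X = adj U *m dg mu *m U /\
        (forall j, adj X *m P j *m X = adj (V j) *m dg (lam j) *m V j),
      moments mu (fun i => - ln (mu i)) s vs n
    & moments (fun p : 'I_A * 'I_c => lam p.1 p.2) (fun p => - ln (lam p.1 p.2)) h vh n].

Lemma type_of_info_kron a b A B (P : 'I_a -> 'M[C]_b) (P' : 'I_A -> 'M[C]_B) :
  type_of_info P -> type_of_info P' ->
  type_of_info (fun k : 'I_(a * A) => kron (P (mxtens.mxtens_unindex k).1) (P' (mxtens.mxtens_unindex k).2)).
Proof.
move=> [Ph [Po P1]] [Ph' [Po' P1']]; split; [|split].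
- by move=> j; rewrite adj_kron Ph Ph'.
- move=> j k; case: (mxtens.mxtens_indexP j) => j1 j2; case: (mxtens.mxtens_indexP k) => k1 k2.
  rewrite -/(ix j1 j2) -/(ix k1 k2) !ixK ix_eq kronM Po Po' /=.
  by case: eqP => _; case: eqP => _; rewrite ?kron0l ?kron0r.
- rewrite sum_ix -kron11 -P1 -P1' kron_suml; apply: eq_bigr => i _.
  by rewrite kron_sumr; apply: eq_bigr => j _; rewrite ixK.
Qed.

Lemma btens_cq a b c A B C' (P : 'I_a -> 'M[C]_b) (X : 'M[C]_(b, c))
    (P' : 'I_A -> 'M[C]_B) (X' : 'M[C]_(B, C')) :
  btens (cq P X) (cq P' X') =
  cq (fun k : 'I_(a * A) => kron (P (mxtens.mxtens_unindex k).1) (P' (mxtens.mxtens_unindex k).2)) (kron X X').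
Proof.
rewrite btensE; apply: matrix_ixP => i y k z.
case: (mxtens.mxtens_indexP i) => i1 i2; case: (mxtens.mxtens_indexP y) => y1 y2.
case: (mxtens.mxtens_indexP k) => k1 k2; case: (mxtens.mxtens_indexP z) => z1 z2.
rewrite -/(ix i1 i2) -/(ix y1 y2) -/(ix k1 k2) -/(ix z1 z2).
rewrite mxE !bdecE /cq [in LHS]mxE [X in _ * X]mxE [in RHS]mxE sum_ix mulr_suml.
apply: eq_bigr => m _; rewrite mulr_sumr; apply: eq_bigr => m' _.
by rewrite !adjE !stackE !ixK /= !kronM !kronE rmorphM mulrACA.
Qed.

Lemma ln_mul_pos (x y : R) : 0 <= x -> 0 <= y -> x * y != 0 ->
  - ln (x * y) = - ln x + - ln y.
Proof.
move=> x0 y0; rewrite mulf_eq0 negb_or => /andP[xn yn].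
by rewrite lnM ?posrE ?lt_def ?xn ?yn // opprD.
Qed.

Lemma cq_data_btens a b A B n (rho : 'M[C]_(a * b)) (M : 'M[C]_(A * B)) s vs h vh :
  cq_data 1 rho s vs h vh -> cq_data n M s vs h vh ->
  cq_data n.+1 (btens rho M) s vs h vh.
Proof.
move=> [c [P [X [U [mu [V [lam [[hP ->] [hU hV] [eS eSj] m1 m2]]]]]]]].
move=> [c' [P' [X' [U' [mu' [V' [lam' [[hP' ->] [hU' hV'] [eS' eSj'] m1' m2']]]]]]]].
have db m k := @kdec_bij m k.
exists (c * c')%N, (fun k : 'I_(a * A) => kron (P (mxtens.mxtens_unindex k).1) (P' (mxtens.mxtens_unindex k).2)).
exists (kron X X'), (kron U U'), (fun k => mu (mxtens.mxtens_unindex k).1 * mu' (mxtens.mxtens_unindex k).2).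
exists (fun k : 'I_(a * A) => kron (V (mxtens.mxtens_unindex k).1) (V' (mxtens.mxtens_unindex k).2)).
exists (fun j e => lam (mxtens.mxtens_unindex j).1 (mxtens.mxtens_unindex e).1 *
                   lam' (mxtens.mxtens_unindex j).2 (mxtens.mxtens_unindex e).2).
split.
- by split; [apply: type_of_info_kron | rewrite btens_cq].
- split; first by rewrite kron_tens; apply: unitary_tens.
  by move=> j; rewrite kron_tens; apply: unitary_tens.
- split; first by rewrite adj_kron kronM eS eS' !kron_tens (tens_conj_dg (db _ _)).
  by move=> j; rewrite adj_kron !kronM eSj eSj' !kron_tens (tens_conj_dg (db _ _)).
- have [w0 _ _ _] := m1; have [w0' _ _ _] := m1'.
  by apply: (moments_prod (db _ _) m1 m1') => k // k0; apply: ln_mul_pos.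
- have [w0 _ _ _] := m2; have [w0' _ _ _] := m2'.
  apply: (moments_prod (dec2_bij (db _ _) (db _ _)) m2 m2') => k //= k0; apply: ln_mul_pos => //.
    exact: (w0 (_, _)).
  exact: (w0' (_, _)).
Qed.

Lemma cq_data_bpow a b (rho : 'M[C]_(a * b)) s vs h vh n :
  cq_data 1 rho s vs h vh -> cq_data n (bpow rho n) s vs h vh.
Proof.
move=> h1; pose Pr n A B (M M' : 'M[C]_(A * B)) := cq_data n M s vs h vh.
apply: (@bpow_ind _ a b rho rho Pr) => [|{}n A B M M' hM]; last exact: cq_data_btens.
have u1 : unitary (1%:M : 'M[C]_1) by rewrite /unitary adj_1 mulmx1.
exists 1%N, (fun=> 1%:M), (1%:M), 1%:M, (fun=> 1), (fun=> 1%:M), (fun=> fun=> 1); split.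
- split; last first.
    apply: matrix_ixP => i j k l; rewrite /cq [RHS]mxE big_ord1 adjE !stackE mulmx1.
    by rewrite !ord1 !mxE eqxx /= conjC1 mulr1.
  split; first by move=> _; rewrite adj_1.
  by split; [move=> j k; rewrite !ord1 eqxx mulmx1 | rewrite big_ord1].
- by [].
- by rewrite dg1 adj_1 !mulmx1.
- by apply: moments0 => [i|| i _]; rewrite ?ler01 ?big_ord1 // ln1 oppr0.
- apply: moments0 => [i|| i _] /=; rewrite ?ler01 // ?ln1 ?oppr0 //.
  by rewrite -(pair_bigA _ (fun i j => 1)) /= !big_ord1.
Qed.

(** [G] has at most [exp (n (s + d))] elements and [tau = exp (- n (h - d))], so the product under
    the root is at most [exp (- 2 n d)]; this is where [4 d] is spent. *)
Lemma typical_distillation n A B K (M : 'M[C]_(A * B)) s vs h vh (d r : R) :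
  cq_data n M s vs h vh -> (0 < n)%N -> (0 < K)%N -> 0 < d ->
  K%:R <= expR (n%:R * r) -> r + s + 4 * d <= h ->
  exists Pr : locc R A B K K,
    1 - 2 * (vh / (n%:R * d ^+ 2) + vs / (n%:R * d ^+ 2) + expR (- (n%:R * d)) / 2)
    <= rtr (max_ent R K *m locc_apply Pr M).
Proof.
move=> [c [P [X [U [mu [V [lam [[hP ->] [hU hV] [eS eSj] m1 m2]]]]]]]] n0 K0 d0 hK hr.
have [mu0 mu1 _ _] := m1; have [lam0 lam1 _ _] := m2.
(* Positivity keeps zero eigenvalues, on which [ln] takes a default value, out of the count. *)
pose G i := (0 < mu i) && (`|- ln (mu i) - n%:R * s| <= n%:R * d).
pose L j e := (0 < lam j e) && (`|- ln (lam j e) - n%:R * h| <= n%:R * d).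
pose tau := expR (- (n%:R * (h - d))).
have hL j e : L j e -> lam j e <= tau.
  move=> /andP[p q]; rewrite -[lam j e]lnK ?posrE // ler_expR.
  by move: q; rewrite ler_norml => /andP[q _]; move: q; rewrite mulrBr; lra.
have he1 : 1 - vh / (n%:R * d ^+ 2) <= \sum_j \sum_(e | L j e) lam j e.
  apply: le_trans (moments_typical m2 n0 d0) _.
  rewrite big_mkcond -(pair_bigA _ (fun i j => if `|- ln (lam i j) - n%:R * h| <= n%:R * d then lam i j else 0)) /=.
  apply: ler_sum => j _; rewrite [leRHS]big_mkcond; apply: ler_sum => e _.
  rewrite /L; have [->|le] := eqVneq (lam j e) 0; first by rewrite ltxx; case: ifP.
  by rewrite lt_def le (lam0 (j, e)).
have he2 : \sum_(i | ~~ G i) mu i <= vs / (n%:R * d ^+ 2).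
  apply: le_trans (moments_chebyshev m1 n0 d0).
  rewrite big_mkcond [leRHS]big_mkcond; apply: ler_sum => i _; rewrite /G.
  have [->|le] := eqVneq (mu i) 0; first by rewrite ltxx; case: ifP.
  by rewrite lt_def le mu0 /= -ltNge.
have [Pr hPr] := one_shot_distillation hP K0 hU hV eS eSj (fun j e => lam0 (j, e)) mu1 hL (expR_ge0 _) he1 he2.
exists Pr; apply: le_trans hPr.
suff : Num.sqrt (#|G|%:R * K%:R * tau) <= expR (- (n%:R * d)).
  by move: (Num.sqrt _) (expR _) (vh / _) (vs / _) => u v w z; lra.
rewrite -[leRHS]ger0_norm ?expR_ge0 // -sqrtr_sqr ler_wsqrtr // -expRM_natr.
(* Each counted eigenvalue is at least [exp (- n (s + d))], and all of them sum to 1. *)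
have cG : #|G|%:R <= expR (n%:R * (s + d)).
  have : \sum_(i in G) expR (- (n%:R * (s + d))) <= 1.
    rewrite -[X in _ <= X]mu1 [leRHS](bigID (mem G)) /= -[leLHS]addr0; apply: lerD; last exact: sumr_ge0.
    apply: ler_sum => i; rewrite unfold_in => /andP[p q].
    rewrite -[mu i]lnK ?posrE // ler_expR.
    by move: q; rewrite ler_norml => /andP[_ q]; move: q; rewrite mulrDr; lra.
  by rewrite sumr_const -[_ *+ _]mulr_natl expRN ler_pdivrMr ?expR_gt0 // mul1r.
apply: (@le_trans _ _ (expR (n%:R * (s + d)) * expR (n%:R * r) * tau)).
  by rewrite ler_wpM2r ?expR_ge0 // ler_pM ?ler0n.
rewrite -!expRD ler_expR.
have n0' : 0 <= n%:R :> R by apply: ler0n.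
have : n%:R * (r + s + 4 * d) <= n%:R * h by apply: ler_wpM2l.
by move: (n%:R); clear => x; lra.
Qed.

Lemma trace_norm_ge0 n (M : 'M[C]_n) : 0 <= trace_norm M.
Proof. by apply: psd_rtr; apply: sqrtm_psd; apply: psd_gram. Qed.

Lemma trace_norm_max_ent K (w : 'M[C]_(K * K)) : (0 < K)%N -> psd w -> rtr w = 1 ->
  trace_norm (w - max_ent R K) <=
  2 * (1 - rtr (max_ent R K *m w)) + 2 * Num.sqrt (1 - rtr (max_ent R K *m w)).
Proof.
by move=> K0 pw w1; rewrite max_entE; apply: trace_norm_pure => //; apply: max_vec_norm.
Qed.

(** [achievable_rate] asks for a protocol at every [n], including [n = 0]; the hash protocol with
    zero decoders supplies one. *)
Lemma locc_inhabited n A B K (M : 'M[C]_(A * B)) s vs h vh :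
  cq_data n M s vs h vh -> (0 < K)%N -> inhabited (locc R A B K K).
Proof.
move=> [c [P [X [_ [_ [_ [_ [[hP _] _ _ _ _]]]]]]]] K0.
have [|Pr _] := hash_protocol X (fun=> Ordinal K0) (D := fun=> 0) hP K0; last by exists.
by rewrite big1 => [|k _]; rewrite ?mulmx0 // subr0; apply: psd1.
Qed.

Lemma achievable_of_fidelity a b (rho : 'M[C]_(a * b)) (r : R) (y : nat -> R) (c0 : R) :
  (forall n, psd (bpow rho n) /\ rtr (bpow rho n) = 1) ->
  (forall n, y n <= c0 / n%:R) ->
  (forall n, exists Pr : locc R (a ^ n) (b ^ n) (2 ^ Num.truncn (r * n%:R)) (2 ^ Num.truncn (r * n%:R)),
     (0 < n)%N -> 1 - y n <= rtr (max_ent R (2 ^ Num.truncn (r * n%:R)) *m locc_apply Pr (bpow rho n))) ->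
  achievable_rate rho r.
Proof.
move=> dens hy hPr; pose P n := projT1 (cid (hPr n)); exists P.
apply/cvgrPdist_lt => e e0.
(* An infidelity [x] below 1 satisfies [2 x + 2 sqrt x <= 4 sqrt x], and [x < (e / 4)^2] makes this
   less than [e]. *)
pose eta := Num.min 1 ((e / 4) ^+ 2).
have eta0 : 0 < eta by rewrite /eta lt_min ltr01 exprn_gt0 // divr_gt0.
exists (Num.truncn (`|c0| / eta)).+1 => // n /= hn.
have n0 : (0 < n)%N by apply: leq_trans hn.
have nr0 : 0 < n%:R :> R by rewrite ltr0n.
rewrite sub0r normrN ger0_norm ?trace_norm_ge0 //.
have K0 : (0 < 2 ^ Num.truncn (r * n%:R))%N by rewrite expn_gt0.
have [pr tr] := dens n.
have [pw tw] := locc_psd_rtr (P n) pr.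
have pF : 1 - y n <= rtr (max_ent R (2 ^ Num.truncn (r * n%:R)) *m locc_apply (P n) (bpow rho n)).
  exact: (projT2 (cid (hPr n)) n0).
apply: le_lt_trans (trace_norm_max_ent K0 pw (etrans tw tr)) _.
have [_ pE'] := max_ent_effect R K0.
have F1 : 0 <= 1 - rtr (max_ent R (2 ^ Num.truncn (r * n%:R)) *m locc_apply (P n) (bpow rho n)).
  have := psd_rtrM pE' pw; rewrite mulmxBl mul1mx rtrB tw tr //.
have yeta : 1 - rtr (max_ent R (2 ^ Num.truncn (r * n%:R)) *m locc_apply (P n) (bpow rho n)) < eta.
  apply: (@le_lt_trans _ _ (`|c0| / n%:R)).
    apply: (@le_trans _ _ (y n)); first by rewrite lerBlDr addrC -lerBlDr.
    by apply: le_trans (hy n) _; rewrite ler_pM2r ?invr_gt0 // ler_norm.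
  rewrite ltr_pdivrMr // mulrC -ltr_pdivrMr //.
  by apply: lt_le_trans (truncnS_gt _) _; rewrite ler_nat.
move: F1 yeta; move: (1 - rtr _) => x x0; rewrite /eta lt_min => /andP[x1 xe].
have s4 : Num.sqrt x < e / 4.
  rewrite -[ltRHS]ger0_norm ?divr_ge0 ?ltW // -sqrtr_sqr ltr_sqrt //.
  by rewrite exprn_gt0 // divr_gt0.
have s1 : Num.sqrt x <= 1 by rewrite -sqrtr1 ler_wsqrtr // ltW.
have xs : x <= Num.sqrt x.
  by rewrite -{1}(sqr_sqrtr x0) expr2 -[leRHS]mulr1 ler_wpM2l ?sqrtr_ge0.
by move: s4 xs; move: (Num.sqrt x) => z; clear; lra.
Qed.

Theorem achievable_lt a b (rho : 'M[C]_(a * b)) s vs h vh (r : R) :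
  (forall n, psd (bpow rho n) /\ rtr (bpow rho n) = 1) ->
  cq_data 1 rho s vs h vh -> 0 <= r -> r * ln 2 < h - s -> achievable_rate rho r.
Proof.
move=> dens hd r0 rh.
pose d := (h - s - r * ln 2) / 4.
have d0 : 0 < d by rewrite /d divr_gt0 ?ltr0n // subr_gt0.
have eh : r * ln 2 + s + 4 * d <= h.
  by rewrite /d; move: (r * ln 2) => z; rewrite mulrC divfK ?pnatr_eq0 //; lra.
move: d d0 eh {rh} => d d0 eh.
pose y n := 2 * (vh / (n%:R * d ^+ 2) + vs / (n%:R * d ^+ 2) + expR (- (n%:R * d)) / 2).
(* The last summand comes from [exp (- n d) <= 1 / (n d)]. *)
pose c0 := 2 * (vh / d ^+ 2 + vs / d ^+ 2 + d^-1 / 2).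
(* At [n = 0] the bound [c0 / n] is 0 by convention, so the error is set to 0 there. *)
apply: (@achievable_of_fidelity _ _ _ _ (fun n => if (0 < n)%N then y n else 0) c0) => //.
- move=> n; case: (posnP n) => [->|n0] /=; first by rewrite invr0 mulr0.
  have nr0 : 0 < n%:R :> R by rewrite ltr0n.
  have h1 : expR (- (n%:R * d)) <= d^-1 / n%:R.
    rewrite -invfM [d * _]mulrC expRN lef_pV2 ?posrE ?expR_gt0 ?mulr_gt0 //.
    by apply: le_trans (expR_ge1Dx _); rewrite lerDr ler01.
  rewrite /y /c0 -mulrA ler_pM2l ?ltr0n // 2!mulrDl.
  have q (v : R) : v / (n%:R * d ^+ 2) = v / d ^+ 2 / n%:R.
    by rewrite invfM [n%:R^-1 * _]mulrC mulrA.
  by rewrite !q lerD // mulrAC ler_pM2r ?invr_gt0 ?ltr0n.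
- move=> n; have K0 : (0 < 2 ^ Num.truncn (r * n%:R))%N by rewrite expn_gt0.
  have dn := cq_data_bpow n hd.
  have [Pr0] := locc_inhabited dn K0.
  case: (posnP n) => [n0|n0].
    by exists Pr0.
  have hK : (2 ^ Num.truncn (r * n%:R))%N%:R <= expR (n%:R * (r * ln 2)).
    rewrite natrX -[X in X ^+ _](@lnK _ 2) ?posrE ?ltr0n // -expRM_natl ler_expR mulrA.
    rewrite ler_pM2r ?ln2_gt0 // [n%:R * r]mulrC truncn_le.
    by rewrite mulr_ge0.
  have [Pr hPr] := typical_distillation dn n0 K0 d0 hK eh.
  by exists Pr.
Qed.

(** At rate 0 the target has rank [K = 1] and [max_ent] is the identity. This makes [E_D]
    nonnegative even when no positive rate is available. *)
Lemma achievable0 a b (rho : 'M[C]_(a * b)) s vs h vh :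
  (forall n, psd (bpow rho n) /\ rtr (bpow rho n) = 1) ->
  cq_data 1 rho s vs h vh -> achievable_rate rho 0.
Proof.
move=> dens hd.
apply: (@achievable_of_fidelity _ _ _ _ (fun=> 0) 0 dens _ _) => n; first by rewrite mul0r.
have K0 : (0 < 2 ^ Num.truncn (0 * n%:R : R))%N by rewrite expn_gt0.
have [Pr] := locc_inhabited (cq_data_bpow n hd) K0; exists Pr => _.
have [pr tr] := dens n; have [pw tw] := locc_psd_rtr Pr pr.
rewrite subr0 -[X in X <= _]tr -tw; move: (locc_apply Pr _).
have -> : (2 ^ Num.truncn (0 * n%:R : R))%N = 1%N by rewrite mul0r truncn0.
move=> w; have -> : max_ent R 1 = 1%:M; last by rewrite mul1mx.
by apply: matrix_ixP => i j k l; rewrite !mxE !ixK !ord1 eqxx /= invr1.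
Qed.

End Asymptotic.

(** * Entropies of the measured state *)

Section Blocks.
Variable R : realType.
Local Notation C := (R[i]).
Local Notation "x %:C" := (real_complex R x) (format "x %:C").
Opaque adj.

(** A column of arbitrary blocks; [stack P X] is the case of blocks [P j *m X]. *)
Definition gst (A p q : nat) (F : 'I_A -> 'M[C]_(p, q)) : 'M[C]_(A * p, q) :=
  \matrix_(k, m) F (mxtens.mxtens_unindex k).1 (mxtens.mxtens_unindex k).2 m.

Definition blk (A p q : nat) (E : 'I_A -> 'M[C]_(p, q)) : 'M[C]_(A * p, A * q) :=
  \sum_j kron (delta_mx j j) (E j).

Lemma gstE A p q (F : 'I_A -> 'M[C]_(p, q)) j y m : gst F (ix j y) m = F j y m.
Proof. by rewrite [LHS]mxE ixK. Qed.

Lemma blkE A p q (E : 'I_A -> 'M[C]_(p, q)) j y k z :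
  blk E (ix j y) (ix k z) = E j y z *+ (j == k).
Proof.
rewrite /blk summxE (bigD1 j) //= kronE mxE eqxx /= big1 => [|i ij].
  by rewrite addr0 [k == j]eq_sym; case: eqP; rewrite ?mul1r ?mul0r.
by rewrite kronE mxE [j == i]eq_sym (negbTE ij) mul0r.
Qed.

Lemma matrix_ixl_P A p q (F G : 'M[C]_(A * p, q)) :
  (forall j y m, F (ix j y) m = G (ix j y) m) -> F = G.
Proof.
by move=> h; apply/matrixP=> i m; case: (mxtens.mxtens_indexP i) => j y; apply: h.
Qed.

Lemma adj_blk A p q (E : 'I_A -> 'M[C]_(p, q)) : adj (blk E) = blk (fun j => adj (E j)).
Proof.
apply: matrix_ixP => j y k z; rewrite adjE !blkE adjE eq_sym.
by case: eqP => [->|_]; rewrite ?mulr1n ?mulr0n ?rmorph0.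
Qed.

Lemma blkM A p q r (E : 'I_A -> 'M[C]_(p, q)) (F : 'I_A -> 'M[C]_(q, r)) :
  blk E *m blk F = blk (fun j => E j *m F j).
Proof.
apply: matrix_ixP => j y k z; rewrite mxE sum_ix (bigD1 j) //= [X in _ + X]big1 => [|i ij].
  rewrite addr0 blkE mxE -sumrMnl; apply: eq_bigr => l _.
  by rewrite !blkE eqxx mulr1n mulrnAr.
by apply: big1 => l _; rewrite blkE eq_sym (negbTE ij) mul0r.
Qed.

Lemma blk_gst A p q r (E : 'I_A -> 'M[C]_(p, q)) (F : 'I_A -> 'M[C]_(q, r)) :
  blk E *m gst F = gst (fun j => E j *m F j).
Proof.
apply: matrix_ixl_P => j y m; rewrite mxE sum_ix (bigD1 j) //= [X in _ + X]big1 => [|i ij].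
  rewrite addr0 gstE mxE; apply: eq_bigr => l _.
  by rewrite blkE gstE eqxx mulr1n.
by apply: big1 => l _; rewrite blkE eq_sym (negbTE ij) mul0r.
Qed.

Lemma adj_gst_mul A p q r (F : 'I_A -> 'M[C]_(p, q)) (G : 'I_A -> 'M[C]_(p, r)) :
  adj (gst F) *m gst G = \sum_j adj (F j) *m G j.
Proof.
apply/matrixP=> x z; rewrite mxE sum_ix summxE; apply: eq_bigr => j _.
by rewrite mxE; apply: eq_bigr => y _; rewrite !adjE !gstE.
Qed.

Lemma blk_dg A p (d : 'I_A -> 'I_p -> R) :
  blk (fun j => dg (d j)) =
  dg (fun k => d (mxtens.mxtens_unindex k).1 (mxtens.mxtens_unindex k).2).
Proof.
apply: matrix_ixP => j y k z; rewrite blkE !dgE ixK ix_eq.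
by case: (j == k); rewrite ?mulr0n ?mulr1n.
Qed.

Lemma unitary_blk A p (U : 'I_A -> 'M[C]_p) : (forall j, unitary (U j)) -> unitary (blk U).
Proof.
move=> hU; rewrite /unitary adj_blk blkM; apply: matrix_ixP => j y k z.
by rewrite blkE hU !mxE ix_eq; case: (j == k); rewrite ?mulr0n ?mulr1n.
Qed.

Lemma rtr_blk A p (E : 'I_A -> 'M[C]_p) : rtr (blk E) = \sum_j rtr (E j).
Proof.
rewrite /rtr /mxtrace sum_ix Re_sum; apply: eq_bigr => j _; congr complex.Re.
by apply: eq_bigr => y _; rewrite blkE eqxx.
Qed.

Lemma eq_blk A p q (E F : 'I_A -> 'M[C]_(p, q)) : E =1 F -> blk E = blk F.
Proof. by move=> h; apply: eq_bigr => j _; rewrite h. Qed.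

Lemma mxfun_blk (f : R -> R) A p (E : 'I_A -> 'M[C]_p) : (forall j, adj (E j) = E j) ->
  mxfun f (blk E) = blk (fun j => mxfun f (E j)).
Proof.
move=> hE; have [U hU] := fin_all_exists (fun j => hermitian_spectral (hE j)).
have [d hd] := fin_all_exists hU.
have uU : unitary (blk U) by apply: unitary_blk => j; case: (hd j).
have -> : blk E = adj (blk U) *m dg (fun k => d (mxtens.mxtens_unindex k).1 (mxtens.mxtens_unindex k).2) *m blk U.
  by rewrite -blk_dg adj_blk !blkM; apply: eq_blk => j; case: (hd j).
rewrite (mxfun_diag _ _ uU).
rewrite -(blk_dg (fun j y => f (d j y))) adj_blk !blkM; apply: eq_blk => j.
by have [hUj ->] := hd j; rewrite mxfun_diag.
Qed.

Lemma mxfun_trmx (f : R -> R) n (E : 'M[C]_n) : adj E = E ->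
  mxfun f (E^T) = (mxfun f E)^T.
Proof.
move=> /hermitian_spectral[U [d [hU ->]]]; rewrite (mxfun_diag _ _ hU).
have tdg e : (dg e)^T = dg e :> 'M[C]_n by rewrite /dg tr_diag_mx.
have uV : unitary (adj (U^T)).
  by rewrite /unitary adjK adj_trmx -trmx_mul hU trmx1.
rewrite !trmx_mul !tdg !mulmxA -adj_trmx -{1}[U^T]adjK (mxfun_diag _ _ uV).
by rewrite adjK.
Qed.

Lemma vN_rtr n (E : 'M[C]_n) : vN_entropy E = rtr (mxfun (@eta_fun R) E).
Proof. by []. Qed.

Lemma vN_trmx n (E : 'M[C]_n) : adj E = E -> vN_entropy (E^T) = vN_entropy E.
Proof. by move=> hE; rewrite !vN_rtr mxfun_trmx // rtr_trmx. Qed.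

Lemma vN_blk A p (E : 'I_A -> 'M[C]_p) : (forall j, adj (E j) = E j) ->
  vN_entropy (blk E) = \sum_j vN_entropy (E j).
Proof. by move=> hE; rewrite vN_rtr mxfun_blk // rtr_blk. Qed.

Lemma eta_fun0 : eta_fun (0 : R) = 0.
Proof. by rewrite /eta_fun ltxx. Qed.

Lemma vN_gram m n (Y : 'M[C]_(m, n)) : vN_entropy (Y *m adj Y) = vN_entropy (adj Y *m Y).
Proof. by rewrite !vN_rtr rtr_mxfun_gram // eta_fun0. Qed.

(** On the kernel both sides contribute 0, by the conventions in [log2_supp] and [eta_fun]. *)
Lemma rtr_mul_log n (A : 'M[C]_n) : psd A ->
  rtr (A *m mxfun (@log2_supp R) A) = - vN_entropy A.
Proof.
move=> /psd_spectral[U [d [hU d0 ->]]].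
rewrite vN_rtr !(mxfun_diag _ _ hU) (conj_dgM _ _ hU) !(rtr_conj_dg _ hU) -sumrN.
apply: eq_bigr => i _; rewrite /log2_supp /eta_fun; case: ifP => _.
  by rewrite opprK.
by rewrite mulr0 oppr0.
Qed.

(** In the eigenbasis of [G G^+], a row of [W G] has squared norm equal to its eigenvalue, so [G^+]
    vanishes on the kernel and inverting the other eigenvalues gives the factor. *)
Lemma gram_submx m n (G : 'M[C]_(m, n)) : (adj G <= G *m adj G)%MS.
Proof.
have [W [mu [hW m0 eM]]] := psd_spectral (psd_gram' G).
have z i j : mu j = 0 -> (adj G *m adj W) i j = 0.
  move=> mj; have : hs (row j (W *m G)) = 0.
    rewrite hs_row adjM !mulmxA -(mulmxA W) eM !mulmxA hW mul1mx -mulmxA hW mulmx1.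
    by rewrite dgE eqxx mj.
  move/hs_eq0/rowP/(_ i); rewrite mxE [RHS]mxE => h.
  by rewrite -adjM adjE h rmorph0.
apply/submxP; exists (adj G *m adj W *m dg (fun j => (mu j)^-1) *m W).
rewrite eM -!mulmxA (mulmxA W) hW mul1mx (mulmxA (dg _)) dgM !mulmxA.
have -> : adj G *m adj W *m dg (fun j => (mu j)^-1 * mu j) = adj G *m adj W.
  apply/matrixP=> i j; rewrite mul_dg_r.
  have [mj|mj] := eqVneq (mu j) 0; first by rewrite (z i j mj) mul0r.
  by rewrite mulVf // mulr1.
by rewrite -mulmxA (unitaryV hW) mulmx1.
Qed.

Lemma psd_delta n (j : 'I_n) : psd (delta_mx j j : 'M[C]_n).
Proof.
have e : adj (delta_mx j j : 'M[C]_n) = delta_mx j j.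
  by apply/matrixP=> x y; rewrite adjE !mxE rmorph_nat andbC.
by have := psd_gram (delta_mx j j : 'M[C]_n); rewrite e mul_delta_mx.
Qed.

Lemma separable_blk A B (T : 'I_A -> 'M[C]_B) (D : 'M[C]_B) :
  density D -> (forall j, psd (T j)) -> \sum_j rtr (T j) = 1 -> separable (blk T).
Proof.
move=> dD pT T1.
(* [D] is a placeholder for the state of a block of weight zero, which cannot be normalized. *)
pose sy j := if rtr (T j) == 0 then D else ((rtr (T j))^-1)%:C *: T j.
have rtrT j : \tr (T j) = (rtr (T j))%:C.
  rewrite /rtr; have /psd_sqrt[g ->] := pT j.
  apply/eqP; rewrite eq_complex /= eqxx /=; apply/eqP.
  have -> : \tr (adj g *m g) = (hs g)%:C.
    rewrite hsE rmorph_sum; apply: eq_bigr => i _; rewrite mxE rmorph_sum.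
    by apply: eq_bigr => k _; rewrite adjE nsqE.
  by [].
have T0 j : rtr (T j) = 0 -> T j = 0.
  by have /psd_sqrt[g ->] := pT j; move=> /hs_eq0 ->; rewrite mulmx0.
exists A, (fun j => rtr (T j)), (fun j => delta_mx j j), sy; split; last split => //; last split; last split.
- by move=> j; apply: psd_rtr.
- move=> j; split.
    exact: psd_delta.
  rewrite /mxtrace (bigD1 j) //= big1 => [|k kj]; first by rewrite mxE eqxx addr0.
  by rewrite mxE (negbTE kj).
- move=> j; rewrite /sy; case: eqP => // /eqP tj; split.
    by apply: psdZ; rewrite ?invr_ge0 ?psd_rtr.
  by rewrite mxtraceZ rtrT -rmorphM /= mulVf.
- apply: eq_bigr => j _; rewrite /sy; case: eqP => [t0|/eqP tj].
    by rewrite t0 (T0 j t0) kron0r scale0r.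
  apply/matrixP=> x y; rewrite !mxE mulrCA; congr (_ * _).
  by rewrite mulrA -rmorphM /= divff // mul1r.
Qed.

Lemma density_gram m n (Y : 'M[C]_(m, n)) : rtr (adj Y *m Y) = 1 -> density (Y *m adj Y).
Proof.
move=> h; split; first exact: psd_gram'.
rewrite mxtrace_mulC.
have -> : \tr (adj Y *m Y) = (hs Y)%:C.
  rewrite hsE rmorph_sum; apply: eq_bigr => i _; rewrite mxE rmorph_sum.
  by apply: eq_bigr => k _; rewrite adjE nsqE.
by rewrite /hs /ip h.
Qed.

Lemma info_gram A B c (P : 'I_A -> 'M[C]_B) (X : 'M[C]_(B, c)) j : type_of_info P ->
  adj (P j *m X) *m (P j *m X) = adj X *m P j *m X.
Proof.
by move=> [Ph [Po _]]; rewrite adjM Ph mulmxA -(mulmxA (adj X)) Po eqxx.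
Qed.

Lemma info_gram_sum A B c (P : 'I_A -> 'M[C]_B) (X : 'M[C]_(B, c)) : type_of_info P ->
  \sum_j adj (P j *m X) *m (P j *m X) = adj X *m X.
Proof.
move=> hP; under eq_bigr => j _ do rewrite (info_gram X j hP).
by case: hP => _ [_ P1]; rewrite -mulmx_suml -mulmx_sumr P1 mulmx1.
Qed.

(** The logarithm of the block-diagonal state is block diagonal, so the cross term sees only the
    diagonal blocks [Y_j Y_j^+] and is the sum of their entropies. Supports are included because
    [Psi] is the block-diagonal matrix of the [Y j] times a column of identities. *)
Lemma rel_entropy_dephased A B c (P : 'I_A -> 'M[C]_B) (X : 'M[C]_(B, c)) : type_of_info P ->
  rel_entropy (cq P X) (blk (fun j => (P j *m X) *m adj (P j *m X))) =
  (\sum_j vN_entropy (adj X *m P j *m X) - vN_entropy (adj X *m X))%:E.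
Proof.
move=> hP; pose Y j := P j *m X.
have eb : blk (fun j => Y j *m adj (Y j)) = blk Y *m adj (blk Y) by rewrite adj_blk blkM.
have es : stack P X = blk Y *m gst (fun=> 1%:M).
  by rewrite blk_gst; apply: matrix_ixl_P => j y m; rewrite stackE gstE mulmx1.
rewrite /rel_entropy ifT; last first.
  rewrite -/(Y _) eb /cq es adjM mulmxA; apply: submx_trans (gram_submx _).
  exact: submxMl.
congr (_%:E); rewrite -[complex.Re _]/(rtr _) addrC; congr (_ - _); last first.
  rewrite /cq vN_gram.
  have -> : stack P X = gst Y by [].
  by rewrite adj_gst_mul info_gram_sum.
rewrite mxfun_blk; last by move=> j; rewrite adjM adjK.
rewrite /cq -mulmxA rtrC -mulmxA.
have -> : stack P X = gst Y by [].
rewrite -[adj (gst Y)]mulmx1 -mulmxA mul1mx blk_gst adj_gst_mul rtr_sum -sumrN.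
apply: eq_bigr => j _.
by rewrite mulmxA rtrC mulmxA (rtr_mul_log (psd_gram' _)) opprK vN_gram info_gram.
Qed.

Lemma cq_data1 A B c (P : 'I_A -> 'M[C]_B) (X : 'M[C]_(B, c)) : type_of_info P ->
  rtr (adj X *m X) = 1 ->
  exists vs vh, cq_data 1 (cq P X) (vN_entropy (adj X *m X) * ln 2) vs
    ((\sum_j vN_entropy (adj X *m P j *m X)) * ln 2) vh.
Proof.
move=> hP X1.
have [U [mu [hU mu0 eS]]] := psd_spectral (psd_gram X).
have pj j : psd (adj X *m P j *m X) by rewrite -info_gram //; apply: psd_gram.
have [V hV] := fin_all_exists (fun j => psd_spectral (pj j)).
have [lam hl] := fin_all_exists hV.
have ln20 := lt0r_neq0 (@ln2_gt0 R).
have eta_ln (x : R) : 0 <= x -> x * - ln x = eta_fun x * ln 2.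
  move=> x0; rewrite /eta_fun /log2; case: ltP => [_|xn].
    by rewrite mulrN mulNr -mulrA divfK.
  by have -> : x = 0 by [apply/eqP; rewrite eq_le x0 xn]; rewrite !mul0r.
have mu1 : \sum_i mu i = 1 by rewrite -X1 eS rtr_conj_dg.
have [vs m1] := moments1 (fun i => - ln (mu i)) mu0 mu1.
have lam0 (p : 'I_A * 'I_c) : 0 <= lam p.1 p.2 by case: (hl p.1).
have lam1 : \sum_(p : 'I_A * 'I_c) lam p.1 p.2 = 1.
  rewrite -(pair_bigA _ (fun i j => lam i j)) /= -X1 -(info_gram_sum X hP) rtr_sum.
  by apply: eq_bigr => j _; rewrite info_gram //; have [hUj _ ->] := hl j; rewrite rtr_conj_dg.
have [vh m2] := moments1 (fun p : 'I_A * 'I_c => - ln (lam p.1 p.2)) lam0 lam1.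
exists vs, vh, c, P, X, U, mu, V, lam; split => //.
- by split=> // j; case: (hl j).
- by split=> // j; case: (hl j).
- suff -> : vN_entropy (adj X *m X) * ln 2 = \sum_i mu i * - ln (mu i) by [].
  rewrite vN_rtr eS (mxfun_diag _ _ hU) (rtr_conj_dg _ hU) mulr_suml.
  by apply: eq_bigr => i _; rewrite eta_ln.
- suff -> : (\sum_j vN_entropy (adj X *m P j *m X)) * ln 2 =
    \sum_(p : 'I_A * 'I_c) lam p.1 p.2 * - ln (lam p.1 p.2) by [].
  rewrite -(pair_bigA _ (fun i j => lam i j * - ln (lam i j))) /= mulr_suml.
  apply: eq_bigr => j _; have [hUj l0 ->] := hl j.
  rewrite vN_rtr (mxfun_diag _ _ hUj) (rtr_conj_dg _ hUj) mulr_suml.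
  by apply: eq_bigr => i _; rewrite eta_ln.
Qed.

End Blocks.

(** * Fidelity and guessing probability *)

Section Guess.
Variable R : realType.
Local Notation C := (R[i]).
Local Notation "x %:C" := (real_complex R x) (format "x %:C").
Opaque adj.

(** With [S] the root of [F F^+], the fidelity is the squared trace norm of [S G], and
    [(S G)^+ (S G)] equals [(G^+ F) (G^+ F)^+]. *)
Lemma fidelity_gram m n p (F : 'M[C]_(m, n)) (G : 'M[C]_(m, p)) :
  fidelity (F *m adj F) (G *m adj G) = tnorm (adj G *m F) ^+ 2.
Proof.
rewrite /fidelity; congr (_ ^+ 2).
have [S [pS SS ->]] : exists S, [/\ psd S, S *m S = F *m adj F & sqrtm (F *m adj F) = S].
  exists (sqrtm (F *m adj F)); split=> //; first exact: sqrtm_psd (psd_gram' F).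
  exact: sqrtm_sqr (psd_gram' F).
have -> : S *m (G *m adj G) *m S = (S *m G) *m adj (S *m G).
  by rewrite adjM (psd_adj pS) !mulmxA.
rewrite -[LHS]/(tnorm (S *m G)) -tnorm_adj /tnorm adjK !adjM adjK (psd_adj pS).
by rewrite -!mulmxA (mulmxA S S) SS !mulmxA.
Qed.

Lemma hsZc m n (a : C) (M : 'M[C]_(m, n)) : hs (a *: M) = nsq a * hs M.
Proof.
rewrite !hsE mulr_sumr; apply: eq_bigr => j _; rewrite mulr_sumr.
by apply: eq_bigr => i _; rewrite mxE nsqM.
Qed.

Lemma rtr_gram_swap m n (Y : 'M[C]_(m, n)) (G : 'M[C]_n) :
  rtr (Y *m adj G *m adj (Y *m adj G)) = rtr (adj G *m G *m (adj Y *m Y)).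
Proof. by rewrite adjM adjK -mulmxA [LHS]rtrC !mulmxA. Qed.

Lemma mul_gram_swap m n (Y : 'M[C]_(m, n)) (G : 'M[C]_n) :
  adj G *m (adj (Y *m adj G) *m Y) = adj G *m G *m (adj Y *m Y).
Proof. by rewrite adjM adjK !mulmxA. Qed.

(** Each local state [M^+ M] is the sum of the projectors on the adjoint rows of [M], up to norm;
    the root of the convex weight goes into [a]. *)
Lemma separable_vectors A B (sigma : 'M[C]_(A * B)) : separable sigma ->
  exists (m : nat) (a : 'I_m -> 'cV[C]_A) (b : 'I_m -> 'cV[C]_B),
    sigma = \sum_i kron (a i *m adj (a i)) (b i *m adj (b i)) /\
    \sum_i hs (a i) * hs (b i) = 1.
Proof.
move=> [K [q [sx [sy [q0 [q1 [hx [hy ->]]]]]]]].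
have [G hG] := fin_all_exists (fun k => psd_sqrt (hx k).1).
have [H hH] := fin_all_exists (fun k => psd_sqrt (hy k).1).
have dec n (M : 'M[C]_n) : adj M *m M = \sum_i adj (row i M) *m adj (adj (row i M)).
  apply/matrixP=> x y; rewrite mxE summxE; apply: eq_bigr => i _.
  by rewrite adjK [RHS]mxE big_ord1 !adjE !mxE.
pose I : finType := ('I_K * ('I_A * 'I_B))%type.
pose a (p : I) := (Num.sqrt (q p.1))%:C *: adj (row p.2.1 (G p.1)).
pose b (p : I) := adj (row p.2.2 (H p.1)).
exists #|I|, (fun i => a (enum_val i)), (fun i => b (enum_val i)).
rewrite -(sum_enum_val (fun p => kron (a p *m adj (a p)) (b p *m adj (b p)))).
rewrite -(sum_enum_val (fun p => hs (a p) * hs (b p))).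
split.
  rewrite -(pair_bigA _ (fun k ij => kron (a (k, ij) *m adj (a (k, ij))) (b (k, ij) *m adj (b (k, ij))))) /=.
  apply: eq_bigr => k _.
  rewrite -(pair_bigA _ (fun i j => kron (a (k, (i, j)) *m adj (a (k, (i, j)))) (b (k, (i, j)) *m adj (b (k, (i, j)))))) /=.
  rewrite hG hH !dec kron_suml scaler_sumr; apply: eq_bigr => i _.
  rewrite kron_sumr scaler_sumr; apply: eq_bigr => j _.
  rewrite /a /b adjZr -scalemxAl -scalemxAr scalerA -rmorphM -expr2 sqr_sqrtr //.
  by apply/matrixP=> x y; rewrite !mxE mulrA.
have t1 d (s : 'M[C]_d) : density s -> rtr s = 1 by rewrite /rtr => -[_ ->].
rewrite -(pair_bigA _ (fun k ij => hs (a (k, ij)) * hs (b (k, ij)))) /= -q1.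
apply: eq_bigr => k _.
rewrite -(pair_bigA _ (fun i j => hs (a (k, (i, j))) * hs (b (k, (i, j))))) /=.
have hsrow n (M : 'M[C]_n) : \sum_i hs (adj (row i M)) = rtr (adj M *m M).
  by under eq_bigr => i _ do rewrite hs_adj; rewrite -[RHS]/(ip M M) ip_rows.
transitivity (\sum_i q k * hs (adj (row i (G k))) * \sum_j hs (adj (row j (H k)))).
  apply: eq_bigr => i _; rewrite mulr_sumr; apply: eq_bigr => j _.
  by rewrite /a /b hsZ sqr_sqrtr.
rewrite -mulr_suml -mulr_sumr !hsrow -hG -hH (t1 _ _ (hx k)) (t1 _ _ (hy k)).
by rewrite !mulr1.
Qed.

Section Fixed.
Variables (A B c : nat) (P : 'I_A -> 'M[C]_B) (X : 'M[C]_(B, c)).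
Hypothesis hP : type_of_info P.
Hypothesis X1 : rtr (adj X *m X) = 1.

(** For the amplitude of a pure state, [X^+ P_j X] is the transpose of the conditional state on [C];
    [p_guessE] moves the transposition to the POVM. *)
Definition guess_value (Q : 'I_A -> 'M[C]_c) : R :=
  \sum_j rtr (Q j *m (adj X *m P j *m X)).

Lemma psd_info_gram j : psd (adj X *m P j *m X).
Proof. by rewrite -info_gram //; apply: psd_gram. Qed.

(** An empty family of projectors would sum to 0 rather than 1, making [X] zero. *)
Lemma info_pos : (0 < A)%N.
Proof.
case: A P hP => // P' [_ [_]]; rewrite big_ord0 => h.
by move: X1; rewrite -[X]mul1mx -h mul0mx mulmx0 rtr0 => /eqP; rewrite eq_sym oner_eq0.
Qed.

Lemma guess_value_bounds Q : POVM Q -> 0 <= guess_value Q <= 1.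
Proof.
move=> [pQ Q1]; apply/andP; split.
  by apply: sumr_ge0 => j _; exact: psd_rtrM (pQ j) (psd_info_gram j).
rewrite -X1 -(info_gram_sum X hP) rtr_sum; apply: ler_sum => j _.
rewrite info_gram // -subr_ge0 -[X in rtr X - _]mul1mx -rtrB -mulmxBl.
apply: psd_rtrM (psd_info_gram j).
by rewrite -Q1 (bigD1 j) //= addrAC subrr add0r; apply: psd_sum.
Qed.

(** The missing part of the identity is given to one outcome, which cannot lower the value. *)
Lemma subPOVM_guess (Q : 'I_A -> 'M[C]_c) : (forall j, psd (Q j)) ->
  psd (1%:M - \sum_j Q j) ->
  exists Q', POVM Q' /\ guess_value Q <= guess_value Q'.
Proof.
move=> pQ pR; pose j0 := Ordinal info_pos.
exists (fun j => Q j + (if j == j0 then 1%:M - \sum_j Q j else 0)); split.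
  split; first by move=> j; case: eqP => _; [exact: psdD (pQ j) pR | rewrite addr0; exact: pQ].
  by rewrite big_split /= -big_mkcond big_pred1_eq addrC subrK.
apply: ler_sum => j _; rewrite mulmxDl rtrD lerDl.
case: eqP => _; last by rewrite mul0mx rtr0.
exact: psd_rtrM pR (psd_info_gram j).
Qed.

Lemma fidelity_le_guess sigma : separable sigma ->
  exists Q, POVM Q /\ fidelity (cq P X) sigma <= guess_value Q.
Proof.
move=> /separable_vectors[m [a [b [es s1]]]].
have [Ph [Po P1]] := hP.
pose W : 'M[C]_(A * B, m) := \matrix_(k, i)
  (a i (mxtens.mxtens_unindex k).1 0 * b i (mxtens.mxtens_unindex k).2 0).
have WE j y i : W (ix j y) i = a i j 0 * b i y 0 by rewrite [LHS]mxE ixK.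
have -> : sigma = W *m adj W.
  rewrite es; apply: matrix_ixP => j y k z; rewrite summxE mxE.
  apply: eq_bigr => i _; rewrite kronE adjE !WE !mxE !big_ord1 !adjE rmorphM.
  by rewrite mulrACA.
rewrite fidelity_gram.
have [V [hV <-]] := tnorm_attained (adj W *m stack P X).
pose v i := col i V.
pose hh i j := hs (P j *m X *m v i).
(* By Cauchy-Schwarz the [x i j] sum over [j] to at most [n i], so the ratios [x i j / n i] are
   subnormalized weights; they are 0 when [n i = 0]. *)
pose x i j := Num.sqrt (nsq (a i j 0)) * Num.sqrt (hs (P j *m b i)).
pose n i := Num.sqrt (hs (a i)) * Num.sqrt (hs (b i)).
have n0 i : 0 <= n i by rewrite mulr_ge0 ?sqrtr_ge0.
have x0 i j : 0 <= x i j by rewrite mulr_ge0 ?sqrtr_ge0.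
have xn i : \sum_j x i j <= n i.
  have := sum_cauchy (fun j => Num.sqrt (nsq (a i j 0))) (fun j => Num.sqrt (hs (P j *m b i))).
  under [X in _ <= X * _]eq_bigr => j _ do rewrite sqr_sqrtr ?nsq_ge0 //.
  under [X in _ <= _ * X]eq_bigr => j _ do rewrite sqr_sqrtr ?hs_ge0 //.
  have -> : \sum_j hs (P j *m b i) = hs (b i) by rewrite -rtr_sum info_gram_sum.
  have -> : \sum_j nsq (a i j 0) = hs (a i) by rewrite hsE big_ord1.
  move=> h; rewrite -[leLHS]ger0_norm ?sumr_ge0 // -sqrtr_sqr /n -sqrtrM ?hs_ge0 //.
  exact: ler_wsqrtr.
pose Q j := \sum_i (x i j / n i)%:C *: (v i *m adj (v i)).
have pQ j : psd (Q j).
  by apply: psd_sum => i _; apply: psdZ; [apply: divr_ge0 | apply: psd_gram'].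
have sQ : psd (1%:M - \sum_j Q j).
  have eV : V *m adj V = \sum_i v i *m adj (v i).
    apply/matrixP=> y z; rewrite mxE summxE; apply: eq_bigr => i _.
    by rewrite [RHS]mxE big_ord1 !adjE !mxE.
  have -> : 1%:M - \sum_j Q j = (1%:M - V *m adj V) + \sum_i (1 - \sum_j x i j / n i)%:C *: (v i *m adj (v i)).
    rewrite /Q exchange_big eV -addrA; congr (_ + _); rewrite addrC -sumrB -sumrN.
    apply: eq_bigr => i _; rewrite rmorphB rmorph1 scalerBl scale1r rmorph_sum -scaler_suml.
    by rewrite addrAC subrr add0r.
  apply: psdD; first exact: contraction_adj.
  apply: psd_sum => i _; apply: psdZ; last exact: psd_gram'.
  rewrite subr_ge0 -mulr_suml.
  have [ni|ni] := eqVneq (n i) 0; first by rewrite ni invr0 mulr0 ler01.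
  by rewrite ler_pdivrMr ?mul1r // lt_def ni n0.
have [Q' [pQ' hQ']] := subPOVM_guess pQ sQ.
exists Q'; split=> //; apply: le_trans hQ'.
have gQ : guess_value Q = \sum_i \sum_j x i j / n i * hh i j.
  rewrite exchange_big; apply: eq_bigr => j _.
  rewrite /Q mulmx_suml rtr_sum; apply: eq_bigr => i _.
  rewrite -scalemxAl rtrZ; congr (_ * _).
  rewrite -(info_gram X j hP) /hh; move: (P j *m X) => Y.
  by rewrite /hs /ip adjM -mulmxA rtrC !mulmxA.
have eT : rtr (V *m (adj W *m stack P X)) = \sum_i \sum_j ip (a i j 0 *: (P j *m b i)) (P j *m X *m v i).
  rewrite rtrC -mulmxA /rtr /mxtrace Re_sum; apply: eq_bigr => i _.
  rewrite mxE sum_ix Re_sum; apply: eq_bigr => j _.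
  rewrite /ip /rtr /mxtrace big_ord1; congr complex.Re.
  rewrite adjZ -scalemxAl [RHS]mxE adjM Ph -!mulmxA (mulmxA (P j)) Po eqxx.
  rewrite mxE mulr_sumr; apply: eq_bigr => y _.
  rewrite !adjE WE rmorphM -mulrA; congr (_ * (_ * _)).
  rewrite mulmxA mxE [RHS]mxE; apply: eq_bigr => z _.
  by rewrite stackE [v i _ _]mxE.
have x_le_n i j : x i j <= n i.
  by apply: le_trans (xn i); rewrite (bigD1 j) //= lerDl sumr_ge0.
have bT : `|rtr (V *m (adj W *m stack P X))| <= \sum_i \sum_j x i j * Num.sqrt (hh i j).
  rewrite eT; apply: le_trans (ler_norm_sum _ _ _) _; apply: ler_sum => i _.
  apply: le_trans (ler_norm_sum _ _ _) _; apply: ler_sum => j _.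
  apply: le_trans (ip_le_sqrt _ _) _.
  by rewrite hsZc sqrtrM ?nsq_ge0.
rewrite -real_normK ?num_real //.
have hh0 i j : 0 <= hh i j := hs_ge0 _.
have xd0 i j : 0 <= x i j / n i by rewrite divr_ge0.
(* Splits [x sqrt h] as [sqrt (x n) sqrt (x h / n)]. After Cauchy-Schwarz the first factor gives at
   most the sum of the [n_i^2], which is 1, and the second gives [guess_value Q]. *)
apply: (@le_trans _ _ ((\sum_(p : 'I_m * 'I_A) Num.sqrt (x p.1 p.2 * n p.1) * Num.sqrt (x p.1 p.2 / n p.1 * hh p.1 p.2)) ^+ 2)).
  rewrite ler_sqr ?nnegrE ?normr_ge0 //; last by apply: sumr_ge0 => p _; rewrite mulr_ge0 ?sqrtr_ge0.
  apply: le_trans bT _; rewrite pair_bigA /=; apply: ler_sum => -[i j] _ /=.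
  rewrite -sqrtrM ?mulr_ge0 //.
  have [ni|ni] := eqVneq (n i) 0.
    have -> : x i j = 0 by apply/eqP; rewrite eq_le x0 andbT -ni.
    by rewrite mul0r sqrtr_ge0.
  have -> : x i j * n i * (x i j / n i * hh i j) = x i j ^+ 2 * hh i j by field.
  by rewrite sqrtrM ?sqr_ge0 // sqrtr_sqr ger0_norm.
apply: le_trans (sum_cauchy _ _) _.
have -> : \sum_(p : 'I_m * 'I_A) Num.sqrt (x p.1 p.2 / n p.1 * hh p.1 p.2) ^+ 2 = guess_value Q.
  rewrite gQ pair_bigA /=; apply: eq_bigr => p _.
  by rewrite sqr_sqrtr // mulr_ge0.
rewrite -[leRHS]mul1r; apply: ler_wpM2r.
  by rewrite gQ; apply: sumr_ge0 => i _; apply: sumr_ge0 => j _; rewrite mulr_ge0.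
rewrite -s1 -(pair_bigA _ (fun i j => Num.sqrt (x i j * n i) ^+ 2)) /=.
apply: ler_sum => i _.
under eq_bigr => j _ do rewrite sqr_sqrtr ?mulr_ge0 //.
rewrite -mulr_suml; apply: (@le_trans _ _ (n i * n i)); first exact: ler_wpM2r.
by rewrite -expr2 /n exprMn !sqr_sqrtr ?hs_ge0.
Qed.

Lemma guess_le_fidelity Q : POVM Q ->
  exists sigma, separable sigma /\ guess_value Q <= fidelity (cq P X) sigma.
Proof.
move=> pQ'; have [pQ Q1] := pQ'.
pose Y j := P j *m X; have eS : stack P X = gst Y by [].
have eSj j : adj (Y j) *m Y j = adj X *m P j *m X := info_gram X j hP.
have dens : density (X *m adj X) by exact: density_gram.
have [g0 _] := andP (guess_value_bounds pQ').
(* A zero value cannot be used to normalize; then any separable state will do. *)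
have [gz|gn] := eqVneq (guess_value Q) 0.
  exists (blk (fun j => Y j *m adj (Y j))); split; last by rewrite gz sqr_ge0.
  apply: separable_blk dens _ _ => [j|]; first exact: psd_gram'.
  by rewrite -X1 -(info_gram_sum X hP) rtr_sum; apply: eq_bigr => j _; rewrite rtrC.
have gp : 0 < guess_value Q by rewrite lt_def gn.
have [G hG] := fin_all_exists (fun j => psd_sqrt (pQ j)).
pose r : R := (Num.sqrt (guess_value Q))^-1.
have r2 : r * r * guess_value Q = 1.
  by rewrite -expr2 /r exprVn sqr_sqrtr // mulVf.
pose E j := r%:C *: (Y j *m adj (G j)).
have eE j : rtr (E j *m adj (E j)) = r * r * rtr (Q j *m (adj X *m P j *m X)).
  rewrite /E adjZr -scalemxAl -scalemxAr !rtrZ mulrA; congr (_ * _).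
  by rewrite hG -eSj rtr_gram_swap.
exists (blk (fun j => E j *m adj (E j))); split.
  apply: separable_blk dens _ _ => [j|]; first exact: psd_gram'.
  by under eq_bigr => j _ do rewrite eE; rewrite -mulr_sumr r2.
have -> : blk (fun j => E j *m adj (E j)) = blk E *m adj (blk E) by rewrite adj_blk blkM.
rewrite fidelity_gram eS adj_blk blk_gst.
(* A contraction because the [G_j^+ G_j = Q j] sum to 1; tested against it, the overlap is the
   square root of the guessing value. *)
pose V := adj (gst G).
have hV : psd (1%:M - adj V *m V).
  rewrite /V adjK; apply: contraction_adj; rewrite adj_gst_mul.
  under eq_bigr => j _ do rewrite -hG.
  by rewrite Q1 subrr; apply: psd0.
have := tnorm_ge (gst (fun j => adj (E j) *m Y j)) hV.
rewrite /V adj_gst_mul rtr_sum.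
have -> : \sum_j rtr (adj (G j) *m (adj (E j) *m Y j)) = Num.sqrt (guess_value Q).
  transitivity (r * guess_value Q).
    rewrite /guess_value mulr_sumr; apply: eq_bigr => j _.
    rewrite /E adjZr -scalemxAl -scalemxAr rtrZ; congr (_ * _).
    by rewrite mul_gram_swap -hG eSj.
  by rewrite /r -{2}(sqr_sqrtr g0) expr2 mulrA mulVf ?mul1r // sqrtr_eq0 -ltNge.
move=> h; rewrite -{1}(sqr_sqrtr g0) ler_sqr ?nnegrE ?sqrtr_ge0 ?tnorm_ge0 //.
Qed.

End Fixed.
End Guess.

(** * The theorem *)

Section Structure.
Variable R : realType.
Local Notation C := (R[i]).
Local Notation "x %:C" := (real_complex R x) (format "x %:C").
Opaque adj.

Variables (dA dB dC N : nat) (psi : 'cV[C]_(dA * dB * dC)) (Z : 'I_N -> 'M[C]_dA).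
Hypothesis psi1 : adj psi *m psi = 1.
Hypothesis hZ : type_of_info Z.

Let rho : 'M[C]_(dA * dB * dC) := psi *m adj psi.

(* [psi] as an operator from [C] to [A (x) B]. *)
Definition amplitude : 'M[C]_(dA * dB, dC) := \matrix_(y, k) psi (ix y k) 0.

Definition infoAB (j : 'I_N) : 'M[C]_(dA * dB) := kron (Z j) 1%:M.

Let X := amplitude.
Let P := infoAB.

Let XE y k : X y k = psi (ix y k) 0.
Proof. by rewrite mxE. Qed.

Let rhoE x y : rho x y = psi x 0 * (psi y 0)^*.
Proof. by rewrite /rho mxE big_ord1 adjE. Qed.

Lemma type_of_info_infoAB : type_of_info infoAB.
Proof.
have [Zh [Zo Z1]] := hZ; rewrite /infoAB; split; [|split].
- by move=> j; rewrite adj_kron Zh adj_1.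
- move=> j k; rewrite kronM Zo mulmx1; case: eqP => _ //; exact: kron0l.
- by rewrite -kron_suml Z1 kron11.
Qed.

Lemma ptr2_pure : ptr2 rho = amplitude *m adj amplitude.
Proof.
apply/matrixP=> i k; rewrite [LHS]mxE [RHS]mxE; apply: eq_bigr => j _.
by rewrite rhoE adjE !XE.
Qed.

Lemma ptr1_pure : ptr1 rho = (adj amplitude *m amplitude)^T.
Proof.
apply/matrixP=> i k; rewrite [LHS]mxE [RHS]mxE [RHS]mxE; apply: eq_bigr => j _.
by rewrite rhoE adjE !XE mulrC.
Qed.

Lemma amplitude_norm : rtr (adj amplitude *m amplitude) = 1.
Proof.
have := congr1 (fun M : 'M[C]_1 => complex.Re (M 0 0)) psi1.
rewrite mxE [X in _ = complex.Re X]mxE eqxx Re_sum /= => <-.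
rewrite sum_ix /= -/(ip _ _) -/(hs _) hsE exchange_big; apply: eq_bigr => y _.
by apply: eq_bigr => k _; rewrite XE adjE nsqE.
Qed.

Lemma cond_stateE j : cond_state Z rho j = (adj amplitude *m infoAB j *m amplitude)^T.
Proof.
apply/matrixP=> k l; rewrite [LHS]mxE [RHS]mxE -mulmxA [RHS]mxE sum_ix.
apply: eq_bigr => x _.
have eR b : (infoAB j *m amplitude) (ix x b) k = \sum_y Z j x y * psi (ix (ix y b) k) 0.
  rewrite mxE sum_ix; apply: eq_bigr => y _; rewrite (bigD1 b) //= big1 ?addr0 => [|b' bb].
    by rewrite kronE XE mxE eqxx mulr1.
  by rewrite kronE mxE eq_sym (negbTE bb) mulr0 mul0r.
have eM y : ptr_mid rho (ix y k) (ix x l) = \sum_b rho (ix (ix y b) k) (ix (ix x b) l).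
  by rewrite mxE; apply: eq_bigr => b _; rewrite !ixK.
transitivity (\sum_y Z j x y * ptr_mid rho (ix y k) (ix x l)).
  rewrite mxE sum_ix; apply: eq_bigr => y _; rewrite (bigD1 k) //= big1 ?addr0 => [|k' kk].
    by rewrite kronE mxE eqxx mulr1.
  by rewrite kronE mxE eq_sym (negbTE kk) mulr0 mul0r.
transitivity (\sum_y \sum_b (psi (ix (ix x b) l) 0)^* * (Z j x y * psi (ix (ix y b) k) 0)).
  apply: eq_bigr => y _; rewrite eM mulr_sumr; apply: eq_bigr => b _.
  by rewrite rhoE mulrA mulrC.
rewrite exchange_big; apply: eq_bigr => b _.
by rewrite eR adjE XE mulr_sumr.
Qed.

Lemma VZ_amplitude : VZ Z *m amplitude = stack infoAB amplitude.
Proof.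
apply: matrix_ixl_P => j y k; rewrite stackE [LHS]mxE [RHS]mxE.
apply: eq_bigr => z _; congr (_ * _).
rewrite /VZ castmxE /= cast_ord_id.
(* The column index decodes as a pair whose first entry lies in ['I_1], matching the single column
   of [delta_mx j 0]. *)
have -> : cast_ord (esym (mul1n (dA * dB))) z = ix (ord0 : 'I_1) z.
  by apply: val_inj; rewrite /= mul0n.
rewrite summxE (bigD1 j) //= kronE mxE !eqxx mul1r big1 ?addr0 // => i ij.
by rewrite kronE mxE eq_sym (negbTE ij) mul0r.
Qed.

Lemma rho_tildeE : rho_tilde Z rho = cq infoAB amplitude.
Proof.
rewrite /rho_tilde ptr2_pure /cq -VZ_amplitude adjM !mulmxA.
by [].
Qed.

Lemma cond_entropyE : cond_entropy Z rho =
  \sum_j vN_entropy (adj amplitude *m infoAB j *m amplitude)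
    - vN_entropy (adj amplitude *m amplitude).
Proof.
have ph j : adj (adj X *m P j *m X) = adj X *m P j *m X.
  exact: psd_adj (psd_info_gram X type_of_info_infoAB j).
rewrite /cond_entropy; congr (_ - _).
  have -> : rho_MC Z rho = blk (fun j => (adj X *m P j *m X)^T).
    by apply: eq_bigr => j _; rewrite cond_stateE.
  rewrite vN_blk => [|j]; last by rewrite adj_trmx ph.
  by apply: eq_bigr => j _; rewrite vN_trmx.
by rewrite ptr1_pure vN_trmx // adjM adjK.
Qed.

(** Transposition permutes the POVMs and preserves traces, so both suprema run over the same set of
    values. *)
Lemma p_guessE : p_guess Z rho = sup (guess_value infoAB amplitude @` @POVM R dC N)%classic.
Proof.
have povmT Q : POVM Q -> POVM (fun j => (Q j)^T : 'M[C]_dC).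
  move=> [pQ Q1]; split; first by move=> j; apply: psd_trmx.
  have := congr1 trmx Q1; rewrite trmx1 => <-.
  by rewrite (big_morph _ (@raddfD _ _ _) (raddf0 _)).
have val Q : \sum_j complex.Re (\tr (Q j *m cond_state Z rho j)) =
    guess_value infoAB amplitude (fun j => (Q j)^T).
  apply: eq_bigr => j _; rewrite cond_stateE -[LHS]/(rtr _) -rtr_trmx trmx_mul trmxK.
  by rewrite rtrC.
congr sup; apply/seteqP; split => x [Q pQ <-].
  by exists (fun j => (Q j)^T); [apply: povmT | rewrite val].
exists (fun j => (Q j)^T); first exact: povmT.
by rewrite val /=; congr (guess_value _ _ _); apply: funext => j; rewrite trmxK.
Qed.

End Structure.

Theorem theorem2 (R : realType) (dA dB dC N : nat)
    (rho : 'M[R[i]]_(dA * dB * dC)) (Z : 'I_N -> 'M[R[i]]_dA) :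
  pure_state rho -> type_of_info Z ->
  (E_D (rho_tilde Z rho) = E_R (rho_tilde Z rho) /\
   E_R (rho_tilde Z rho) = (cond_entropy Z rho)%:E) /\
  E_G (rho_tilde Z rho) = 1 - p_guess Z rho.
Proof.
move=> [psi [psi1 ->]] hZ.
rewrite rho_tildeE (cond_entropyE psi hZ) p_guessE.
have hP := type_of_info_infoAB dB hZ.
have X1 := amplitude_norm psi1.
move: (infoAB dB Z) (amplitude psi) hP X1 => P X hP X1.
set h := \sum_j _; set s := vN_entropy _.
pose tau := cq P X.
have dtau : density tau.
  apply: density_gram; rewrite -X1.
  have -> : stack P X = gst (fun j => P j *m X) by [].
  by rewrite adj_gst_mul info_gram_sum.
pose sigma := blk (fun j => (P j *m X) *m adj (P j *m X)).
have ssig : separable sigma.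
  apply: separable_blk (density_gram X1) _ _ => [j|]; first exact: psd_gram'.
  by rewrite -X1 -(info_gram_sum X hP) rtr_sum; apply: eq_bigr => j _; rewrite rtrC.
have Dsig : rel_entropy tau sigma = (h - s)%:E by exact: rel_entropy_dephased.
have psig : psd sigma.
  by apply: psd_sum => j _; apply: psd_kron; [exact: psd_delta | exact: psd_gram'].
have [vs [vh hd]] := cq_data1 hP X1.
(* The powers of [tau] are seen to be states through their spectral data in [ns_pair]. *)
have dens n : psd (bpow tau n) /\ rtr (bpow tau n) = 1.
  have [V ns] := rel_entropy_ns_pair dtau psig Dsig.
  exact: ns_pair_density (ns_pair_bpow n ns).
have le_ED_ER : (E_D tau <= E_R tau)%E.
  apply/ereal_infP => _ [sigma' ss <-]; apply/ereal_supP => _ [r [r0 ar] <-].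
  case eD : (rel_entropy tau sigma') => [D| |]; last by move: eD; rewrite /rel_entropy; case: ifP.
    by rewrite lee_fin; exact: distillable_le_rel_entropy dtau ss eD ar.
  exact: leey.
have le_ER_H : (E_R tau <= (h - s)%:E)%E.
  by apply: ge_ereal_inf; exists (rel_entropy tau sigma); [exists sigma | rewrite Dsig].
have le_H_ED : ((h - s)%:E <= E_D tau)%E.
  have a0 := achievable0 dens hd.
  have ED0 : (0%:E <= E_D tau)%E.
    by apply: le_ereal_sup_tmp; exists 0%:E => //; exists 0.
  have l2 := @ln2_gt0 R.
  have ar r : 0 <= r -> r < h - s -> (r%:E <= E_D tau)%E.
    move=> r0 rh; apply: le_ereal_sup_tmp; exists r%:E => //; exists r => //; split=> //.
    apply: achievable_lt dens hd r0 _.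
    by rewrite -mulrBl ltr_pM2r.
  case E : (E_D tau) => [x| |]; [|exact: leey|by rewrite E in ED0].
  rewrite lee_fin leNgt; apply/negP => xh.
  rewrite E lee_fin in ED0.
  (* If [E_D] were below [h - s], the midpoint would be an achievable rate above [E_D]. *)
  have := ar ((x + (h - s)) / 2); rewrite E lee_fin; move: (h - s) xh ED0; clear => y; lra.
split.
  have e1 : E_R tau = (h - s)%:E.
    by apply/eqP; rewrite eq_le le_ER_H (le_trans le_H_ED).
  split=> //; apply/eqP; rewrite eq_le le_ED_ER /=.
  exact: le_trans le_ER_H le_H_ED.
(* The measurement that always answers the first outcome shows that the supremum is over a nonempty
   set. *)
have pu : POVM (fun j : 'I_N => if j == Ordinal (info_pos hP X1) then 1%:M else 0 : 'M[R[i]]_dC).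
  split; first by move=> j; case: eqP => _; [exact: psd1 | exact: psd0].
  by rewrite -big_mkcond big_pred1_eq.
set S := (guess_value P X @` _)%classic.
have hS : has_sup S.
  split; first by exists (guess_value P X (fun j => if j == Ordinal (info_pos hP X1) then 1%:M else 0)); exists (fun j => if j == Ordinal (info_pos hP X1) then 1%:M else 0).
  by exists 1 => _ [Q pQ <-]; case/andP: (guess_value_bounds hP X1 pQ).
have fub sg : separable sg -> fidelity tau sg <= sup S.
  move=> ss; have [Q [pQ hQ]] := fidelity_le_guess hP X1 ss.
  by apply: le_trans hQ _; apply: sup_upper_bound => //; exists Q.
have hI : has_inf ((fun sg => 1 - fidelity tau sg) @` @separable R N (dA * dB))%classic.
  split; first by exists (1 - fidelity tau sigma); exists sigma.
  by exists (1 - sup S) => _ [sg ss <-]; rewrite lerD2l lerN2; apply: fub.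
apply/eqP; rewrite eq_le; apply/andP; split.
  rewrite lerBrDr -lerBrDl; apply: ge_sup; first by case: hS.
  move=> _ [Q pQ <-]; have [sg [ss hQ]] := guess_le_fidelity hP X1 pQ.
  rewrite lerBrDl -lerBrDr; apply: (@le_trans _ _ (1 - fidelity tau sg)).
    by apply: ge_inf; [case: hI | exists sg].
  by rewrite lerD2l lerN2.
by apply: lb_le_inf; [case: hI | move=> _ [sg ss <-]; rewrite lerD2l lerN2; apply: fub].
Qed.
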